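(* Let $p\in[1,\infty)\setminus\{2\}$ and let $\mathcal{G}^{(0)}\times\mathbb{T}\xrightarrow{i}\mathcal{E}\xrightarrow{\pi}\mathcal{G}$ be a twist over a topologically principal, locally compact, Hausdorff, étale groupoid $\mathcal{G}$ with compact unit space. Put $A=F^p_\lambda(\mathcal{G};\mathcal{E})$, let $\mathcal{G}_A$ be its Weyl groupoid and $\mathcal{E}_A$ its Weyl twist, with maps $i_A\colon X_A\times\mathbb{T}=\mathcal{G}^{(0)}\times\mathbb{T}\to\mathcal{E}_A$ and $\pi_A\colon\mathcal{E}_A\to\mathcal{G}_A$, and let $\theta\colon\mathcal{G}_A\to\mathcal{G}$ be the groupoid isomorphism $[\alpha_{\mathrm n},x]\mapsto B_{\mathrm n}x$. Then there is an isomorphism of (topological) groupoids $\varphi\colon\mathcal{E}_A\to\mathcal{E}$ such that $\varphi\circ i_A=i$ and $\pi\circ\varphi=\theta\circ\pi_A$.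
   Context: **Groupoids.** A groupoid $\mathcal G$ has unit space $\mathcal G^{(0)}$, range $r(\gamma)=\gamma\gamma^{-1}$ and source $s(\gamma)=\gamma^{-1}\gamma$; $\mathcal G_x=s^{-1}(x)$, $\mathcal G^x=r^{-1}(x)$. A locally compact (topological) groupoid is étale if $r\colon\mathcal G\to\mathcal G^{(0)}$ is a local homeomorphism. It is topologically principal if the set of $x\in\mathcal G^{(0)}$ with $\mathcal G_x\cap\mathcal G^x=\{x\}$ is dense in $\mathcal G^{(0)}$. An open bisection is an open $B\subseteq\mathcal G$ on which $r$ and $s$ restrict to homeomorphisms onto open subsets; for $x\in s(B)$, $Bx$ denotes the unique element of $B$ with source $x$. **Twists.** A twist over an étale groupoid $\mathcal G$ is a sequence $\mathcal G^{(0)}\times\mathbb T\xrightarrow{i}\mathcal E\xrightarrow{\pi}\mathcal G$, where $\mathcal G^{(0)}\times\mathbb T$ is the trivial group bundle with fibres $\mathbb T$, $\mathcal E$ is a locally compact Hausdorff groupoid, $i,\pi$ are continuous groupoid homomorphisms restricting to homeomorphisms of unit spaces, and: (1) $i$ is injective; (2) every $\gamma\in\mathcal G$ has a bisection neighbourhood $U$ with a continuous section $S\colon U\to\mathcal E$, $\pi\circ S=\mathrm{id}_U$, such that $(\gamma,z)\mapsto i(r(\gamma),z)S(\gamma)$ is a homeomorphism $U\times\mathbb T\to\pi^{-1}(U)$; (3) $i(r(\varepsilon),z)\varepsilon=\varepsilon i(s(\varepsilon),z)$ for all $\varepsilon\in\mathcal E,z\in\mathbb T$; (4) $\pi^{-1}(\mathcal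 G^{(0)})=i(\mathcal G^{(0)}\times\mathbb T)$. Write $z\cdot\varepsilon=i(r(\varepsilon),z)\varepsilon$; $\mathcal E^{(0)}$ is identified with $\mathcal G^{(0)}$ via $x\mapsto i(x,1)$. **The algebra.** $\Sigma_c(\mathcal G;\mathcal E)=\{f\in C_c(\mathcal E):f(z\cdot\varepsilon)=zf(\varepsilon)\ \forall\varepsilon\in\mathcal{E},z\in\mathbb{T}\}$. For $x\in\mathcal G^{(0)}$, $\mathcal E_x=s^{-1}(x)$ carries the measure $\nu_x$ which on each $\pi^{-1}(\gamma)$, $\gamma\in\mathcal G_x$, is the copy of normalized Haar measure of $\mathbb T$ under $z\mapsto z\cdot\delta$ (any $\delta\in\pi^{-1}(\gamma)$). The product on $\Sigma_c(\mathcal G;\mathcal E)$ is $(f\ast g)(\varepsilon)=\int_{\mathcal E_{s(\varepsilon)}}f(\varepsilon\gamma^{-1})g(\gamma)\,d\nu_{s(\varepsilon)}(\gamma)$. $L^p(\mathcal G_x;\mathcal E_x)$ is the space of $p$-integrable $\mathbb T$-equivariant functions on $\mathcal E_x$; $\lambda_x(f)\xi(\varepsilon)=\int_{\mathcal E_x}f(\varepsilon\gamma^{-1})\xi(\gamma)\,d\nu_x(\gamma)$ defines $\lambda_x\colon\Sigma_c(\mathcal G;\mathcal E)\to\mathcal B(L^p(\mathcal G_x;\mathcal E_x))$. $F^p_\lambda(\mathcal G;\mathcal E)$ is the completion of $\Sigma_c(\mathcal G;\mathcal E)$ in $\|f\|_\lambda=\sup_{x\in\mathcal G^{(0)}}\|\lambda_x(f)\|$.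 The inclusion $\Sigma_c(\mathcal G;\mathcal E)\to C_0(\mathcal E)$ extends to an injective contractive linear map $F^p_\lambda(\mathcal G;\mathcal E)\to C_0(\mathcal E)$, and elements $a\in F^p_\lambda(\mathcal{G};\mathcal{E})$ are regarded as functions on $\mathcal E$. **Core.** An $L^p$-operator algebra is a Banach algebra admitting an isometric homomorphism into $\mathcal B(E)$ for an $L^p$-space $E$. For a unital $L^p$-operator algebra $A$, $A_h=\{a:\|e^{ita}\|=1\ \forall t\in\mathbb R\}$ and $\mathrm{core}(A)=A_h+iA_h$; for $p\ne2$ this is a commutative unital $C^*$-algebra, with spectrum $X_A$, and $\mathrm{core}(A)$ is identified with $C(X_A)$. For $A=F^p_\lambda(\mathcal G;\mathcal E)$ one has $\mathrm{core}(A)=C(\mathcal G^{(0)})$, where $f\in C(\mathcal G^{(0)})$ is identified with the function supported in $i(\mathcal G^{(0)}\times\mathbb T)$ given by $i(x,z)\mapsto zf(x)$; thus $X_A=\mathcal G^{(0)}$. **Admissible pairs.** For open $U,V\subseteq X_A$ and a homeomorphism $\alpha\colon U\to V$, a pair $\mathrm n=(a,b)\in A\times A$ is an admissible pair realizing $\alpha$ (write $\alpha=\alpha_{\mathrm n}$, $U=U_{\mathrm n}$, $V=V_{\mathrm n}$) if: (1) $bfa,afb\in C(X_A)_+$ for all $f\in C(X_A)_+$ (the non-negative functions); (2) $U=\{x:ba(x)>0\}$, $V=\{x:ab(x)>0\}$; (3) $f(\alpha(x))\,ba(x)=bfa(x)$ and $g(\alpha^{-1}(y))\,ab(y)=agb(y)$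 for $x\in U,y\in V,f\in C_0(V),g\in C_0(U)$. Products, inverses, and scalar multiples ($z\in\mathbb{T}$) of admissible pairs: $(a,b)(c,d)=(ac,db)$, $(a,b)^\sharp=(b,a)$, $z\cdot(a,b)=(za,\overline zb)$. For $f\in C(X_A)$, $\mathrm n_f=(f,\overline f)$ is an admissible pair realizing the identity of $\{f\neq0\}$. **Weyl groupoid.** $\mathcal G_A$ is the groupoid of germs of the inverse semigroup of all partial homeomorphisms of $X_A$ realized by admissible pairs: its elements are classes $[\alpha,x]$ with $x\in\mathrm{dom}(\alpha)$, where $[\alpha,x]=[\beta,y]$ iff $x=y$ and $\alpha,\beta$ agree on a neighbourhood of $x$; $s[\alpha,x]=x$, $r[\alpha,x]=\alpha(x)$, $[\alpha,\beta(y)][\beta,y]=[\alpha\circ\beta,y]$, $[\alpha,x]^{-1}=[\alpha^{-1},\alpha(x)]$; basic open sets are $\{[\alpha,x]:x\in U\}$, $U\subseteq\mathrm{dom}(\alpha)$ open. **Weyl twist.** $\mathcal E_A=\{(\mathrm n,x):\mathrm n=(a,b)\text{ an admissible pair in }A,\ x\in X_A,\ ba(x)>0\}/\approx$, where $(\mathrm n,x)\approx(\mathrm m,y)$ iff $x=y$ and there are $f,g\in C(X_A)$ with $f(x),g(x)>0$ and $\mathrm n\mathrm n_f=\mathrm m\mathrm n_g$. The class of $(\mathrm n,x)$ is $[[\mathrm n,x]]$. Structure: $s([[\mathrm n,x]])=x$, $r([[\mathrm n,x]])=\alpha_{\mathrm n}(x)$, $[[\mathrm n,\alpha_{\mathrm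 m}(x)]][[\mathrm m,x]]=[[\mathrm{nm},x]]$, $[[\mathrm n,x]]^{-1}=[[\mathrm n^\sharp,\alpha_{\mathrm n}(x)]]$; basic open sets are $\{[[z\cdot\mathrm n,x]]:x\in U,z\in V\}$ for admissible pairs $\mathrm n$, open $U\subseteq U_{\mathrm n}$ and open $V\subseteq\mathbb T$. The maps are $i_A(x,z)=[[\mathrm n_f,x]]$ for any $f\in C(X_A)$ with $f(x)=z$, and $\pi_A([[\mathrm n,x]])=[\alpha_{\mathrm n},x]$. **The map $\theta$.** For an admissible pair $\mathrm n=(a,b)$ in $F^p_\lambda(\mathcal G;\mathcal E)$, the set $B_{\mathrm n}=\{\gamma\in\mathcal G:a(\varepsilon)\ne0\text{ and }b(\varepsilon^{-1})\neq0\text{ for }\varepsilon\in\pi^{-1}(\gamma)\}$ is an open bisection with $s(B_{\mathrm n})=U_{\mathrm n}$ and $r(B_{\mathrm n}x)=\alpha_{\mathrm n}(x)$, and $\theta([\alpha_{\mathrm n},x])=B_{\mathrm n}x$ is a well-defined isomorphism $\mathcal G_A\to\mathcal G$.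
   Formalization: In the Weyl twist, ≈ asks only that the first entries of n n_f and m n_g agree (equality of the pairs makes the claim false for every nonempty groupoid), and i_A(x,z)=[[n_f,x]] for f(x)=z̄ rather than f(x)=z, as the convention f(z·ε)=zf(ε) requires. *)

(* Defs.v *)
From HB Require Import structures.
Set Warnings "-all".
From mathcomp Require Import all_boot all_order all_algebra.
From mathcomp Require Import complex.
From mathcomp Require Import all_classical all_reals all_analysis.
From mathcomp Require Import measurable_realfun ring lra.

Set Implicit Arguments.
Unset Strict Implicit.
Unset Printing Implicit Defensive.

Import Order.TTheory GRing.Theory Num.Theory numFieldNormedType.Exports.
Local Open Scope classical_set_scope.
Local Open Scope ring_scope.

HB.instance Definition _ (R : realType) := GRing.ComAlgebra.copy R[i] R[i]^o.
HB.instance Definition _ (R : realType) := NormedModule.copy R[i] R[i]^o.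

Definition circle (R : realType) : Type := [set z : R[i] | `|z| = 1].
HB.instance Definition _ (R : realType) := Topological.on (circle R).

Section Circle.
Context {R : realType}.
Implicit Types z w : circle R.

Definition circle_val z : R[i] := set_val z.

Lemma circle_norm z : `|circle_val z| = 1.
Proof. exact: (set_valP z). Qed.

Definition mk_circle (c : R[i]) (h : `|c| = 1) : circle R :=
  exist _ c (mem_set h).

Fact circle_one_subproof : `|1 : R[i]| = 1.
Proof. exact: normr1. Qed.
Definition circle_one : circle R := mk_circle circle_one_subproof.

Fact circle_mul_subproof z w : `|circle_val z * circle_val w| = 1.
Proof. by rewrite normrM !circle_norm mulr1. Qed.
Definition circle_mul z w : circle R := mk_circle (circle_mul_subproof z w).

Fact circle_inv_subproof z : `|(circle_val z)^-1| = 1.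
Proof. by rewrite normfV circle_norm invr1. Qed.
Definition circle_inv z : circle R := mk_circle (circle_inv_subproof z).

Fact circle_exp_subproof (t : R) :
  `|Complex (cos (2 * pi * t)) (sin (2 * pi * t))| = 1.
Proof. by rewrite normc_def /= cos2Dsin2 sqrtr1. Qed.
Definition circle_exp (t : R) : circle R := mk_circle (circle_exp_subproof t).

Lemma circle_val_inj : injective circle_val.
Proof. exact: val_inj. Qed.

Lemma circle_mulE z w : circle_val (circle_mul z w) = circle_val z * circle_val w.
Proof. by []. Qed.

Lemma circle_invE z : circle_val (circle_inv z) = (circle_val z)^-1.
Proof. by []. Qed.

Lemma circle_mulA : associative circle_mul.
Proof. by move=> x y z; apply: circle_val_inj; rewrite !circle_mulE mulrA. Qed.

Lemma circle_neq0 z : circle_val z != 0.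
Proof. by rewrite -normr_eq0 circle_norm oner_eq0. Qed.

(* Normalized Haar measure: the image of Lebesgue measure on [0, 1]. *)
Definition circle_haar (B : set (circle R)) : \bar R :=
  lebesgue_measure (`[0, 1]%classic `&` circle_exp @^-1` B).

End Circle.

Definition homeomorphism_on (X Y : topologicalType) (A : set X) (B : set Y)
    (f : X -> Y) : Prop :=
  [/\ set_bij A B f, {within A, continuous f} &
      forall W : set X, open W ->
        exists2 W' : set Y, open W' & f @` (A `&` W) = B `&` W'].

Definition homeomorphism (X Y : topologicalType) (f : X -> Y) : Prop :=
  homeomorphism_on [set: X] [set: Y] f.

Definition local_homeomorphism (X Y : topologicalType) (f : X -> Y) : Prop :=
  forall x, exists U : set X,
    [/\ open U, U x, open (f @` U) & homeomorphism_on U (f @` U) f].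

(* A groupoid whose arrows (and hence whose units) carry a topology; continuity
   of the operations is [topological_groupoid] below. [gmul] is meaningful on
   composable pairs only. *)
Record groupoid := Groupoid {
  garrow :> topologicalType;
  gcomp : garrow -> garrow -> Prop;
  gmul : garrow -> garrow -> garrow;
  ginv : garrow -> garrow;
  ginvK : forall g, ginv (ginv g) = g;
  gcompA : forall g h k, gcomp g h -> gcomp h k ->
    [/\ gcomp (gmul g h) k, gcomp g (gmul h k) &
        gmul (gmul g h) k = gmul g (gmul h k)];
  gcompV : forall g, gcomp (ginv g) g;
  gmulKV : forall g h, gcomp g h -> gmul (ginv g) (gmul g h) = h;
  gmulVK : forall g h, gcomp g h -> gmul (gmul g h) (ginv h) = g }.

Section GroupoidTheory.
Context {G : groupoid}.
Implicit Types g h k u : G.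

Definition rng g : G := gmul g (ginv g).
Definition src g : G := gmul (ginv g) g.

Lemma gcompVr g : gcomp g (ginv g).
Proof. by have := gcompV (ginv g); rewrite ginvK. Qed.

Lemma gcomp_src_rng g h : gcomp g h -> src g = rng h.
Proof.
move=> gh; have [_ _ E] := gcompA gh (gcompVr h).
have [c _ _] := gcompA gh (gcompVr h).
have hh' : gcomp g (rng h) by have [] := gcompA gh (gcompVr h).
by rewrite /src -[X in gmul _ X](gmulVK gh) E gmulKV.
Qed.

Lemma src_inv g : src (ginv g) = rng g.
Proof. by rewrite /src ginvK. Qed.

Lemma src_mul g h : gcomp g h -> src (gmul g h) = src h.
Proof.
move=> gh; have [c _ _] := gcompA gh (gcompVr h).
by rewrite (gcomp_src_rng c) /rng ginvK.
Qed.

Lemma gcompP g h : src g = rng h -> gcomp g h.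
Proof.
move=> gh; have [_ c _] := gcompA (gcompVr g) (gcompV g).
have [c' _ _] := gcompA (gcompVr h) (gcompV h).
rewrite -/(src g) gh in c.
have [+ _ _] := gcompA c c'.
by rewrite -gh /src; have [_ _ <-] := gcompA (gcompVr g) (gcompV g);
  rewrite -[X in gmul _ X]ginvK gmulVK //; exact: gcompVr.
Qed.

Lemma rng_mul g h : gcomp g h -> rng (gmul g h) = rng g.
Proof.
move=> gh; have [_ c _] := gcompA (gcompV g) gh.
by rewrite -(gcomp_src_rng c) src_inv.
Qed.

Definition gunit : set G := range rng.

Lemma gunit_rng g : gunit (rng g).
Proof. by exists g. Qed.

Lemma gunit_src g : gunit (src g).
Proof. by rewrite -[g]ginvK src_inv; exact: gunit_rng. Qed.

Lemma src_unit u : gunit u -> src u = u.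
Proof.
by case=> g _ <-; rewrite /rng src_mul ?src_inv //; exact: gcompVr.
Qed.

Lemma rng_unit u : gunit u -> rng u = u.
Proof. by case=> g _ <-; rewrite {2}/rng rng_mul //; exact: gcompVr. Qed.

End GroupoidTheory.

(* The unit space, with the subspace topology. *)
Definition units (G : groupoid) : Type := @gunit G.
HB.instance Definition _ (G : groupoid) := Topological.on (units G).

Definition unit_val (G : groupoid) (x : units G) : G := set_val x.
Definition rng0 (G : groupoid) (g : G) : units G :=
  exist _ (rng g) (mem_set (gunit_rng g)).
Definition src0 (G : groupoid) (g : G) : units G :=
  exist _ (src g) (mem_set (gunit_src g)).

Definition topological_groupoid (G : groupoid) : Prop :=
  {within [set q : G * G | gcomp q.1 q.2],
     continuous (fun q : G * G => gmul q.1 q.2)} /\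
  continuous (@ginv G).

Definition etale (G : groupoid) : Prop := local_homeomorphism (@rng0 G).

Definition topologically_principal (G : groupoid) : Prop :=
  @gunit G `<=` closure [set x : G | gunit x /\
    [set g | src g = x] `&` [set g | rng g = x] = [set x]].

Definition open_bisection (G : groupoid) (B : set G) : Prop :=
  [/\ open B,
      open (@rng0 G @` B) /\ homeomorphism_on B (@rng0 G @` B) (@rng0 G) &
      open (@src0 G @` B) /\ homeomorphism_on B (@src0 G @` B) (@src0 G)].

Definition groupoid_morphism (G H : groupoid) (phi : G -> H) : Prop :=
  forall g h, gcomp g h ->
    gcomp (phi g) (phi h) /\ phi (gmul g h) = gmul (phi g) (phi h).

Section TrivialBundle.
Variables (R : realType) (X : topologicalType).
Let T : topologicalType := (X * circle R)%type.
Let comp (q q' : T) : Prop := q.1 = q'.1.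
Let mul (q q' : T) : T := (q.1, circle_mul q.2 q'.2).
Let inv (q : T) : T := (q.1, circle_inv q.2).

Definition trivial_bundle : groupoid.
Proof.
refine (@Groupoid T comp mul inv _ _ _ _ _); rewrite /comp /mul /inv.
- move=> [x z] /=; congr pair; apply: circle_val_inj.
  by rewrite !circle_invE invrK.
- by move=> [x z] [y w] [t v] /= -> ->; split=> //=; congr pair; exact/esym/circle_mulA.
- by [].
- move=> [x z] [y w] /= ->; congr pair; apply: circle_val_inj.
  by rewrite !(circle_mulE, circle_invE) mulKf ?circle_neq0.
- move=> [x z] [y w] /= xy; congr pair; apply: circle_val_inj.
  by rewrite !(circle_mulE, circle_invE) mulfK ?circle_neq0.
Defined.

End TrivialBundle.

(* By [tw_pi_unit], the identification x |-> i(x, 1) of G^(0) with E^(0) is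
   inverse to the one given by [tw_pi]; so the range of [e : tw_E], seen as a
   point of G^(0), is [rng0 (tw_pi e)]. *)
Record twist (R : realType) (G : groupoid) := Twist {
  tw_E : groupoid;
  tw_i : trivial_bundle R (units G) -> tw_E;
  tw_pi : tw_E -> G;
  tw_E_topological : topological_groupoid tw_E;
  tw_E_locally_compact : locally_compact [set: tw_E];
  tw_E_hausdorff : hausdorff_space tw_E;
  tw_i_continuous : continuous tw_i;
  tw_i_morphism : groupoid_morphism tw_i;
  tw_i_units : homeomorphism_on (@gunit (trivial_bundle R (units G)))
                 (@gunit tw_E) tw_i;
  tw_pi_continuous : continuous tw_pi;
  tw_pi_morphism : groupoid_morphism tw_pi;
  tw_pi_units : homeomorphism_on (@gunit tw_E) (@gunit G) tw_pi;
  tw_pi_unit : forall x, tw_pi (tw_i (x, circle_one)) = unit_val x;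
  tw_i_inj : injective tw_i;
  tw_section : forall g : G, exists (U : set G) (S : G -> tw_E),
    [/\ open_bisection U /\ U g,
        {within U, continuous S},
        forall h, U h -> tw_pi (S h) = h &
        homeomorphism_on (U `*` [set: circle R]) (tw_pi @^-1` U)
          (fun q : G * circle R => gmul (tw_i (rng0 q.1, q.2)) (S q.1))];
  tw_central : forall (e : tw_E) (z : circle R),
    gmul (tw_i (rng0 (tw_pi e), z)) e = gmul e (tw_i (src0 (tw_pi e), z));
  tw_kernel : tw_pi @^-1` @gunit G = range tw_i }.

Arguments tw_i {R G} t _.
Arguments tw_pi {R G} t _.

Section TwistTheory.
Context {R : realType} {G : groupoid} (T : twist R G).
Local Notation E := (tw_E T).
Local Notation C := R[i].

Definition tw_unit (x : units G) : E := tw_i T (x, circle_one).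

Definition tw_act (z : circle R) (e : E) : E :=
  gmul (tw_i T (rng0 (tw_pi T e), z)) e.

Lemma gunit_trivial (x : units G) :
  @gunit (trivial_bundle R (units G)) (x, circle_one).
Proof.
exists (x, circle_one) => //; rewrite /rng /=; congr pair.
by apply: circle_val_inj; rewrite circle_mulE circle_invE invr1 mulr1.
Qed.

Lemma gunit_tw_unit x : gunit (tw_unit x).
Proof.
by have [[h _ _] _ _] := @tw_i_units R G T; apply: h; exact: gunit_trivial.
Qed.

Lemma src_tw_i x z : src (tw_i T (x, z)) = tw_unit x.
Proof.
have [] := @tw_i_morphism R G T (x, z) (x, circle_one) erefl.
by move=> /gcomp_src_rng -> _; exact/rng_unit/gunit_tw_unit.
Qed.

Lemma rng_tw (e : E) : rng e = tw_unit (rng0 (tw_pi T e)).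
Proof.
have [[_ _ onto] _ _] := @tw_i_units R G T.
have [[x z] [[y w] _ xz] re] := onto _ (gunit_rng e).
have {xz} z1 : z = circle_one.
  case: xz => _ <-; apply: circle_val_inj.
  by rewrite circle_mulE circle_invE mulfV ?circle_neq0.
rewrite -re z1 /tw_unit; congr (tw_i T (_, _)); apply: val_inj => /=.
rewrite -[LHS](tw_pi_unit T) -z1 re.
have [c _ _] := gcompA (gcompVr e) (gcompV e).
have [cp _] := @tw_pi_morphism R G T _ _ c.
rewrite -(gcomp_src_rng cp) src_unit //.
have [[h _ _] _ _] := @tw_pi_units R G T; exact/h/gunit_rng.
Qed.

Lemma gcomp_act z e : gcomp (tw_i T (rng0 (tw_pi T e), z)) e.
Proof. by apply: gcompP; rewrite src_tw_i rng_tw. Qed.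

Lemma src_act z e : src (tw_act z e) = src e.
Proof. exact/src_mul/gcomp_act. Qed.

Lemma src_tw_unit x : src (tw_unit x) = tw_unit x.
Proof. exact/src_unit/gunit_tw_unit. Qed.

End TwistTheory.

Lemma esum_exchange (R : realType) (I J : choiceType) (A : set I) (B : set J)
    (a : I -> J -> \bar R) : (forall i j, 0 <= a i j)%E ->
  (\esum_(i in A) \esum_(j in B) a i j = \esum_(j in B) \esum_(i in A) a i j)%E.
Proof.
move=> a0; rewrite !esum_esum //.
rewrite (@reindex_esum R _ _ (B `*` A) _ (fun q => (q.2, q.1))) //.
split=> [[j i] [? ?]|[j i] [j' i'] _ _ [-> ->]|[i j] [? ?]] //=.
by exists (j, i).
Qed.

Lemma continuous_circle_exp (R : realType) : continuous (@circle_exp R).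
Proof.
apply: continuous_comp_initial => t; apply/cvgrPdist_lt => -[e ei].
rewrite ltcE /= => /andP[/eqP -> {ei} er].
have ct : {for t, continuous (fun t : R => cos (2 * pi * t))}.
  apply: (@continuous_comp _ _ _ ( *%R (2 * pi)) cos).
    exact: mulrl_continuous.
  exact: continuous_cos.
have st : {for t, continuous (fun t : R => sin (2 * pi * t))}.
  apply: (@continuous_comp _ _ _ ( *%R (2 * pi)) sin).
    exact: mulrl_continuous.
  exact: continuous_sin.
have e2 : 0 < e / 2 by rewrite divr_gt0 // ltr0n.
move/cvgrPdist_lt : ct => /(_ _ e2); move/cvgrPdist_lt : st => /(_ _ e2).
move=> st ct; near=> s.
have cs : `|cos (2 * pi * t) - cos (2 * pi * s)| < e / 2 by near: s.
have ss : `|sin (2 * pi * t) - sin (2 * pi * s)| < e / 2 by near: s.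
rewrite normc_def ltcE /= eqxx /=.
set u := _ - _ in cs; set v := _ - _ in ss.
rewrite -(ger0_norm (ltW er)) -sqrtr_sqr ltr_sqrt ?exprn_gt0 //.
rewrite -(real_normK (num_real u)) -(real_normK (num_real v)).
have u0 := normr_ge0 u; have v0 := normr_ge0 v.
by nra.
Unshelve. all: by end_near. Qed.

Definition tw_fibre (R : realType) (G : groupoid) (T : twist R G)
  (x : units G) : Type := [set e : tw_E T | src e = tw_unit T x].
HB.instance Definition _ R G (T : twist R G) x :=
  Topological.on (tw_fibre T x).
HB.instance Definition _ R G (T : twist R G) x :=
  isPointed.Build (tw_fibre T x)
    (exist _ (tw_unit T x) (mem_set (src_tw_unit T x))).

Section Fibre.
Context {R : realType} {G : groupoid} (T : twist R G) (x : units G).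
Local Notation E := (tw_E T).
Local Notation Ex := (tw_fibre T x).
Local Notation C := R[i].

Definition fibre_val (e : Ex) : E := set_val e.

Fact fibre_act_subproof z (e : Ex) : src (tw_act z (fibre_val e)) = tw_unit T x.
Proof. by rewrite src_act; exact: (set_valP e). Qed.
Definition fibre_act (z : circle R) (e : Ex) : Ex :=
  exist _ (tw_act z (fibre_val e)) (mem_set (fibre_act_subproof z e)).

Definition fibre_borel := g_sigma_algebraType (@open Ex).

(* An arbitrary point of [fibre_val @` Ex] over [g], if [src g = x]. *)
Definition fibre_lift (g : G) : Ex := get [set e | tw_pi T (fibre_val e) = g].

Definition nu (A : set fibre_borel) : \bar R :=
  \esum_(g in [set g : G | src g = unit_val x])
     circle_haar [set z | A (fibre_act z (fibre_lift g))].

Lemma continuous_fibre_act (e : Ex) : continuous (fun z => fibre_act z e).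
Proof.
apply: continuous_comp_initial => z.
pose h (w : circle R) : E * E :=
  (tw_i T (rng0 (tw_pi T (fibre_val e)), w), fibre_val e).
have ch : continuous h.
  move=> w; have Fw : Filter (nbhs w) by exact: nbhs_filter.
  pose y := rng0 (tw_pi T (fibre_val e)).
  have cy : (fun _ : circle R => y) @ w --> y.
    exact: (@cvg_cst (units G) y _ (nbhs w)).
  have ce : (fun _ : circle R => fibre_val e) @ w --> fibre_val e.
    exact: (@cvg_cst E (fibre_val e) _ (nbhs w)).
  have cw : (fun v : circle R => v) @ w --> w by exact: cvg_id.
  have c2 : (fun v => tw_i T (y, v)) @ w --> tw_i T (y, w).
    apply: (@continuous_comp _ _ _ (fun v => (y, v)) (tw_i T)).
      exact: (cvg_pair cy cw).
    exact: tw_i_continuous.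
  exact: (cvg_pair c2 ce).
have [cm _] := tw_E_topological T.
move/subspace_continuousP : cm => /(_ (h z) (gcomp_act z (fibre_val e))) cm.
have Fz : Filter (nbhs z) by exact: nbhs_filter.
move=> U /cm nU; apply: (@filterS _ _ Fz _ _ _ (ch z _ nU)) => w /=.
by apply; exact: gcomp_act.
Qed.

Lemma measurable_orbit (e : Ex) (A : set fibre_borel) : measurable A ->
  measurable [set t : R | A (fibre_act (circle_exp t) e)].
Proof.
pose f (t : measurableTypeR R) : fibre_borel := fibre_act (circle_exp t) e.
suff mf : measurable_fun setT f.
  by move=> mA; have := mf measurableT _ mA; rewrite setTI.
apply: (@measurability _ _ _ _ setT f (@open Ex)) => // _ [U oU <-].
rewrite setTI; apply: open_measurable.
have cf : continuous (f : R -> Ex).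
  move=> t.
  apply: (@continuous_comp R _ _ (@circle_exp R) (fun z => fibre_act z e)).
    exact: continuous_circle_exp.
  exact: continuous_fibre_act.
exact: (proj1 (@continuousP R Ex f) cf U oU).
Qed.

Let nu0 : nu set0 = 0%E.
Proof.
rewrite /nu esum1 // => g _; rewrite /circle_haar.
by rewrite (_ : _ `&` _ = set0) ?measure0 //; apply/seteqP; split=> // t [].
Qed.

Let nu_ge0 A : (0 <= nu A)%E.
Proof. by apply: esum_ge0 => g _; exact: measure_ge0. Qed.

Let nu_sigma : semi_sigma_additive nu.
Proof.
move=> F mF tF mUF.
have mo n g : measurable
    (`[0, 1]%classic `&` [set t : R | F n (fibre_act (circle_exp t) (fibre_lift g))]).
  by apply: measurableI => //; exact: measurable_orbit.
suff -> : nu (\bigcup_n F n) = (\sum_(n <oo) nu (F n))%E.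
  by apply: is_cvg_nneseries => n _ _; exact: nu_ge0.
rewrite nneseries_esumT; last by move=> n; exact: nu_ge0.
rewrite /nu esum_exchange; last by move=> *; exact: measure_ge0.
apply: eq_esum => g _; rewrite -nneseries_esumT; last first.
  by move=> n; exact: measure_ge0.
rewrite /circle_haar -measure_semi_bigcup //.
- by congr lebesgue_measure; rewrite -setI_bigcupr.
- by move=> n; exact: mo.
- move=> i j _ _ [t [[_ Fi] [_ Fj]]]; apply: tF => //.
  by exists (fibre_act (circle_exp t) (fibre_lift g)).
- by apply: bigcupT_measurable => n; exact: mo.
Qed.

HB.instance Definition _ := isMeasure.Build _ fibre_borel R nu
  nu0 nu_ge0 nu_sigma.

End Fibre.

Arguments nu {R G} T x A.

Section TwistedAlgebra.
Context {R : realType} {G : groupoid} (T : twist R G).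
Local Notation E := (tw_E T).
Local Notation C := R[i].

Definition Sigma_c : set (E -> C) := [set f |
  [/\ continuous f, compact (closure [set e | f e != 0]) &
      forall z e, f (tw_act z e) = circle_val z * f e]].

Definition fibre_integral (x : units G) (h : tw_fibre T x -> C) : C :=
  Complex (\int[nu T x]_(e in setT) complex.Re (h e))
          (\int[nu T x]_(e in setT) complex.Im (h e)).

Definition convolution (f g : E -> C) (e : E) : C :=
  fibre_integral (fun c : tw_fibre T (src0 (tw_pi T e)) =>
    f (gmul e (ginv (fibre_val c))) * g (fibre_val c)).

(* An equivariant function vanishing nu_x-almost everywhere is zero, so elements
   of L^p(G_x; E_x) are genuine functions. *)
Definition Lp_norm (p : R) (x : units G) (xi : tw_fibre T x -> C) : \bar R :=
  Lnorm (nu T x) p%:E (fun e => (complex.Re `|xi e|)%:E).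

Definition Lp_space (p : R) (x : units G) : set (tw_fibre T x -> C) :=
  [set xi |
    [/\ measurable_fun [set: fibre_borel T x] (fun e => complex.Re (xi e)) /\
        measurable_fun [set: fibre_borel T x] (fun e => complex.Im (xi e)),
        forall z e, xi (fibre_act z e) = circle_val z * xi e &
        (Lp_norm p xi < +oo)%E]].

Definition lambda (x : units G) (f : E -> C) (xi : tw_fibre T x -> C)
    (e : tw_fibre T x) : C :=
  fibre_integral (fun c : tw_fibre T x =>
    f (gmul (fibre_val e) (ginv (fibre_val c))) * xi c).

Definition lambda_norm (p : R) (x : units G) (f : E -> C) : \bar R :=
  ereal_sup [set Lp_norm p (lambda f xi) |
    xi in [set xi : tw_fibre T x -> C | Lp_space p xi /\ (Lp_norm p xi <= 1)%E]].

(* The value 0 only matters when the unit space is empty. *)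
Definition reduced_norm (p : R) (f : E -> C) : \bar R :=
  ereal_sup ([set 0%E] `|` range (fun x => lambda_norm p x f)).

End TwistedAlgebra.

(* The condition 1 != 0 is not imposed. *)
Record banach_algebra (K : numFieldType) := BanachAlgebra {
  ba_sort :> completeNormedModType K;
  ba_mul : ba_sort -> ba_sort -> ba_sort;
  ba_one : ba_sort;
  ba_mulA : associative ba_mul;
  ba_mul1l : left_id ba_one ba_mul;
  ba_mul1r : right_id ba_one ba_mul;
  ba_mulDl : left_distributive ba_mul +%R;
  ba_mulDr : right_distributive ba_mul +%R;
  ba_scaleAl : forall k a b, k *: ba_mul a b = ba_mul (k *: a) b;
  ba_scaleAr : forall k a b, k *: ba_mul a b = ba_mul a (k *: b);
  ba_norm_mul : forall a b, `|ba_mul a b| <= `|a| * `|b| }.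

Notation "a ** b" := (ba_mul a b) (at level 40, left associativity) : ring_scope.

(* The completion of Sigma_c(G; E) in the reduced norm: a Banach algebra
   containing an isometric dense copy of Sigma_c(G; E). [ra_in] is meaningful
   on [Sigma_c] only. *)
Record reduced_algebra (R : realType) (G : groupoid) (T : twist R G) (p : R) :=
  ReducedAlgebra {
    ra_sort :> banach_algebra R[i];
    ra_in : (tw_E T -> R[i]) -> ra_sort;
    ra_inD : forall f g, Sigma_c f -> Sigma_c g ->
      ra_in (fun e => f e + g e) = ra_in f + ra_in g;
    ra_inZ : forall k f, Sigma_c f -> ra_in (fun e => k * f e) = k *: ra_in f;
    ra_inM : forall f g, Sigma_c f -> Sigma_c g ->
      ra_in (convolution f g) = ra_in f ** ra_in g;
    ra_in_norm : forall f, Sigma_c f ->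
      (complex.Re `|ra_in f|)%:E = reduced_norm p f;
    ra_in_dense : closure (ra_in @` @Sigma_c R G T) = setT }.

Section Core.
Context {R : realType} (A : banach_algebra R[i]).

Definition ba_exp (a : A) : A :=
  lim (series (fun n => (n`!%:R)^-1 *: iter n (ba_mul a) (ba_one A)) @ \oo).

Definition ba_hermitian (a : A) : Prop :=
  forall t : R, `|ba_exp (Complex 0 t *: a)| = 1.

Definition core : set A :=
  [set a | exists h k : A, [/\ ba_hermitian h, ba_hermitian k & a = h + 'i%C *: k]].

End Core.

(* A partial homeomorphism; the values of [papply] outside [pdom] are
   irrelevant. *)
Record partial_map (X : Type) := PartialMap {
  pdom : set X;
  papply :> X -> X }.

Section PartialMap.
Context {X : topologicalType}.
Implicit Types alpha beta : partial_map X.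

Definition pcod alpha : set X := alpha @` pdom alpha.

Definition pcomp alpha beta : partial_map X :=
  PartialMap (pdom beta `&` beta @^-1` pdom alpha) (alpha \o beta).

Definition pinverse alpha : partial_map X :=
  PartialMap (pcod alpha)
    (fun y => xget y [set x | pdom alpha x /\ alpha x = y]).

Definition partial_homeo alpha : Prop :=
  [/\ open (pdom alpha), open (pcod alpha) &
      homeomorphism_on (pdom alpha) (pcod alpha) alpha].

End PartialMap.

(* A topological space with a partial product and an inversion, both given by
   their graphs ([gd_prod g h k] means g h = k). The operations of the Weyl
   groupoid and the Weyl twist are described on representatives; a bijection as
   in [groupoid_iso] onto a groupoid entails that they are well defined and
   satisfy the groupoid axioms. *)
Record groupoid_data := GroupoidData {
  gd_sort :> topologicalType;
  gd_prod : gd_sort -> gd_sort -> gd_sort -> Prop;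
  gd_inv : gd_sort -> gd_sort -> Prop }.

Definition groupoid_graph (G : groupoid) : groupoid_data :=
  @GroupoidData G (fun g h k => gcomp g h /\ gmul g h = k)
    (fun g h => ginv g = h).

Definition groupoid_iso (D D' : groupoid_data) (phi : D -> D') : Prop :=
  [/\ homeomorphism phi,
      forall g h k, gd_prod g h k <-> gd_prod (phi g) (phi h) (phi k) &
      forall g h, gd_inv g h <-> gd_inv (phi g) (phi h)].

(* [X] is the spectrum X_A of core(A), and [ev f x] is the value at [x] of the
   function on X_A with which [f : A], if it belongs to core(A), is
   identified. *)
Section Weyl.
Context {R : realType} (A : banach_algebra R[i]) (X : topologicalType).
Variable ev : A -> X -> R[i].
Implicit Types (a b f g : A) (n m : A * A) (x y : X).
Implicit Types (alpha beta : partial_map X).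

Definition core_nonneg f : Prop := core f /\ forall x, 0 <= ev f x.

(* C_0(V), X being compact. *)
Definition core_c0 (V : set X) f : Prop :=
  core f /\ forall x, ~ V x -> ev f x = 0.

Definition core_conj f g : Prop :=
  [/\ core f, core g & forall x, ev g x = ((ev f x)^*)%C].

Definition pair_mul n m : A * A := (n.1 ** m.1, m.2 ** n.2).
Definition pair_sharp n : A * A := (n.2, n.1).
Definition pair_scale (z : circle R) n : A * A :=
  (circle_val z *: n.1, ((circle_val z)^*)%C *: n.2).

Definition pair_dom n : set X := [set x | 0 < ev (n.2 ** n.1) x].
Definition pair_cod n : set X := [set y | 0 < ev (n.1 ** n.2) y].

Definition realizes n alpha : Prop :=
  let: (a, b) := n in
  [/\ partial_homeo alpha,
      forall f, core_nonneg f ->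
        core_nonneg (b ** f ** a) /\ core_nonneg (a ** f ** b),
      pdom alpha = pair_dom n /\ pcod alpha = pair_cod n,
      forall x f, pdom alpha x -> core_c0 (pcod alpha) f ->
        ev f (alpha x) * ev (b ** a) x = ev (b ** f ** a) x &
      forall y g, pcod alpha y -> core_c0 (pdom alpha) g ->
        ev g (pinverse alpha y) * ev (a ** b) y = ev (a ** g ** b) y].

Definition admissible n : Prop := exists alpha, realizes n alpha.
Definition realizable alpha : Prop := exists n, realizes n alpha.

(* The class [alpha, x] of the groupoid of germs. *)
Definition germ alpha x : set (partial_map X * X) :=
  [set q | [/\ realizable q.1, pdom q.1 q.2, q.2 = x &
     \forall w \near x, [/\ pdom alpha w, pdom q.1 w & alpha w = q.1 w]]].

Definition weyl_germ : Type :=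
  [set S | exists alpha x, [/\ realizable alpha, pdom alpha x & S = germ alpha x]].
HB.instance Definition _ := Choice.on weyl_germ.

Definition germ_val (u : weyl_germ) : set (partial_map X * X) := set_val u.

Definition weyl_germ_basis : set (set weyl_germ) :=
  [set O | exists alpha U, [/\ realizable alpha, open U, U `<=` pdom alpha &
     O = [set u | exists2 x, U x & germ_val u = germ alpha x]]].
HB.instance Definition _ :=
  isSubBaseTopological.Build weyl_germ weyl_germ_basis id.

Definition weyl_groupoid : groupoid_data :=
  @GroupoidData weyl_germ
    (fun u v w => exists alpha beta y,
       [/\ realizable alpha /\ realizable beta,
           pdom beta y /\ pdom alpha (beta y),
           germ_val u = germ alpha (beta y), germ_val v = germ beta y &
           germ_val w = germ (pcomp alpha beta) y])
    (fun u v => exists alpha x,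
       [/\ realizable alpha, pdom alpha x, germ_val u = germ alpha x &
           germ_val v = germ (pinverse alpha) (alpha x)]).

(* For n = (a, b) and m = (c, d): there are f, g in C(X_A), positive at x, such
   that n n_f and m n_g have the same first entry, a f = c g. Equality of the
   pairs (a f, f^* b) = (c g, g^* d) must not be required: it would force
   c / a = (d / b)^* near x, so that the pairs (1, 1) and (1, 2), both realizing
   the identity, would give two elements of the Weyl twist over the same unit
   that do not differ by an element of the circle. *)
Definition weyl_equiv n m x : Prop :=
  exists f g, [/\ core f, core g, 0 < ev f x, 0 < ev g x &
    n.1 ** f = m.1 ** g].

(* [pair_class n x] is the class [[n, x]]. *)
Definition pair_class n x : set ((A * A) * X) :=
  [set q | [/\ admissible q.1, pair_dom q.1 q.2, q.2 = x & weyl_equiv n q.1 x]].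

Definition weyl_arrow : Type :=
  [set S | exists n x, [/\ admissible n, pair_dom n x & S = pair_class n x]].
HB.instance Definition _ := Choice.on weyl_arrow.

Definition arrow_val (u : weyl_arrow) : set ((A * A) * X) := set_val u.

Definition weyl_arrow_basis : set (set weyl_arrow) :=
  [set O | exists n U (V : set (circle R)),
     [/\ admissible n, open U /\ U `<=` pair_dom n, open V &
         O = [set u | exists x z,
           [/\ U x, V z & arrow_val u = pair_class (pair_scale z n) x]]]].
HB.instance Definition _ :=
  isSubBaseTopological.Build weyl_arrow weyl_arrow_basis id.

Definition weyl_twist : groupoid_data :=
  @GroupoidData weyl_arrow
    (fun u v w => exists n m alpha x,
       [/\ admissible n /\ realizes m alpha,
           pair_dom m x /\ pair_dom n (alpha x),
           arrow_val u = pair_class n (alpha x), arrow_val v = pair_class m x &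
           arrow_val w = pair_class (pair_mul n m) x])
    (fun u v => exists n alpha x,
       [/\ realizes n alpha, pair_dom n x, arrow_val u = pair_class n x &
           arrow_val v = pair_class (pair_sharp n) (alpha x)]).

(* i_A(x, z) is the class of (f, f^* ) for any f with f(x) = z^*. The conjugate
   is due to the convention f(z . e) = z f(e) of [Sigma_c]: the class of an
   admissible pair (a, b) corresponds to the e with a(e) > 0, and for a = f as
   above, a(i(x, w)) = w f(x) is positive at w = z. With the convention
   f(z . e) = z^* f(e) it would be f(x) = z. *)
Definition is_weyl_i (iA : X * circle R -> weyl_twist) : Prop :=
  forall x z f f', core_conj f f' -> ev f x = ((circle_val z)^*)%C ->
    arrow_val (iA (x, z)) = pair_class (f, f') x.

Definition is_weyl_pi (piA : weyl_twist -> weyl_groupoid) : Prop :=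
  forall n alpha x u, realizes n alpha -> pair_dom n x ->
    arrow_val u = pair_class n x -> germ_val (piA u) = germ alpha x.

End Weyl.

Section WeylReduced.
Context {R : realType} {G : groupoid} {T : twist R G} {p : R}.
Variable A : reduced_algebra T p.
Local Notation E := (tw_E T).

(* The continuous extension to A of the inclusion of Sigma_c(G; E) in the
   functions on E: the limit of f(e) as f in Sigma_c(G; E) tends to a. *)
Definition ra_fun (a : A) (e : E) : R[i] :=
  lim ((fun f : E -> R[i] => f e) @
    filter_from [set d : R[i] | 0 < d]
      (fun d => [set f | Sigma_c f /\ `|ra_in A f - a| < d])).

(* Through this evaluation core(A) is C(G^(0)) and X_A is G^(0): an element of
   core(A) is a function i(x, z) |-> z f(x) supported in i(G^(0) x T). *)
Definition ra_ev (a : A) (x : units G) : R[i] := ra_fun a (tw_unit T x).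

Definition ra_weyl_groupoid : groupoid_data := weyl_groupoid ra_ev.
Definition ra_weyl_twist : groupoid_data := weyl_twist ra_ev.

Definition bisection_of (n : A * A) : set G :=
  [set g | forall e : E, tw_pi T e = g ->
     ra_fun n.1 e != 0 /\ ra_fun n.2 (ginv e) != 0].

Definition is_theta (theta : ra_weyl_groupoid -> G) : Prop :=
  forall n alpha x u, realizes ra_ev n alpha -> pdom alpha x ->
    germ_val u = germ ra_ev alpha x ->
    bisection_of n (theta u) /\ src (theta u) = unit_val x.

End WeylReduced.

(* Main.v *)
Require Import Defs.
From HB Require Import structures.
Set Warnings "-all".
From mathcomp Require Import all_boot all_order all_algebra.
From mathcomp Require Import complex.
From mathcomp Require Import all_classical all_reals all_analysis.
From mathcomp Require Import measurable_realfun ring lra.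

(** Every element a of the reduced algebra is a function on E, and nothing is
    lost: the function determines a, and its values a(g h^-1) along a fibre of
    the source map form a matrix acting on l^p with norm at most |a|. Products
    are limits of finite convolution sums, uniformly when a function on the unit
    space bounded by 1 is inserted ([mul_approx]). The theorem is then read off
    these functions.

    The core consists of the functions supported over the unit space ([coreP]).
    If a is Hermitian, exp(i t a) is a contraction of l^p for all real t, and the
    first-order term in t gives a linear relation between the entries of a for
    every vector; on vectors with two entries of moduli 1 and r the two
    off-diagonal entries appear with weights 1 and r^(p-2), and for p <> 2 these
    relations force them to vanish ([hermitian_offdiag]).

    Let n = (a, b) be a pair for which b f a and a f b are positive functions on
    the unit space whenever f is. Over a unit with trivial isotropy, a bump
    function f isolates one term of the convolution b f a ([isolate]); such units
    being dense, a(e) b(d^-1) = 0 everywhere for e and d over distinct arrows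
    with the same source or the same range, and b(e^-1) a(e) >= 0 always
    ([compressesP]). Consequently the arrows on which neither a(e) nor b(e^-1)
    vanishes form an open bisection, the map realized by n follows it
    ([realizesP]), and over each of its arrows exactly one element e of E has
    a(e) > 0 and b(e^-1) > 0: the element that n represents there.

    Two pairs are equivalent over a unit x if and only if they represent the same
    element over x ([weyl_equivP]); two realized maps have the same germ at x if
    and only if the bisections contain the same arrow over x, again by density of
    trivial isotropy ([germ_eq]). So classes of pairs are elements of E, germs
    are arrows of G, and these bijections phi and theta respect the operations
    because the element represented by a product of pairs is the product of the
    elements ([represents_mul]). Functions supported over bisections show that
    every element of E is represented ([exists_normalizing]) and, together with
    the continuity of the functions of the algebra, that phi and theta are
    homeomorphisms. The maps of the Weyl twist are obtained by transporting i and
    pi through phi and theta. *)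

Set Implicit Arguments.
Unset Strict Implicit.
Unset Printing Implicit Defensive.

Import Order.TTheory GRing.Theory Num.Theory numFieldNormedType.Exports.
Local Open Scope classical_set_scope.
Local Open Scope ring_scope.
Local Open Scope complex_scope.

(** * Norms of complex vectors and the topology of the circle *)

Lemma near_all_seq (I : eqType) (X : Type) (F : set_system X) (FF : Filter F)
    (s : seq I) (P : I -> X -> Prop) :
  {in s, forall i, \forall y \near F, P i y} ->
  \forall y \near F, {in s, forall i, P i y}.
Proof.
elim: s => [|i s IH] h; first by apply: filterE.
have hi : \forall y \near F, P i y by apply: h; rewrite inE eqxx.
have hs : \forall y \near F, {in s, forall j, P j y}.
  by apply: IH => j js; apply: h; rewrite inE js orbT.
by apply: filterS2 hi hs => y Pi Ps j /[!inE]/orP[/eqP ->//|/Ps].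
Qed.

Section RealNorm.
Context {R : realType} {V : normedModType R[i]}.
Implicit Types (v w : V) (z : R[i]).

(** The norm of a complex normed space is complex-valued; estimates use its real
    part, which carries the same information. *)
Definition nrm v : R := complex.Re `|v|.

Lemma nrmE v : `|v| = (nrm v)%:C.
Proof.
by have := normr_ge0 v; rewrite /nrm; case: `|v| => a b; rewrite lecE /= => /andP[/eqP -> _].
Qed.

Lemma nrm_ge0 v : 0 <= nrm v.
Proof. by rewrite -ler0c -nrmE normr_ge0. Qed.

Lemma nrmD v w : nrm (v + w) <= nrm v + nrm w.
Proof. by rewrite -lecR rmorphD /= -!nrmE ler_normD. Qed.

Lemma nrmN v : nrm (- v) = nrm v.
Proof. by rewrite /nrm normrN. Qed.

Lemma nrmB v w : nrm (v - w) <= nrm v + nrm w.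
Proof. by rewrite -(nrmN w) nrmD. Qed.

Lemma nrmC v w : nrm (v - w) = nrm (w - v).
Proof. by rewrite /nrm distrC. Qed.

Lemma nrm0 : nrm 0 = 0.
Proof. by rewrite /nrm normr0. Qed.

Lemma nrm_eq0 v : (nrm v == 0) = (v == 0).
Proof. by rewrite -[v == 0]normr_eq0 nrmE eq_complex /= eqxx andbT. Qed.

Lemma nrm_gt0 v : (0 < nrm v) = (v != 0).
Proof. by rewrite lt_def nrm_ge0 nrm_eq0 andbT. Qed.

Lemma nrm_sum (I : Type) (r : seq I) (P : pred I) (F : I -> V) :
  nrm (\sum_(i <- r | P i) F i) <= \sum_(i <- r | P i) nrm (F i).
Proof.
elim/big_ind2: _ => [|x1 x2 y1 y2 h1 h2|//]; first by rewrite nrm0.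
exact: le_trans (nrmD _ _) (lerD h1 h2).
Qed.

Lemma cvg_nrm (T : Type) (F : set_system T) (FF : Filter F) (f : T -> V) v :
  f @ F --> v <-> forall e : R, 0 < e -> \forall x \near F, nrm (v - f x) < e.
Proof.
split=> [/cvgrPdist_lt h e e0|h].
  have e0' : 0 < e%:C by rewrite ltcR.
  near=> x; rewrite -ltcR -nrmE; near: x; exact: h.
apply/cvgrPdist_lt => -[e ei]; rewrite ltcE /= => /andP[/eqP -> e0].
near=> x; rewrite nrmE -[Complex _ _]/(e%:C) ltcR; near: x; exact: h.
Unshelve. all: by end_near. Qed.

End RealNorm.

Section ComplexNorm.
Context {R : realType}.
Implicit Types (z w : R[i]).

Lemma cabsM z w : nrm (z * w) = nrm z * nrm w.
Proof. by rewrite /nrm normrM !nrmE /= !mulr0 subr0. Qed.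

Lemma nrmZ (V : normedModType R[i]) z (v : V) : nrm (z *: v) = nrm z * nrm v.
Proof. by rewrite /nrm normrZ !nrmE /= !mulr0 subr0. Qed.

Lemma cabs1 : nrm (1 : R[i]) = 1.
Proof. by rewrite /nrm normr1. Qed.

Lemma cabsR (x : R) : nrm x%:C = `|x|.
Proof. by rewrite /nrm normc_def /= expr0n addr0 sqrtr_sqr. Qed.

Lemma cabsJ z : nrm (conjc z) = nrm z.
Proof. by rewrite /nrm normcJ. Qed.

Lemma cabsV z : nrm z^-1 = (nrm z)^-1.
Proof.
by apply: complexI; rewrite -nrmE normfV nrmE fmorphV.
Qed.

Lemma Re_le_cabs z : `|complex.Re z| <= nrm z.
Proof. by rewrite -lecR -nrmE normc_ge_Re. Qed.

Lemma Im_le_cabs z : `|complex.Im z| <= nrm z.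
Proof.
have := Re_le_cabs (z * 'i).
by rewrite ReiNIm normrN cabsM /(nrm 'i) normc_def /= expr0n expr1n add0r sqrtr1 mulr1.
Qed.

Lemma cabs_le_ReIm z : nrm z <= `|complex.Re z| + `|complex.Im z|.
Proof.
rewrite {1}[z]complexE (le_trans (nrmD _ _)) // cabsM !cabsR lerD2l.
by rewrite /(nrm 'i) normc_def /= expr0n expr1n add0r sqrtr1 mul1r.
Qed.

Lemma mulcJ z : z * conjc z = (nrm z ^+ 2)%:C.
Proof. by rewrite -sqr_normc nrmE rmorphXn. Qed.

Lemma cabs1_inv z : nrm z = 1 -> z^-1 = conjc z.
Proof. by move=> h; rewrite invc_norm nrmE h rmorph1 expr1n invr1 mul1r. Qed.

Lemma nrm_dist (V : normedModType R[i]) (v w : V) : `|nrm v - nrm w| <= nrm (v - w).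
Proof.
rewrite ler_norml; have := nrmD (v - w) w; have := nrmD (w - v) v.
by rewrite !subrK (nrmC w v) => ? ?; apply/andP; split; lra.
Qed.

Lemma continuous_nrm (V : normedModType R[i]) : continuous (@nrm R V).
Proof.
move=> v; apply/cvgrPdist_lt => e e0.
have /cvg_nrm /(_ e e0) : (fun x : V => x) @ v --> v by [].
by apply: filterS => x; exact/le_lt_trans/nrm_dist.
Qed.

Lemma continuous_Re : continuous (@complex.Re R).
Proof.
move=> z; have Fz : Filter (nbhs z) by exact: nbhs_filter.
apply/cvgrPdist_lt => e e0.
have /cvg_nrm /(_ e e0) : (fun x : R[i] => x) @ z --> z by [].
apply: filterS => x; apply: le_lt_trans.
by apply: le_trans (Re_le_cabs _); rewrite raddfB.
Qed.

Lemma continuous_Im : continuous (@complex.Im R).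
Proof.
move=> z; have Fz : Filter (nbhs z) by exact: nbhs_filter.
apply/cvgrPdist_lt => e e0.
have /cvg_nrm /(_ e e0) : (fun x : R[i] => x) @ z --> z by [].
apply: filterS => x; apply: le_lt_trans.
by apply: le_trans (Im_le_cabs _); rewrite raddfB.
Qed.

Lemma continuous_conjc : continuous (@conjc R : R[i] -> R[i]).
Proof.
move=> z; have Fz : Filter (nbhs z) by exact: nbhs_filter.
apply/cvg_nrm => e e0.
have /cvg_nrm /(_ e e0) : (fun x : R[i] => x) @ z --> z by [].
by apply: filterS => x; rewrite -rmorphB /= cabsJ.
Qed.

Lemma cvg_Complex (T : Type) (F : set_system T) (FF : Filter F)
    (f g : T -> R) a b : f @ F --> a -> g @ F --> b ->
  (fun t => Complex (f t) (g t)) @ F --> Complex a b.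
Proof.
move=> /cvgrPdist_lt fa /cvgrPdist_lt gb; apply/cvg_nrm => e e0.
have e2 : 0 < e / 2 by rewrite divr_gt0.
near=> t; apply: le_lt_trans (cabs_le_ReIm _) _ => /=.
have : `|a - f t| < e / 2 by near: t; exact: fa.
have : `|b - g t| < e / 2 by near: t; exact: gb.
by lra.
Unshelve. all: by end_near. Qed.

Lemma ltc0E z : (0 < z) = (complex.Im z == 0) && (0 < complex.Re z).
Proof. by rewrite ltcE. Qed.

Lemma gtc0_cabs z : 0 < z -> z = (nrm z)%:C.
Proof. by move=> z0; rewrite -nrmE gtr0_norm. Qed.

End ComplexNorm.

Lemma cvg_sum_seq (R : realType) (I : eqType) (X : Type) (F : set_system X)
    (FF : Filter F) (s : seq I) (f : I -> X -> R[i]) (l : I -> R[i]) :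
  {in s, forall i, f i @ F --> l i} ->
  (fun x => \sum_(i <- s) f i x) @ F --> \sum_(i <- s) l i.
Proof.
elim: s => [|i s IH] h.
  rewrite big_nil (_ : (fun x => _) = fun=> 0); first exact: (@cvg_cst R[i]).
  by apply/funext => x; rewrite big_nil.
rewrite big_cons (_ : (fun x => _) = fun x => f i x + \sum_(i <- s) f i x).
  apply: cvgD; first by apply: h; rewrite inE eqxx.
  by apply: IH => j js; apply: h; rewrite inE js orbT.
by apply/funext => x; rewrite big_cons.
Qed.

Lemma continuous_mulC (R : realType) (X : topologicalType) (f g : X -> R[i]) :
  continuous f -> continuous g -> continuous (fun x => f x * g x).
Proof.
move=> cf cg x; have Fx : Filter (nbhs x) by exact: nbhs_filter.
have fx : f y @[y --> x] --> f x by exact: cf.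
have gx : g y @[y --> x] --> g x by exact: cg.
exact: (cvgM fx gx).
Qed.

Lemma continuous_cstC (R : realType) (X : topologicalType) (k : R[i]) :
  continuous (fun _ : X => k).
Proof. exact: (@cst_continuous X R[i] k). Qed.

Section CircleTopology.
Context {R : realType}.
Implicit Types z w : circle R.

Lemma cabs_circle z : nrm (circle_val z) = 1.
Proof. by apply: complexI; rewrite -nrmE circle_norm. Qed.

Lemma circle_valJ z : conjc (circle_val z) = (circle_val z)^-1.
Proof. by rewrite cabs1_inv ?cabs_circle. Qed.

Lemma circle_valMJ z : circle_val z * conjc (circle_val z) = 1.
Proof. by rewrite circle_valJ mulfV ?circle_neq0. Qed.

Lemma continuous_circle_val : continuous (@circle_val R).
Proof. exact: initial_continuous. Qed.

Lemma circle_expE (t : R) :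
  circle_val (circle_exp t) = Complex (cos (2 * pi * t)) (sin (2 * pi * t)).
Proof. by []. Qed.

(** The circle is the image of [0, 1] under t |-> exp(2 i pi t): arccos gives the
    preimage in the upper half plane, and 1 minus it the one in the lower half
    plane. *)
Lemma compact_circle : compact [set: circle R].
Proof.
suff -> : [set: circle R] = (@circle_exp R) @` `[0, 1].
  apply: continuous_compact; last exact: segment_compact.
  exact/continuous_subspaceT/continuous_circle_exp.
apply/seteqP; split=> // z _ /=.
have pi0 := @pi_gt0 R; have zn := cabs_circle z.
have pi2 : 2 * pi != 0 :> R by rewrite mulf_neq0 ?gt_eqF.
move Ec : (circle_val z) zn => [a b] zn.
have /eqP ab : a ^+ 2 + b ^+ 2 == 1.
  move: zn; rewrite /nrm normc_def /= => /(congr1 (fun x => x ^+ 2)).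
  by rewrite sqr_sqrtr ?addr_ge0 ?sqr_ge0 // expr1n => ->.
have a1 : -1 <= a <= 1.
  by rewrite -ler_norml -(@ler_pXn2r _ 2) ?nnegrE // expr1n real_normK ?num_real //; nra.
have sb : sin (acos a) = `|b|.
  by rewrite sin_acos // -ab addrAC subrr add0r sqrtr_sqr.
have ac : cos (acos a) = a by rewrite acosK // in_itv.
have [l u] := (acos_ge0 a1, acos_lepi a1).
have [b0|b0] := leP 0 b.
  exists (acos a / (2 * pi)).
    rewrite /= in_itv /=; apply/andP; split.
      by rewrite divr_ge0 // mulr_ge0 // ltW.
    by rewrite ler_pdivrMr ?mulr_gt0 // mul1r; lra.
  apply: circle_val_inj; rewrite Ec circle_expE [2 * pi * _]mulrC divfK //.
  by rewrite ac sb ger0_norm.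
exists (1 - acos a / (2 * pi)).
  have h : acos a / (2 * pi) <= 1 by rewrite ler_pdivrMr ?mulr_gt0 // mul1r; lra.
  have h' : 0 <= acos a / (2 * pi) by rewrite divr_ge0 // mulr_ge0 // ltW.
  by rewrite /= in_itv /=; apply/andP; split; lra.
apply: circle_val_inj; rewrite Ec circle_expE mulrBr mulr1.
rewrite [2 * pi * (_ / _)]mulrC divfK // addrC mulr_natl cosD2pi sinD2pi.
by rewrite cosN sinN ac sb ltr0_norm // opprK.
Qed.

End CircleTopology.

(** * Algebra of groupoids and twists *)

Section GroupoidAlgebra.
Context {G : groupoid}.
Implicit Types g h k u : G.

Lemma rng_inv g : rng (ginv g) = src g.
Proof. by rewrite /rng ginvK. Qed.

Lemma gcomp_iff g h : gcomp g h <-> src g = rng h.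
Proof. by split; [exact: gcomp_src_rng|exact: gcompP]. Qed.


Lemma gmulA g h k : src g = rng h -> src h = rng k ->
  gmul (gmul g h) k = gmul g (gmul h k).
Proof. by move=> /gcompP gh /gcompP hk; have [] := gcompA gh hk. Qed.

Lemma gmul_rng g : gmul (rng g) g = g.
Proof.
rewrite /rng gmulA ?src_inv ?rng_inv // -{1}[g]ginvK gmulKV //; exact: gcompV.
Qed.

Lemma gmul_src g : gmul g (src g) = g.
Proof.
by have := gmulVK (gcompVr g); rewrite ginvK /src -gmulA ?src_inv ?rng_inv.
Qed.

Lemma gmul_unit_l u g : gunit u -> src u = rng g -> gmul u g = g.
Proof. by move=> uu; rewrite src_unit // => ->; exact: gmul_rng. Qed.

Lemma gmul_unit_r u g : gunit u -> src g = rng u -> gmul g u = g.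
Proof. by move=> uu; rewrite rng_unit // => <-; exact: gmul_src. Qed.

Lemma srcM g h : src g = rng h -> src (gmul g h) = src h.
Proof. by move=> /gcompP; exact: src_mul. Qed.

Lemma rngM g h : src g = rng h -> rng (gmul g h) = rng g.
Proof. by move=> /gcompP; exact: rng_mul. Qed.

Lemma gmulK g h : src g = rng h -> gmul (gmul g h) (ginv h) = g.
Proof. by move=> /gcompP; exact: gmulVK. Qed.

Lemma gmulVg g h : src g = rng h -> gmul (ginv g) (gmul g h) = h.
Proof. by move=> /gcompP; exact: gmulKV. Qed.

Lemma gmulgV g h : src g = src h -> gmul (gmul g (ginv h)) h = g.
Proof. by move=> gh; have := @gmulK g (ginv h); rewrite rng_inv ginvK; exact. Qed.

Lemma gmulVKg g h : rng g = rng h -> gmul g (gmul (ginv g) h) = h.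
Proof. by move=> gh; have := @gmulVg (ginv g) h; rewrite src_inv ginvK; exact. Qed.

Lemma ginvM g h : src g = rng h -> ginv (gmul g h) = gmul (ginv h) (ginv g).
Proof.
move=> gh.
have e1 : gmul (gmul g h) (gmul (ginv h) (ginv g)) = rng g.
  rewrite -gmulA ?src_inv ?rng_inv // ?srcM //.
  by rewrite gmulK.
rewrite -[RHS](@gmulVg (gmul g h)); last by rewrite srcM // rngM ?rng_inv // src_inv.
rewrite e1 [RHS]gmul_unit_r //.
  exact: gunit_rng.
by rewrite src_inv rngM // [RHS]rng_unit //; exact: gunit_rng.
Qed.

(** Distinct arrows with the same source have a quotient outside the unit space.
    This turns statements about units into statements comparing two arrows. *)
Lemma gmul_divI g h : src g = src h -> gunit (gmul g (ginv h)) -> g = h.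
Proof.
move=> gh u; rewrite -(gmulgV gh); apply: gmul_unit_l => //.
by rewrite srcM ?rng_inv // src_inv.
Qed.

Lemma gunit_idem u : gcomp u u -> gmul u u = u -> gunit u.
Proof. by move=> cu uu; rewrite -(gmulVK cu) uu; exact: gunit_rng. Qed.

Lemma src0_val g : unit_val (src0 g) = src g. Proof. by []. Qed.

Lemma rng0_val g : unit_val (rng0 g) = rng g. Proof. by []. Qed.

Lemma unit_val_inj : injective (@unit_val G).
Proof. exact: val_inj. Qed.

Lemma unit_valP (x : units G) : gunit (unit_val x).
Proof. exact: (set_valP x). Qed.

Lemma src0_unit (x : units G) : src0 (unit_val x) = x.
Proof. by apply: unit_val_inj; rewrite src0_val src_unit //; exact: unit_valP. Qed.

Lemma rng0_unit (x : units G) : rng0 (unit_val x) = x.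
Proof. by apply: unit_val_inj; rewrite rng0_val rng_unit //; exact: unit_valP. Qed.

Lemma src0_inv g : src0 (ginv g) = rng0 g.
Proof. by apply: unit_val_inj; rewrite src0_val src_inv. Qed.

Lemma rng0_inv g : rng0 (ginv g) = src0 g.
Proof. by apply: unit_val_inj; rewrite rng0_val rng_inv. Qed.

Lemma gcomp0 g h : gcomp g h <-> src0 g = rng0 h.
Proof.
rewrite gcomp_iff; split=> [h0|/(congr1 (@unit_val G))//].
exact: unit_val_inj.
Qed.

Lemma src0M g h : src0 g = rng0 h -> src0 (gmul g h) = src0 h.
Proof. by move=> /gcomp0 c; apply: unit_val_inj; rewrite src0_val src_mul. Qed.

Lemma rng0M g h : src0 g = rng0 h -> rng0 (gmul g h) = rng0 g.
Proof. by move=> /gcomp0 c; apply: unit_val_inj; rewrite rng0_val rng_mul. Qed.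

Lemma gunitE g : gunit g -> g = unit_val (src0 g).
Proof. by move=> u; rewrite src0_val src_unit. Qed.

End GroupoidAlgebra.

(** A groupoid morphism sends idempotents, hence units, to units; so it commutes
    with inverses. *)
Lemma morphism_inv (G H : groupoid) (phi : G -> H) :
  groupoid_morphism phi -> forall g, phi (ginv g) = ginv (phi g).
Proof.
move=> mp g; have [c1 e1] := mp _ _ (gcompV g); rewrite -/(src g) in e1.
have uu : gcomp (src g) (src g).
  by apply: gcompP; rewrite (rng_unit (gunit_src g)) (src_unit (gunit_src g)).
have [c2 e2] := mp _ _ uu.
have us : gunit (phi (src g)).
  apply: gunit_idem => //; rewrite -e2 gmul_unit_r //; first exact: gunit_src.
  by rewrite (rng_unit (gunit_src g)) (src_unit (gunit_src g)).
rewrite -(gmulVK c1) -e1 gmul_unit_l // rng_inv e1.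
exact: src_mul.
Qed.

Section TwistAlgebra.
Context {R : realType} {G : groupoid} {T : twist R G}.
Local Notation E := (tw_E T).
Local Notation pi := (tw_pi T).
Implicit Types (e : E) (z w : circle R) (x : units G).

Definition es e : units G := src0 (pi e).
Definition er e : units G := rng0 (pi e).

Lemma pi_inv e : pi (ginv e) = ginv (pi e).
Proof. by apply: morphism_inv; exact: tw_pi_morphism. Qed.

Lemma es_inv e : es (ginv e) = er e.
Proof. by rewrite /es pi_inv src0_inv. Qed.

Lemma er_inv e : er (ginv e) = es e.
Proof. by rewrite /er pi_inv rng0_inv. Qed.

Lemma rngE e : rng e = tw_unit T (er e).
Proof. exact: rng_tw. Qed.

Lemma srcE e : src e = tw_unit T (es e).
Proof. by rewrite -rng_inv rngE er_inv. Qed.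

Lemma tw_unit_inj : injective (tw_unit T).
Proof. by move=> x y /tw_i_inj []. Qed.

Lemma src_tw_unitP e x : src e = tw_unit T x <-> es e = x.
Proof. by rewrite srcE; split=> [/tw_unit_inj|->]. Qed.

Lemma gcompE e e' : gcomp e e' <-> es e = er e'.
Proof. by rewrite gcomp_iff srcE rngE; split=> [/tw_unit_inj|->]. Qed.

Lemma piM e e' : es e = er e' -> pi (gmul e e') = gmul (pi e) (pi e').
Proof. by move=> /gcompE c; have [] := tw_pi_morphism c. Qed.

Lemma esM e e' : es e = er e' -> es (gmul e e') = es e'.
Proof. by move=> c; rewrite /es piM // src0M. Qed.

Lemma erM e e' : es e = er e' -> er (gmul e e') = er e.
Proof. by move=> c; rewrite /er piM // rng0M. Qed.

Lemma pi_tw_unit x : pi (tw_unit T x) = unit_val x.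
Proof. exact: tw_pi_unit. Qed.

Lemma es_unit x : es (tw_unit T x) = x.
Proof. by rewrite /es pi_tw_unit src0_unit. Qed.

Lemma er_unit x : er (tw_unit T x) = x.
Proof. by rewrite /er pi_tw_unit rng0_unit. Qed.

Lemma mulA e e' e'' : es e = er e' -> es e' = er e'' ->
  gmul (gmul e e') e'' = gmul e (gmul e' e'').
Proof. by move=> /gcompE/gcomp_iff h /gcompE/gcomp_iff h'; exact: gmulA. Qed.

Lemma mul_unit_l e : gmul (tw_unit T (er e)) e = e.
Proof. by rewrite -rngE gmul_rng. Qed.

Lemma mul_inv_r e : gmul e (ginv e) = tw_unit T (er e).
Proof. by rewrite -rngE. Qed.

Lemma mulK e e' : es e = er e' -> gmul (gmul e e') (ginv e') = e.
Proof. by move=> /gcompE; exact: gmulVK. Qed.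

Lemma mulVK e e' : es e = es e' -> gmul (gmul e (ginv e')) e' = e.
Proof. by move=> h; rewrite gmulgV // !srcE h. Qed.

Lemma invM e e' : es e = er e' -> ginv (gmul e e') = gmul (ginv e') (ginv e).
Proof. by move=> /gcompE/gcomp_iff; exact: ginvM. Qed.

Lemma tw_iM x z w :
  gmul (tw_i T (x, z)) (tw_i T (x, w)) = tw_i T (x, circle_mul z w).
Proof. by have [_ ->] := @tw_i_morphism R G T (x, z) (x, w) erefl. Qed.

Lemma src_tw_iE x z : src (tw_i T (x, z)) = tw_unit T x.
Proof. exact: src_tw_i. Qed.

Lemma es_tw_i x z : es (tw_i T (x, z)) = x.
Proof. by apply/src_tw_unitP; exact: src_tw_iE. Qed.

Lemma tw_i_inv x z : ginv (tw_i T (x, z)) = tw_i T (x, circle_inv z).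
Proof. by rewrite -(morphism_inv (@tw_i_morphism R G T)). Qed.

Lemma er_tw_i x z : er (tw_i T (x, z)) = x.
Proof. by rewrite -es_inv tw_i_inv es_tw_i. Qed.

Lemma pi_tw_i x z : pi (tw_i T (x, z)) = unit_val x.
Proof.
have [y yu] : gunit (pi (tw_i T (x, z))).
  suff : (pi @^-1` @gunit G) (tw_i T (x, z)) by [].
  by rewrite tw_kernel; exists (x, z).
move=> e; rewrite -[LHS]src_unit; last by rewrite -e; exact: gunit_rng.
by rewrite -[src _]/(unit_val (es _)) es_tw_i.
Qed.

Lemma es_act z e : es (tw_act z e) = es e.
Proof. by rewrite /tw_act esM // es_tw_i. Qed.

Lemma pi_act z e : pi (tw_act z e) = pi e.
Proof.
rewrite /tw_act piM ?es_tw_i // pi_tw_i gmul_unit_l //; first exact: unit_valP.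
by rewrite src_unit //; exact: unit_valP.
Qed.

Lemma act1 e : tw_act circle_one e = e.
Proof. exact: mul_unit_l. Qed.

Lemma actA z w e : tw_act z (tw_act w e) = tw_act (circle_mul z w) e.
Proof.
rewrite {1}/tw_act pi_act /tw_act -mulA ?es_tw_i ?er_tw_i //.
by rewrite tw_iM.
Qed.

Lemma actE z e : tw_act z e = gmul (tw_i T (er e, z)) e.
Proof. by []. Qed.

Lemma actEr z e : tw_act z e = gmul e (tw_i T (es e, z)).
Proof. exact: tw_central. Qed.

Lemma tw_i_act x z : tw_i T (x, z) = tw_act z (tw_unit T x).
Proof. by rewrite actE er_unit /tw_unit tw_iM; congr (tw_i T (_, _)); apply: circle_val_inj; rewrite circle_mulE mulr1. Qed.

Lemma act_mull z e e' : es e = er e' ->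
  gmul (tw_act z e) e' = tw_act z (gmul e e').
Proof.
by move=> h; rewrite !actE erM // mulA // es_tw_i.
Qed.

Lemma act_mulr z e e' : es e = er e' ->
  gmul e (tw_act z e') = tw_act z (gmul e e').
Proof.
by move=> h; rewrite !actEr esM // mulA ?er_tw_i.
Qed.

Lemma act_inv z e : ginv (tw_act z e) = tw_act (circle_inv z) (ginv e).
Proof. by rewrite actE invM ?es_tw_i // tw_i_inv actEr es_inv. Qed.

(** The kernel axiom of the twist: over a unit there are only the elements of the
    central circle. *)
Lemma pi_unitP e : gunit (pi e) -> exists z, e = tw_i T (es e, z).
Proof.
move=> u; have : (pi @^-1` @gunit G) e by [].
by rewrite tw_kernel => -[[x z] _ <-]; exists z; rewrite es_tw_i.
Qed.

(** The fibres of pi are exactly the orbits of the circle: two elements over the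
    same arrow have a quotient in the kernel. *)
Lemma pi_eq_act e e' : pi e = pi e' -> exists z, e' = tw_act z e.
Proof.
move=> h; have c : es e' = es e by rewrite /es h.
have c' : es e' = er (ginv e) by rewrite er_inv.
have [|z ez] := @pi_unitP (gmul e' (ginv e)).
  by rewrite piM // pi_inv h; exact: gunit_rng.
exists z; rewrite actE -(mulVK c) {1}ez esM // es_inv //.
Qed.

Lemma act_inj e z w : tw_act z e = tw_act w e -> z = w.
Proof.
move=> h; have : gmul (tw_act z e) (ginv e) = gmul (tw_act w e) (ginv e) by rewrite h.
rewrite !actE !mulK ?es_tw_i //; by move/tw_i_inj => [].
Qed.

Lemma pi_surj g : exists e, pi e = g.
Proof. by have [U [S [[_ Ug] _ /(_ g Ug) h _]]] := tw_section T g; exists (S g). Qed.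

Lemma es_fibre x (e : tw_fibre T x) : es (fibre_val e) = x.
Proof. by apply/src_tw_unitP; exact: (set_valP e). Qed.

Definition to_fibre x e (h : es e = x) : tw_fibre T x :=
  exist _ e (mem_set ((src_tw_unitP e x).2 h)).

Lemma fibre_val_inj x : injective (@fibre_val R G T x).
Proof. exact: val_inj. Qed.

Lemma fibre_val_act x z (e : tw_fibre T x) :
  fibre_val (fibre_act z e) = tw_act z (fibre_val e).
Proof. by []. Qed.

Lemma fibre_liftP x g : src0 g = x -> pi (fibre_val (fibre_lift T x g)) = g.
Proof.
move=> gx; rewrite /fibre_lift; apply: (@getPex _ [set e | pi (fibre_val e) = g]).
have [e eg] := pi_surj g.
have h : es e = x by rewrite /es eg.
by exists (to_fibre h).
Qed.

(** A chosen element of E over each arrow; since the fibres of pi are circle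
    orbits, equivariant functions are determined by their values on lifts. *)
Definition lift g : E := fibre_val (fibre_lift T (src0 g) g).

Lemma pi_lift g : pi (lift g) = g.
Proof. exact: fibre_liftP. Qed.

Lemma es_lift g : es (lift g) = src0 g.
Proof. by rewrite /es pi_lift. Qed.

Lemma er_lift g : er (lift g) = rng0 g.
Proof. by rewrite /er pi_lift. Qed.

End TwistAlgebra.

(** * Topology of etale groupoids *)

Lemma nbhs_open (X : topologicalType) (x : X) (V : set X) : nbhs x V ->
  exists B : set X, [/\ open B, B x & B `<=` V].
Proof. by rewrite nbhsE => -[B [oB Bx] BV]; exists B. Qed.

Lemma compact_image (X Y : topologicalType) (f : X -> Y) (K : set X) :
  (forall x, K x -> f y @[y --> x] --> f x) -> compact K -> compact (f @` K).
Proof.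
move=> cf; apply: continuous_compact; apply: continuous_in_subspaceT => x.
by rewrite inE => /cf.
Qed.

Section SubTopology.
Context {X : topologicalType} {A : set X}.

Lemma open_set_typeP (U : set A) :
  open U <-> exists2 O : set X, open O & U = set_val @^-1` O.
Proof. by split=> [ [W oW <-] | [W oW ->] ]; exists W. Qed.

Lemma cvg_set_type (T : Type) (F : set_system T) (FF : Filter F) (f : T -> A) x :
  (fun t => set_val (f t)) @ F --> (set_val x : X) -> f @ F --> x.
Proof.
move=> h U /nbhs_open[B [oB Bx BU]].
have [W oW BW] := (open_set_typeP B).1 oB.
have nO : nbhs (set_val x : X) W.
  by apply: open_nbhs_nbhs; split=> //; move: Bx; rewrite BW.
by apply: (@filterS _ F FF _ _ _ (h _ nO)) => t /= Wt; apply: BU; rewrite BW.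
Qed.

Lemma hausdorff_set_type : hausdorff_space X -> hausdorff_space A.
Proof.
move=> hX x y xy; apply: val_inj; apply: hX => U V nU nV.
have c : continuous (set_val : A -> X) by exact: initial_continuous.
by have [u [? ?]] := xy _ _ (c _ _ nU) (c _ _ nV); exists (set_val u).
Qed.

Lemma compact_set_type : compact A -> compact [set: A].
Proof.
move=> cA F PF _.
have FA : (set_val @ F) A.
  by apply: (@filterS _ F _ setT) => [x _|]; [exact: set_valP|exact: filterT].
have [x [Ax cx]] := cA _ _ FA.
exists (exist _ x (mem_set Ax)); split=> // U V FU /nbhs_open[B [oB Bx BV]].
have [W oW BW] := (open_set_typeP B).1 oB.
have nO : nbhs x W.
  by apply: open_nbhs_nbhs; split=> //; move: Bx; rewrite BW.
have [|y [[u Uu <-] Wy]] := cx (set_val @` U) W _ nO.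
  by apply: (@filterS _ F _ _ _ _ FU) => u Uu; exists u.
by exists u; split=> //; apply: BV; rewrite BW.
Qed.

End SubTopology.

Section GroupoidTopology.
Context {G : groupoid} (Gtop : topological_groupoid G).
Implicit Types g h : G.

Lemma cvg_units (T : Type) (F : set_system T) (FF : Filter F) (f : T -> units G) x :
  (fun t => unit_val (f t)) @ F --> unit_val x -> f @ F --> x.
Proof. exact: cvg_set_type. Qed.

Lemma continuous_ginv : continuous (@ginv G).
Proof. by have [] := Gtop. Qed.

Lemma cvg_gmul (T : Type) (F : set_system T) (FF : Filter F) (f k : T -> G) g h :
  (\forall t \near F, gcomp (f t) (k t)) -> gcomp g h ->
  f @ F --> g -> k @ F --> h -> (fun t => gmul (f t) (k t)) @ F --> gmul g h.
Proof.
move=> c gh fg kh; have [cm _] := Gtop.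
move/subspace_continuousP : cm => /(_ (g, h) gh) cm.
have fk : (fun t => (f t, k t)) @ F --> (g, h) by exact: cvg_pair.
move=> U /cm nU; have {}nU := fk _ nU.
by apply: (@filterS2 _ F FF _ _ _ _ c nU) => t /= ct; apply.
Qed.

Lemma continuous_rng : continuous (@rng G).
Proof.
move=> g; apply: cvg_gmul; [|exact: gcompVr|exact: cvg_id|exact: continuous_ginv].
by apply: nearW => h; exact: gcompVr.
Qed.

Lemma continuous_rng0 : continuous (@rng0 G).
Proof. by move=> g; apply: cvg_units; exact: continuous_rng. Qed.

Lemma continuous_src0 : continuous (@src0 G).
Proof.
have -> : @src0 G = @rng0 G \o @ginv G by apply/funext => g /=; rewrite rng0_inv.
by move=> g; apply: continuous_comp; [exact: continuous_ginv|exact: continuous_rng0].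
Qed.

Lemma open_preimage (X Y : topologicalType) (f : X -> Y) (U : set Y) :
  continuous f -> open U -> open (f @^-1` U).
Proof. by move=> /continuousP; exact. Qed.

Section Etale.
Hypothesis Get : etale G.

(** A local homeomorphism onto open sets is an open map. *)
Lemma open_rng0 (W : set G) : open W -> open (@rng0 G @` W).
Proof.
move=> oW; rewrite openE => x [g Wg <-].
have [U [oU Ug oU' [_ _ hU]]] := Get g.
have [W' oW' e] := hU _ oW.
have : nbhs (rng0 g) (@rng0 G @` U `&` W').
  apply: open_nbhs_nbhs; split; first exact: openI.
  by rewrite -e; exists g.
by apply: filterS; rewrite -e => _ [h [_ Wh] <-]; exists h.
Qed.

Lemma image_src0 (W : set G) : @src0 G @` W = @rng0 G @` (@ginv G @^-1` W).
Proof.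
apply/seteqP; split=> [_ [g Wg <-]|_ [g Wg <-]].
  by exists (ginv g); rewrite /= ?ginvK // rng0_inv.
by exists (ginv g) => //; rewrite src0_inv.
Qed.

Lemma open_src0 (W : set G) : open W -> open (@src0 G @` W).
Proof.
by move=> oW; rewrite image_src0; apply/open_rng0/open_preimage => //; exact: continuous_ginv.
Qed.

Lemma etale_nbhs g : exists U : set G, [/\ open U, U g,
  {in U &, injective (@rng0 G)} & {in U &, injective (@src0 G)}].
Proof.
have [U [oU Ug _ [[_ iU _] _ _]]] := Get g.
have [V [oV Vg _ [[_ iV _] _ _]]] := Get (ginv g).
exists (U `&` @ginv G @^-1` V); split.
- by apply: openI => //; apply: open_preimage => //; exact: continuous_ginv.
- by [].
- by move=> h k /set_mem[Uh _] /set_mem[Uk _]; apply: iU; exact: mem_set.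
- move=> h k /set_mem[_ Vh] /set_mem[_ Vk]; rewrite -!rng0_inv => e.
  by rewrite -[h]ginvK (iV _ _ _ _ e) ?ginvK //; exact: mem_set.
Qed.

(** Near a unit the range map is injective, and g and r(g) have the same range; so
    g = r(g) for g near a unit. *)
Lemma open_gunit : open (@gunit G).
Proof.
rewrite openE => u uu; have [U [oU Uu iU _]] := etale_nbhs u.
have : nbhs u (U `&` @rng G @^-1` U).
  apply: open_nbhs_nbhs; split; last by split=> //=; rewrite rng_unit.
  by apply: openI => //; apply: open_preimage => //; exact: continuous_rng.
apply: filterS => g [Ug Urg].
rewrite (iU g (rng g)) ?inE //; first exact: gunit_rng.
by apply: unit_val_inj; rewrite !rng0_val [RHS]rng_unit //; exact: gunit_rng.
Qed.

End Etale.

Section Haus.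
Hypothesis GT2 : hausdorff_space G.

Lemma closed_point (X : topologicalType) (x : X) : hausdorff_space X -> closed [set x].
Proof. by move=> h; apply: accessible_closed_set1; exact: hausdorff_accessible. Qed.

Lemma hausdorff_units : hausdorff_space (units G).
Proof. exact: hausdorff_set_type. Qed.

Lemma closed_src_fibre x : closed [set g : G | src0 g = x].
Proof.
have -> : [set g : G | src0 g = x] = @src0 G @^-1` [set x] by [].
apply: (proj1 (continuous_closedP _)); first exact: continuous_src0.
by apply: closed_point; exact: hausdorff_units.
Qed.

(** If K were infinite, the filter of its cofinite subsets would cluster at a
    point of K, which contradicts that this point is isolated in K. *)
Lemma compact_discrete_finite (X : topologicalType) (K : set X) :
  compact K -> (forall x, K x -> exists U, [/\ open U, U x & U `&` K `<=` [set x]]) ->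
  finite_set K.
Proof.
move=> cK h.
apply: contrapT => infK.
pose F : set_system X := [set B | finite_set (K `\` B)].
have PF : ProperFilter F.
  apply: Build_ProperFilter_ex => [B FB|].
    apply: contrapT => nB; apply: infK; apply: sub_finite_set FB => x Kx; split=> // Bx.
    by apply: nB; exists x.
  split.
  - by rewrite /F /= setDT; exact: finite_set0.
  - by move=> P Q; rewrite /F /= setDIr => ? ?; rewrite finite_setU.
  - by move=> P Q PQ; apply: sub_finite_set => x [Kx nQ]; split=> // /PQ.
have [|x [Kx cx]] := cK F; first by rewrite /F /= setDv; exact: finite_set0.
have [U [oU Ux UK]] := h x Kx.
have FU : F (K `\ x).
  by apply: (@sub_finite_set _ _ [set x]) => // y [Ky] /not_andP[//|/contrapT].
have [|y [[Ky yx] Uy]] := cx _ U FU; first exact: open_nbhs_nbhs.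
by apply: yx; apply: UK.
Qed.

End Haus.
End GroupoidTopology.

(** * Local sections of a twist *)

(** The fibres of the source map are discrete, the source map being locally
    injective. *)
Lemma compact_src_finite (G : groupoid) (Gtop : topological_groupoid G) (Get : etale G)
    (GT2 : hausdorff_space G) (K : set G) (x : units G) : compact K ->
  finite_set (K `&` [set g | src0 g = x]).
Proof.
move=> cK; apply: compact_discrete_finite => [|g [Kg gx]].
  by apply: compact_closedI => //; exact: closed_src_fibre.
have [U [oU Ug _ iU]] := etale_nbhs Gtop Get g.
by exists U; split=> // h [Uh [_ hx]]; apply: iU; rewrite ?inE // hx.
Qed.

Section TwistTopology.
Context {R : realType} {G : groupoid} {T : twist R G}.
Hypotheses (Gtop : topological_groupoid G) (Get : etale G)
  (GT2 : hausdorff_space G) (Gcpt : compact (@gunit G)).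
Local Notation E := (tw_E T).
Local Notation pi := (tw_pi T).
Implicit Types (e : E) (z w : circle R) (x : units G).

Lemma compact_units : compact [set: units G].
Proof. exact: compact_set_type. Qed.

Lemma continuous_es : continuous (@es R G T).
Proof.
move=> e; apply: (@continuous_comp _ _ _ pi (@src0 G)); first exact: tw_pi_continuous.
exact: continuous_src0.
Qed.

Lemma continuous_er : continuous (@er R G T).
Proof.
move=> e; apply: (@continuous_comp _ _ _ pi (@rng0 G)); first exact: tw_pi_continuous.
exact: continuous_rng0.
Qed.

Lemma continuous_inv : continuous (@ginv E).
Proof. by apply: continuous_ginv; exact: tw_E_topological. Qed.

Lemma cvg_tw_i (S : Type) (F : set_system S) (FF : Filter F) (f : S -> units G)
    (k : S -> circle R) x z :
  f @ F --> x -> k @ F --> z -> (fun t => tw_i T (f t, k t)) @ F --> tw_i T (x, z).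
Proof.
move=> fx kz; apply: (@cvg_comp _ _ _ (fun t => (f t, k t)) (tw_i T) F (nbhs (x, z))).
  exact: (cvg_pair fx kz).
exact: tw_i_continuous.
Qed.

Lemma cvg_mul (S : Type) (F : set_system S) (FF : Filter F) (f k : S -> E) e e' :
  (\forall t \near F, es (f t) = er (k t)) -> es e = er e' ->
  f @ F --> e -> k @ F --> e' -> (fun t => gmul (f t) (k t)) @ F --> gmul e e'.
Proof.
move=> c ee; apply: cvg_gmul; first exact: tw_E_topological.
- by apply: filterS c => t /gcompE.
- exact/gcompE.
Qed.

Lemma cvg_act (S : Type) (F : set_system S) (FF : Filter F) (f : S -> E)
    (k : S -> circle R) e z :
  k @ F --> z -> f @ F --> e -> (fun t => tw_act (k t) (f t)) @ F --> tw_act z e.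
Proof.
move=> kz fe; apply: cvg_mul => //.
- by apply: nearW => t; rewrite es_tw_i.
- by rewrite es_tw_i.
- by apply: cvg_tw_i => //; exact: (cvg_comp _ _ fe (@continuous_er e)).
Qed.

(** A local trivialization of the twist over a bisection U: every element over U
    is its phase times the value of the section S. *)
Definition local_section (U : set G) (S : G -> E) (ph : E -> circle R) : Prop :=
  [/\ open U, {in U &, injective (@rng0 G)}, {in U &, injective (@src0 G)},
    (forall g, U g -> pi (S g) = g /\ S g' @[g' --> g] --> S g) &
    forall e, U (pi e) ->
      e = tw_act (ph e) (S (pi e)) /\ ph e' @[e' --> e] --> ph e].

(** The phase is the circle coordinate of the inverse of the trivializing
    homeomorphism, hence continuous. *)
Lemma exists_local_section (g : G) :
  exists U S ph, local_section U S ph /\ U g.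
Proof.
have [U [S [[[oU [_ [[_ iU _] _ _]] [_ [[_ iU' _] _ _]]] Ug] cS pS [[b1 b2 b3] _ hom]]]]
  := tw_section T g.
set f := (fun q : G * circle R => gmul (tw_i T (rng0 q.1, q.2)) (S q.1)) in b1 b2 b3 hom.
have fE q : U q.1 -> f q = tw_act q.2 (S q.1).
  by move=> Uq; rewrite /f /tw_act pS.
pose ph e := (xget (g, circle_one) [set q | U q.1 /\ f q = e]).2.
have phP e : U (pi e) -> e = tw_act (ph e) (S (pi e)).
  move=> Ue; have [q [Uq _] qe] := b3 e Ue.
  rewrite /ph; case: xgetP => [q' qd [Uq' q'e]|/(_ q)[]//].
  by rewrite -q'e fE //= pi_act pS.
exists U, S, ph; split=> //; split=> //.
- move=> h Uh; split; first exact: pS.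
  move: cS; rewrite continuous_open_subspace // => cS.
  by apply: cS; rewrite inE.
move=> e Ue; split; first exact: phP.
have Fe : Filter (nbhs e) by exact: nbhs_filter.
move=> V /nbhs_open[B [oB Bz BV]].
have [|W oW WE] := hom (snd @^-1` B).
  by apply: open_preimage => // q; exact: cvg_snd.
have Wpre : nbhs e (pi @^-1` U `&` W).
  apply: open_nbhs_nbhs; split.
    by apply: openI => //; apply: open_preimage => //; exact: tw_pi_continuous.
  rewrite -WE /=; exists (pi e, ph e); first by split.
  by rewrite fE //= -phP.
apply: (@filterS _ _ Fe _ _ _ Wpre); rewrite -WE => e' [[h w] [[Uh _] Bw] <-] /=.
apply: BV; rewrite fE //=.
have := phP (tw_act w (S h)); rewrite !pi_act pS // => /(_ Uh) /act_inj <-.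
exact: Bw.
Qed.

Definition unit_phase (e : E) : circle R :=
  xget circle_one [set z | e = tw_i T (es e, z)].

Lemma unit_phaseP e : gunit (pi e) -> e = tw_i T (es e, unit_phase e).
Proof.
move=> /pi_unitP[z ez]; rewrite /unit_phase; case: xgetP => [w _ //|/(_ z)].
by case.
Qed.

(** Over the unit space the section is global. Its phase is continuous because the
    unit space and the circle are compact: the elements over units whose phase
    avoids an open set form a compact set. *)
Lemma unit_local_section :
  local_section (@gunit G) (fun g => tw_unit T (src0 g)) unit_phase.
Proof.
set ph := unit_phase; have phP := unit_phaseP; split.
- exact: open_gunit.
- by move=> g h /set_mem ug /set_mem uh /(congr1 (@unit_val G)); rewrite !rng0_val !rng_unit.
- by move=> g h /set_mem ug /set_mem uh /(congr1 (@unit_val G)); rewrite !src0_val !src_unit.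
- move=> g ug; split; first by rewrite pi_tw_unit src0_val src_unit.
  apply: cvg_tw_i; first exact: continuous_src0.
  exact: cvg_cst.
move=> e ue; split; first by rewrite {1}(phP e ue) tw_i_act; congr tw_act.
have Fe : Filter (nbhs e) by exact: nbhs_filter.
move=> V /nbhs_open[B [oB Bz BV]].
have cC : closed (tw_i T @` (setT `*` ~` B)).
  apply: compact_closed; first exact: tw_E_hausdorff.
  apply: compact_image => [q _|]; first exact: tw_i_continuous.
  apply: compact_setX; first exact: compact_units.
  by apply: (@subclosed_compact _ _ setT) => //; [exact: open_closedC|exact: compact_circle].
have n : nbhs e (pi @^-1` (@gunit G) `&` ~` (tw_i T @` (setT `*` ~` B))).
  apply: open_nbhs_nbhs; split.
    apply: openI; last exact: closed_openC.
    by apply: open_preimage; [exact: tw_pi_continuous|exact: open_gunit].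
  split=> // -[[y w] [_ nB]]; rewrite (phP e ue) => /tw_i_inj[_ wE].
  by apply: nB; rewrite wE.
apply: (@filterS _ _ Fe _ _ _ n) => e' [ue' nC] /=; apply: BV; apply: contrapT => nB.
by apply: nC; exists (es e', ph e'); [split|rewrite -phP].
Qed.

(** Translate a local section so that it passes through a given element of the
    open set; nearby arrows then lift into the set. *)
Lemma open_pi (W : set E) : open W -> open (pi @` W).
Proof.
move=> oW; rewrite openE => _ [e We <-].
have [U [S [ph [[oU _ _ hS hph] Ue]]]] := exists_local_section (pi e).
have Fe : Filter (nbhs (pi e)) by exact: nbhs_filter.
have [ee _] := hph e Ue; have [_ cS] := hS _ Ue.
have cA : (fun g => tw_act (ph e) (S g)) @ (pi e) --> tw_act (ph e) (S (pi e)).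
  by apply: cvg_act => //; exact: cvg_cst.
have nW : nbhs (tw_act (ph e) (S (pi e))) W by rewrite -ee; exact: open_nbhs_nbhs.
have nU : nbhs (pi e) U by exact: open_nbhs_nbhs.
apply: (@filterS2 _ _ Fe _ _ _ _ (cA _ nW) nU) => g /= Wg Ug.
by exists (tw_act (ph e) (S g)) => //; rewrite pi_act; have [] := hS g Ug.
Qed.

Lemma open_es (W : set E) : open W -> open (@es R G T @` W).
Proof.
move=> oW; suff -> : @es R G T @` W = @src0 G @` (pi @` W).
  by apply: open_src0 => //; exact: open_pi.
by rewrite image_comp.
Qed.

Section Bisection.
Variables (U : set G) (S : G -> E) (ph : E -> circle R).
Hypothesis sec : local_section U S ph.

(** As a bisection is parametrized by its sources, a section over it is a section
    of the source map of E. *)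
Lemma source_section : exists sg : units G -> E, forall g, U g ->
  pi (sg (src0 g)) = g /\ sg y @[y --> src0 g] --> sg (src0 g).
Proof.
have [oU _ iU hS _] := sec.
pose rho x : G := xget (unit_val x) [set g | U g /\ src0 g = x].
have rhoE g : U g -> rho (src0 g) = g.
  move=> Ug; rewrite /rho; case: xgetP => [h _ [Uh e]|/(_ g)[]//].
  by apply: iU; rewrite ?inE.
exists (S \o rho) => g Ug; have [pS cS] := hS g Ug.
split; first by rewrite /= rhoE.
have crho : rho y @[y --> src0 g] --> g.
  move=> V /nbhs_open[B [oB Bs BV]].
  have Fx : Filter (nbhs (src0 g)) by exact: nbhs_filter.
  have n : nbhs (src0 g) (@src0 G @` (B `&` U)).
    apply: open_nbhs_nbhs; split; first by apply: open_src0 => //; exact: openI.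
    by exists g.
  by apply: (@filterS _ _ Fx _ _ _ n) => _ [h [Bh Uh] <-] /=; apply: BV; rewrite rhoE.
by rewrite /= rhoE //; exact: (cvg_comp _ _ crho cS).
Qed.

(** The equivariant function supported over the bisection U whose value along the
    section S is h at the source. *)
Definition bis (h : units G -> R[i]) (e : E) : R[i] :=
  if `[< U (pi e) >] then circle_val (ph e) * h (es e) else 0.

Lemma section_phase_act z e : U (pi e) -> ph (tw_act z e) = circle_mul z (ph e).
Proof.
move=> Ue; have [_ _ _ _ hph] := sec; have [ee _] := hph e Ue.
have [] := hph (tw_act z e); first by rewrite pi_act.
by rewrite pi_act => h _; apply: (@act_inj _ _ _ (S (pi e))); rewrite -h -actA -ee.
Qed.

Lemma bis_act h z e : bis h (tw_act z e) = circle_val z * bis h e.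
Proof.
rewrite /bis pi_act es_act; case: ifPn => [/asboolP Ue|_]; last by rewrite mulr0.
by rewrite section_phase_act // circle_mulE mulrA.
Qed.

Lemma bis_in h e : U (pi e) -> bis h e = circle_val (ph e) * h (es e).
Proof. by move=> Ue; rewrite /bis asboolT. Qed.

Lemma bis_out h e : ~ U (pi e) -> bis h e = 0.
Proof. by move=> Ue; rewrite /bis asboolF. Qed.

Variables (h : units G -> R[i]) (K : set (units G)).
Hypotheses (ch : continuous h) (cK : closed K) (KU : K `<=` @src0 G @` U)
  (hK : forall x, ~ K x -> h x = 0).

Lemma compact_over : compact [set e | U (pi e) /\ K (es e)].
Proof.
have [sg hsg] := source_section; have [_ _ _ _ hph] := sec.
pose f (q : units G * circle R) := tw_act q.2 (sg q.1).
suff -> : [set e | U (pi e) /\ K (es e)] = f @` (K `*` setT).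
  apply: compact_image.
    move=> [x z] [/= /KU[g Ug <-] _]; apply: cvg_act; first exact: cvg_snd.
    have [_ cg] := hsg g Ug; exact: (cvg_comp _ _ (@cvg_fst _ _ _ _ _) cg).
  apply: compact_setX; last exact: compact_circle.
  by apply: (@subclosed_compact _ _ setT) => //; exact: compact_units.
apply/seteqP; split=> [e [Ue Ke]|_ [[x z] [/= Kx _] <-]].
  have [pe _] := hsg _ Ue; have [z ez] := pi_eq_act pe.
  by exists (es e, z).
have [g Ug gx] := KU Kx; have [pg _] := hsg g Ug.
by rewrite /f /= pi_act es_act /es -gx pg; split=> //; rewrite gx.
Qed.

Lemma closed_over : closed [set e | U (pi e) /\ K (es e)].
Proof. by apply: compact_closed; [exact: tw_E_hausdorff|exact: compact_over]. Qed.

Lemma bis_supp e : bis h e != 0 -> U (pi e) /\ K (es e).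
Proof.
move=> be; have Ue : U (pi e).
  by apply: contrapT => nU; move: be; rewrite bis_out // eqxx.
split=> //; apply: contrapT => /hK h0.
by move: be; rewrite bis_in // h0 mulr0 eqxx.
Qed.

(** Over U this is a product of continuous functions; off U it vanishes on the
    complement of the closed set of elements over U with source in K. *)
Lemma continuous_bis : continuous (bis h).
Proof.
have [oU _ iU hS hph] := sec.
move=> e; have Fe : Filter (nbhs e) by exact: nbhs_filter.
have [Ue|nUe] := pselect (U (pi e)).
  have n : nbhs e (pi @^-1` U).
    by apply: open_nbhs_nbhs; split=> //; apply: open_preimage => //; exact: tw_pi_continuous.
  rewrite /continuous_at bis_in //.
  have c : (fun e' => circle_val (ph e') * h (es e')) @ e --> circle_val (ph e) * h (es e).
    apply: cvgM.
      by have [_ c] := hph e Ue; exact: (cvg_comp _ _ c (@continuous_circle_val R _)).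
    exact: (cvg_comp _ _ (@continuous_es e) (@ch _)).
  apply: (cvg_trans _ c); apply: near_eq_cvg.
  by apply: (@filterS _ _ Fe _ _ _ n) => e' Ue' /=; rewrite bis_in.
have n : nbhs e (~` [set e | U (pi e) /\ K (es e)]).
  by apply: open_nbhs_nbhs; split; [apply: closed_openC; exact: closed_over|move=> []].
rewrite /continuous_at bis_out //.
apply: (cvg_trans _ (@cvg_cst _ (0 : R[i]) _ (nbhs e) _)); apply: near_eq_cvg.
apply: (@filterS _ _ Fe _ _ _ n) => e' nUK /=.
by apply/eqP; rewrite eq_sym; apply/negP => /negP /bis_supp.
Qed.

Lemma Sigma_bis : Sigma_c (bis h).
Proof.
split; [exact: continuous_bis| |exact: bis_act].
apply: (@subclosed_compact _ _ [set e | U (pi e) /\ K (es e)]).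
- exact: closed_closure.
- exact: compact_over.
- rewrite closureE => e; apply; split; first exact: closed_over.
  by move=> e'; exact: bis_supp.
Qed.

End Bisection.

End TwistTopology.

(** * Functions in Sigma_c supported over bisections *)

Section SigmaC.
Context {R : realType} {G : groupoid} {T : twist R G}.
Local Notation E := (tw_E T).
Local Notation pi := (tw_pi T).
Implicit Types (f g : E -> R[i]).

Lemma sub_closure_supp f g h : (forall e, h e != 0 -> f e != 0 \/ g e != 0) ->
  compact (closure [set e | f e != 0]) -> compact (closure [set e | g e != 0]) ->
  compact (closure [set e | h e != 0 :> R[i]]).
Proof.
move=> hfg cf cg.
apply: (@subclosed_compact _ _ (closure [set e | f e != 0] `|` closure [set e | g e != 0])).
- exact: closed_closure.
- exact: compactU.
- rewrite [X in X `<=` _]closureE => e; apply; split.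
    by apply: closedU; exact: closed_closure.
  by move=> e' /hfg[]; [left|right]; exact: subset_closure.
Qed.

Lemma Sigma_add f g : Sigma_c f -> Sigma_c g -> Sigma_c (fun e => f e + g e).
Proof.
move=> [cf sf ef] [cg sg eg]; split.
- by move=> e; apply: cvgD; [exact: cf|exact: cg].
- apply: (sub_closure_supp _ sf sg) => e.
  have [->|] := eqVneq (f e) 0; last by left.
  by rewrite add0r; right.
- by move=> z e; rewrite ef eg mulrDr.
Qed.

Lemma Sigma_scale (k : R[i]) f : Sigma_c f -> Sigma_c (fun e => k * f e).
Proof.
move=> [cf sf ef]; split.
- by move=> e; apply: cvgM; [exact: cvg_cst|exact: cf].
- apply: (sub_closure_supp _ sf sf) => e h.
  by left; apply: contraNN h => /eqP ->; rewrite mulr0.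
- by move=> z e; rewrite ef mulrCA.
Qed.

Lemma Sigma_sub f g : Sigma_c f -> Sigma_c g -> Sigma_c (fun e => f e - g e).
Proof.
move=> sf sg; have := Sigma_add sf (Sigma_scale (-1) sg).
by under [X in Sigma_c X]eq_fun do rewrite mulN1r.
Qed.

Lemma Sigma0 : Sigma_c (fun _ : E => 0 : R[i]).
Proof.
split; [by move=> e; exact: cvg_cst| |by move=> z e; rewrite mulr0].
suff -> : [set e : E | (0 : R[i]) != 0] = set0 by rewrite closure0; exact: compact0.
by apply/seteqP; split=> e //=; rewrite eqxx.
Qed.

(** The involution provides the second half of an admissible pair (f, star f). *)
Lemma Sigma_star f : Sigma_c f -> Sigma_c (fun e => conjc (f (ginv e))).
Proof.
move=> [cf sf ef].
have ci : continuous (@ginv E) by apply: continuous_ginv; exact: tw_E_topological.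
split.
- move=> e; apply: (@continuous_comp _ _ _ (fun e => f (ginv e)) (@conjc R)).
    by apply: (@continuous_comp _ _ _ (@ginv E) f); [exact: ci|exact: cf].
  exact: continuous_conjc.
- have ck : compact (@ginv E @` closure [set e | f e != 0]).
    by apply: compact_image => // e _; exact: ci.
  apply: (subclosed_compact _ ck); first exact: closed_closure.
  rewrite [X in X `<=` _]closureE => e; apply; split.
    by apply: compact_closed => //; exact: tw_E_hausdorff.
  move=> e' /= h; exists (ginv e'); last by rewrite ginvK.
  by apply: subset_closure => /=; rewrite -conjc_eq0.
- by move=> z e; rewrite act_inv ef rmorphM /= circle_invE -circle_valJ conjcK.
Qed.

Lemma Sigma_cont f : Sigma_c f -> continuous f. Proof. by case. Qed.

Lemma Sigma_equi f z e : Sigma_c f -> f (tw_act z e) = circle_val z * f e.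
Proof. by case. Qed.

Section Construct.
Hypotheses (Gtop : topological_groupoid G) (Get : etale G)
  (GT2 : hausdorff_space G) (Gcpt : compact (@gunit G)).

(** Urysohn gives f with f(x) = 1 and f = 0 off W; then max(0, 2 f - 1) vanishes
    off the closed set where f is at least 1/2, which lies in W. *)
Lemma bump (x : units G) (W : set (units G)) : open W -> W x ->
  exists (h : units G -> R) (K : set (units G)),
    [/\ continuous h, h x = 1 /\ (forall y, 0 <= h y <= 1), closed K, K `<=` W &
     forall y, ~ K y -> h y = 0].
Proof.
move=> oW Wx; have hX := @hausdorff_units G GT2.
have nX : normal_space (units G) by apply: compact_normal => //; exact: compact_units.
have [||||f [cf f0 f1 fr]] := @urysohn_ext_itv (units G) R nX (~` W) [set x] 0 1.
- exact: open_closedC.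
- exact: closed_point.
- by apply/seteqP; split=> y //= [nW yx]; apply: nW; rewrite yx.
- exact: ltr01.
have fx : f x = 1 by apply: f1; exists x.
have f01 y : 0 <= f y <= 1 by have := fr (f y); rewrite /= in_itv /=; apply; exists y.
exists (fun y => Num.max 0 (2 * f y - 1)), [set y | 2^-1 <= f y]; split.
- move=> y; apply: (@continuous_max _ _ (fun=> 0) (fun y => 2 * f y - 1)).
    exact: (@cst_continuous _ R 0).
  have Fy : Filter (nbhs y) by exact: nbhs_filter.
  apply: (@cvgB _ _ _ _ _ (fun y => 2 * f y) (fun=> 1)); last exact: (@cst_continuous _ R 1).
  apply: (@cvgM _ _ _ _ (fun=> 2) f); [exact: (@cst_continuous _ R 2)|exact: cf].
- rewrite fx; split=> [|y]; first by rewrite (_ : 2 * 1 - 1 = 1 :> R) ?max_r //; lra.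
  by have /andP[? ?] := f01 y; rewrite le_max lexx /= ge_max ler01 /=; lra.
- rewrite -[[set y | _]]/(f @^-1` [set t | 2^-1 <= t]).
  apply: (proj1 (continuous_closedP _)) => //; exact: closed_ge.
- move=> y /= fy; apply: contrapT => nW; move: fy.
  by rewrite (f0 (f y)) ?leNgt ?invr_gt0 ?ltr0n //; exists y.
- move=> y /= /negP; rewrite -ltNge => fy; apply/max_idPl; lra.
Qed.

Lemma continuous_RtoC (X : topologicalType) (h : X -> R) : continuous h ->
  continuous (fun x => (h x)%:C).
Proof.
move=> ch x; have Fx : Filter (nbhs x) by exact: nbhs_filter.
apply: cvg_Complex; [exact: ch|exact: (@cst_continuous _ R 0)].
Qed.

(** Every element e of the twist is seen by a function of Sigma_c supported over a
    bisection. These functions give the admissible pairs through e. *)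
Lemma exists_bisection_fun (e : E) (W : set (units G)) (W' : set G) :
  open W -> W (es e) -> open W' -> W' (pi e) ->
  exists (U : set G) (a : E -> R[i]),
    [/\ [/\ open U, {in U &, injective (@rng0 G)} & {in U &, injective (@src0 G)}],
      U `<=` W' /\ U (pi e), Sigma_c a, a e = 1 &
      forall e', a e' != 0 -> U (pi e') /\ W (es e')].
Proof.
move=> oW We oW' We'.
have [U0 [S [ph [[oU0 r0 s0 hS hph] U0e]]]] := @exists_local_section R G T (pi e).
pose U := U0 `&` W'.
have sec : local_section U S ph.
  split.
  - exact: openI.
  - by move=> g h /set_mem[? _] /set_mem[? _]; apply: r0; exact: mem_set.
  - by move=> g h /set_mem[? _] /set_mem[? _]; apply: s0; exact: mem_set.
  - by move=> g [/hS].
  - by move=> e' [/hph].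
have oU : open U by case: sec.
have Ue : U (pi e) by [].
have [||h [K [ch [hx _] cK KW hK]]] := @bump (es e) (W `&` @src0 G @` U).
- by apply: openI => //; exact: open_src0.
- by split=> //; exists (pi e).
pose k y := (circle_val (ph e))^-1 * (h y)%:C.
have ck : continuous k.
  move=> y; have Fy : Filter (nbhs y) by exact: nbhs_filter.
  apply: (@cvgM _ _ _ _ (fun=> (circle_val (ph e))^-1) (fun y => (h y)%:C)).
    exact: (@cst_continuous _ R[i]).
  exact: continuous_RtoC.
have kK y : ~ K y -> k y = 0 by move=> /hK; rewrite /k => ->; rewrite mulr0.
have KU : K `<=` @src0 G @` U by move=> y /KW[].
exists U, (bis U ph k); split.
- by case: sec.
- by split=> // g [].
- exact: (Sigma_bis Gtop Get Gcpt sec ck cK KU kK).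
- by rewrite bis_in // /k hx mulr1 mulfV ?circle_neq0.
- move=> e' /(bis_supp kK)[Ue' /KW[]//].
Qed.

(** The function i(x, z) |-> z F(x) on the elements over units: the copy of C(G^0)
    inside Sigma_c. *)
Definition ext (F : units G -> R[i]) : E -> R[i] := bis (@gunit G) unit_phase F.

Lemma Sigma_ext F : continuous F -> Sigma_c (ext F).
Proof.
move=> cF; apply: (@Sigma_bis _ _ _ Gtop Get Gcpt _ _ _ _ _ setT) => //.
- exact: unit_local_section.
- by move=> x _; exists (unit_val x); [exact: unit_valP|exact: src0_unit].
- by move=> x nx; case: nx.
Qed.

Lemma ext_out F e : ~ gunit (pi e) -> ext F e = 0.
Proof. exact: bis_out. Qed.

Lemma ext_tw_i F x z : ext F (tw_i T (x, z)) = circle_val z * F x.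
Proof.
have u : gunit (pi (tw_i T (x, z))) by rewrite pi_tw_i; exact: unit_valP.
rewrite /ext bis_in // es_tw_i; congr (circle_val _ * _).
by have /tw_i_inj[_ <-] := unit_phaseP u.
Qed.

Lemma ext_unit F x : ext F (tw_unit T x) = F x.
Proof. by rewrite ext_tw_i /= mul1r. Qed.

End Construct.

End SigmaC.

(** * Integration along the fibres of the source map *)

Section FibreIntegral.
Context {R : realType} {G : groupoid} {T : twist R G}.
Hypothesis GT2 : hausdorff_space G.
Local Notation E := (tw_E T).
Local Notation pi := (tw_pi T).
Variable x : units G.
Local Notation Ex := (tw_fibre T x).
Local Notation lf := (fibre_lift T x).

Definition fibre_coset (g : G) : set (fibre_borel T x) :=
  [set e | pi (fibre_val e) = g].

Lemma continuous_fibre_val : continuous (@fibre_val R G T x).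
Proof. exact: initial_continuous. Qed.

Lemma measurable_fibre_coset g : measurable (fibre_coset g).
Proof.
have c : closed [set e : Ex | pi (fibre_val e) = g].
  rewrite -[[set e | _]]/((pi \o @fibre_val R G T x) @^-1` [set g]).
  apply: (proj1 (continuous_closedP _)); last exact: closed_point.
  move=> e; apply: continuous_comp; first exact: continuous_fibre_val.
  exact: tw_pi_continuous.
rewrite -[fibre_coset g]setCK; apply: measurableC; apply: sub_sigma_algebra.
exact: closed_openC.
Qed.

(** The fibre measure restricted to a coset of the circle is normalized Haar
    measure, so the coset has mass 1. *)
Lemma nu_fibre_coset g : src0 g = x -> nu T x (fibre_coset g) = 1%E.
Proof.
move=> gx; have pf h z : src0 h = x -> pi (fibre_val (fibre_act z (lf h))) = h.
  by move=> hx; rewrite fibre_val_act pi_act fibre_liftP.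
rewrite /nu (esumID [set g]); last by move=> i _; exact: measure_ge0.
rewrite [X in (_ + X)%E]esum1 ?adde0; last first.
  move=> h [/= hx hg]; rewrite /circle_haar (_ : _ `&` _ = set0) ?measure0 //.
  apply/seteqP; split=> // t [_]; rewrite /fibre_coset /= pf //.
  exact: unit_val_inj.
have -> : [set g : G | src g = unit_val x] `&` [set g] = [set g].
  by apply/seteqP; split=> [h []//|h -> /=]; split=> //=; rewrite -gx.
rewrite esum_set1; last exact: measure_ge0.
rewrite /circle_haar (_ : _ `&` _ = `[0, 1]%classic); last first.
  by apply/seteqP; split=> [t []//|t t01]; split=> //; rewrite /fibre_coset /= pf.
by rewrite lebesgue_measure_itv /= lte_fin ltr01 -EFinB subr0.
Qed.

Lemma fibre_orbit (e : Ex) : exists z, e = fibre_act z (lf (pi (fibre_val e))).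
Proof.
have gx : src0 (pi (fibre_val e)) = x by exact: es_fibre.
have [z ez] := pi_eq_act (@fibre_liftP R G T x _ gx).
by exists z; apply: fibre_val_inj; rewrite fibre_val_act.
Qed.

Definition fibre_invariant (S : Type) (h : Ex -> S) : Prop :=
  forall z e, h (fibre_act z e) = h e.

Lemma fibre_invariantE (S : Type) (h : Ex -> S) e g :
  fibre_invariant h -> pi (fibre_val e) = g -> h e = h (lf g).
Proof. by move=> ih <-; have [z {1}->] := fibre_orbit e. Qed.

Definition fibre_seq (s : seq G) : Prop := uniq s /\ {in s, forall g, src0 g = x}.

Section Sum.
Variables (s : seq G) (h : Ex -> R).
Hypotheses (fs : fibre_seq s) (ih : fibre_invariant h)
  (hs : forall e, h e != 0 -> pi (fibre_val e) \in s).

Lemma fibre_sumE e : h e = \sum_(g <- s) h (lf g) * \1_(fibre_coset g) e.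
Proof.
have [us sx] := fs.
have [es|nes] := boolP (pi (fibre_val e) \in s).
  rewrite (bigD1_seq _ es us) /= indicE mem_set // mulr1 big1 ?addr0.
    exact: fibre_invariantE.
  move=> g /eqP ge; rewrite indicE memNset ?mulr0 //.
  by move=> /= eg; apply: ge.
rewrite big_seq big1 => [|g gs].
  by apply/eqP/negPn; apply: contraNN nes => /hs.
rewrite indicE memNset ?mulr0 // => /= eg.
by move: nes; rewrite eg gs.
Qed.

Let I g := (fun e : fibre_borel T x => (\1_(fibre_coset g) e)%:E : \bar R).

Let integrable_I g : g \in s -> (nu T x).-integrable setT (I g).
Proof.
move=> gs; have [us sx] := fs.
apply/integrableP; split.
  by apply/measurable_EFinP; apply: measurable_indic; exact: measurable_fibre_coset.
rewrite (_ : (fun _ => _) = I g); last first.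
  by apply/funext => e; rewrite /I /= ger0_norm.
rewrite integral_indic //; last exact: measurable_fibre_coset.
by rewrite setIT [X in (X < _)%E]nu_fibre_coset ?sx // ltry.
Qed.

Lemma fibre_sum_integrable :
  (nu T x).-integrable setT (fun e : fibre_borel T x => (h e)%:E).
Proof.
have -> : (fun e => (h e)%:E) = (fun e => (\sum_(g <- s | g \in s) (h (lf g))%:E * I g e)%E).
  apply/funext => e; rewrite {1}fibre_sumE -sumEFin big_seq.
  by apply: eq_bigr => g _; rewrite EFinM.
apply: integrable_sum => // g gs; apply: integrableZl => //.
exact: integrable_I.
Qed.

Lemma fibre_sum_integral :
  (\int[nu T x]_(e in setT) (h e)%:E = (\sum_(g <- s) h (lf g))%:E)%E.
Proof.
have -> : (fun e => (h e)%:E) =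
    (fun e => (\sum_(g <- s | true) (h (lf g))%:E * (if g \in s then I g e else 0))%E).
  apply/funext => e; rewrite {1}fibre_sumE -sumEFin big_seq [RHS]big_seq.
  by apply: eq_bigr => g ->; rewrite EFinM.
have [us sx] := fs.
have it g : (nu T x).-integrable setT
    (fun e => ((h (lf g))%:E * (if g \in s then I g e else 0))%E).
  apply: integrableZl => //; have [gs|gs] := boolP (g \in s); first exact: integrable_I.
  exact: integrable0.
rewrite (integral_sum measurableT it) -sumEFin big_seq [RHS]big_seq.
apply: eq_bigr => g gs; rewrite gs integralZl //; last exact: integrable_I.
rewrite integral_indic //; last exact: measurable_fibre_coset.
by rewrite setIT [X in (_ * X)%E]nu_fibre_coset ?sx // mule1.
Qed.

End Sum.

(** Each coset has mass 1, so the integral of an invariant function supported on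
    finitely many cosets is the sum of its values there. All convolutions are
    computed in this way. *)
Lemma fibre_integralE (s : seq G) (h : Ex -> R[i]) : fibre_seq s -> fibre_invariant h ->
  (forall e, h e != 0 -> pi (fibre_val e) \in s) ->
  fibre_integral h = \sum_(g <- s) h (lf g).
Proof.
move=> fs ih hs; rewrite /fibre_integral /Rintegral.
rewrite (@fibre_sum_integral s) //; first last.
- move=> e h0; apply: hs; apply: contraNN h0 => /eqP ->; exact/eqP.
- by move=> z e; rewrite ih.
rewrite (@fibre_sum_integral s) //; first last.
- move=> e h0; apply: hs; apply: contraNN h0 => /eqP ->; exact/eqP.
- by move=> z e; rewrite ih.
rewrite /=; elim: (s) => [|g r IH]; rewrite ?big_nil ?big_cons //.
by rewrite -IH; case: (h (lf g)).
Qed.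

End FibreIntegral.

Section SeqSums.
Context {I : eqType} {R : numDomainType}.

Lemma sum_sub_seq (V : nmodType) (s s' : seq I) (F : I -> V) : uniq s -> uniq s' ->
  {subset s <= s'} -> (forall i, i \in s' -> i \notin s -> F i = 0) ->
  \sum_(i <- s') F i = \sum_(i <- s) F i.
Proof.
move=> us us' ss' F0; rewrite -(@big_rmcond_in _ _ _ _ s' [in s]) //.
rewrite -big_filter; apply: perm_big; apply: uniq_perm => //; first exact: filter_uniq.
move=> i; rewrite mem_filter; case: (boolP (i \in s)) => //= /ss'.
by [].
Qed.

Lemma sum_sub_seq_le (s s' : seq I) (F : I -> R) : uniq s -> uniq s' ->
  {subset s <= s'} -> (forall i, 0 <= F i) -> \sum_(i <- s) F i <= \sum_(i <- s') F i.
Proof.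
move=> us us' ss' F0; rewrite [leRHS](bigID [in s]) /= -[X in _ <= X + _]big_filter.
rewrite [X in _ <= X + _](perm_big s); first by rewrite lerDl sumr_ge0.
apply: uniq_perm => //; first exact: filter_uniq.
by move=> i; rewrite mem_filter; case: (boolP (i \in s)) => //= /ss'.
Qed.

End SeqSums.

Lemma finite_uniq_seq (I : eqType) (A : set I) : finite_set A ->
  exists s : seq I, uniq s /\ forall i, (i \in s) <-> A i.
Proof.
move=> /finite_seqP[s ->]; exists (undup s); split; first exact: undup_uniq.
by move=> i; rewrite mem_undup.
Qed.

Section FibreEstimates.
Context {R : realType} {G : groupoid} {T : twist R G}.
Hypotheses (GT2 : hausdorff_space G).
Local Notation E := (tw_E T).
Local Notation pi := (tw_pi T).
Variable x : units G.
Local Notation Ex := (tw_fibre T x).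
Local Notation lf := (fibre_lift T x).

Lemma fibre_measurable (k : Ex -> R) : continuous k ->
  measurable_fun [set: fibre_borel T x] k.
Proof.
move=> ck; apply: (measurability (@RGenOInfty.G R)).
  exact: RGenOInfty.measurableE.
move=> _ [_ [a ->] <-]; rewrite setTI; apply: sub_sigma_algebra.
by apply: (open_preimage ck); exact: interval_open.
Qed.

Lemma fibre_integral_ge (k : Ex -> R) (s : seq G) :
  measurable_fun [set: fibre_borel T x] k -> (forall e, 0 <= k e) ->
  fibre_invariant k -> fibre_seq x s ->
  ((\sum_(g <- s) k (lf g))%:E <= \int[nu T x]_(e in setT) (k e)%:E)%E.
Proof.
move=> mk k0 ik fs; pose k' e := if pi (fibre_val e) \in s then k e else 0.
have ik' : fibre_invariant k' by move=> z e; rewrite /k' fibre_val_act pi_act ik.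
have sk' e : k' e != 0 -> pi (fibre_val e) \in s.
  by rewrite /k'; case: ifP => //; rewrite eqxx.
have -> : \sum_(g <- s) k (lf g) = \sum_(g <- s) k' (lf g).
  rewrite big_seq [RHS]big_seq; apply: eq_bigr => g gs.
  by rewrite /k' fibre_liftP ?gs //; have [_ ->] := fs.
rewrite -(fibre_sum_integral GT2 fs ik' sk').
have /integrableP[mk' _] := fibre_sum_integrable GT2 fs ik' sk'.
apply: ge0_le_integral => //.
- by move=> e _; rewrite lee_fin /k'; case: ifP.
- exact/measurable_EFinP.
- by move=> e _; rewrite lee_fin /k'; case: ifP.
Qed.

(** By the bound on finite sums, the function exceeds 1/(n+1) on finitely many
    cosets only; so it is the monotone limit of functions supported on finitely
    many cosets. *)
Lemma fibre_integral_le (k : Ex -> R) (B : R) : (forall e, 0 <= k e) ->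
  fibre_invariant k ->
  (forall s, fibre_seq x s -> \sum_(g <- s) k (lf g) <= B) ->
  (\int[nu T x]_(e in setT) (k e)%:E <= B%:E)%E.
Proof.
move=> k0 ik hB.
(* D n is finite, as N elements of it would give a finite sum above N / (n
    + 1). *)
pose D n : set G := [set g | src0 g = x /\ n.+1%:R^-1 < k (lf g)].
have fD n : finite_set (D n).
  apply: contrapT => infD.
  pose N := Num.bound (B * n.+1%:R).
  have [F0 FD0 NF] := infinite_set_fset N infD.
  pose F : seq G := finmap.enum_fset F0.
  have FD g : g \in F -> D n g by exact: (FD0 g).
  have fsF : fibre_seq x F by split=> [|g /FD[]//]; exact: finmap.fset_uniq.
  have := hB F fsF; apply/negP; rewrite -ltNge.
  have B0 : 0 <= B * n.+1%:R.
    by rewrite mulr_ge0 // (le_trans _ (hB [::] _)) ?big_nil.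
  have lt : B < N%:R * n.+1%:R^-1.
    by rewrite ltr_pdivlMr ?ltr0n //; exact: archi_boundP.
  apply: (lt_le_trans lt); apply: (@le_trans _ _ (\sum_(g <- F) n.+1%:R^-1)).
    by rewrite big_const_seq count_predT iter_addr_0 -[leRHS]mulr_natl ler_wpM2r ?invr_ge0 // ler_nat.
  rewrite big_seq [leRHS]big_seq; apply: ler_sum => g /FD[_ /ltW//].
pose kn n (e : Ex) := if n.+1%:R^-1 < k e then k e else 0.
have ikn n : fibre_invariant (kn n) by move=> z e; rewrite /kn ik.
have [sq hsq] := choice (fun n => finite_uniq_seq (fD n)).
have fsq n : fibre_seq x (sq n).
  by have [us h] := hsq n; split=> // g /h[].
have skn n e : kn n e != 0 -> pi (fibre_val e) \in sq n.
  rewrite /kn; case: ifPn => [lt _|_]; last by rewrite eqxx.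
  have [_ h] := hsq n; apply/h; split; first exact: es_fibre.
  by rewrite -(fibre_invariantE ik erefl).
have kn0 n e : 0 <= kn n e by rewrite /kn; case: ifP.
have knk n e : kn n e <= k e by rewrite /kn; case: ifP.
have mkn n : measurable_fun [set: fibre_borel T x] (fun e => (kn n e)%:E).
  by have /integrableP[] := fibre_sum_integrable GT2 (fsq n) (ikn n) (skn n).
have homo (e : fibre_borel T x) : setT e ->
    {homo (fun n => (kn n e)%:E) : n m / (n <= m)%N >-> (n <= m)%E}.
  move=> _ n m nm; rewrite lee_fin /kn; case: ifPn => [lt|_]; last by case: ifP.
  rewrite ifT // (le_lt_trans _ lt) // lef_pV2 ?posrE ?ltr0n // ler_nat ltnS.
  exact: nm.
have cv := @cvg_monotone_convergence _ _ _ (nu T x) _ measurableT _ mkn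
  (fun n e _ => kn0 n e) homo.
have limE : (fun e => limn (fun n => (kn n e)%:E)) = (fun e => (k e)%:E).
  apply/funext => e; apply: lim_near_cst => //.
  have [ke|ke] := ltP 0 (k e); last first.
    near=> n; have e0 : k e = 0 by apply/eqP; rewrite eq_le ke k0.
    by rewrite /kn e0; case: ifP.
  near=> n; rewrite /kn ifT //; near: n.
  exact: (near_infty_natSinv_lt (PosNum ke)).
rewrite -limE -(cvg_lim _ cv) //; apply: lime_le.
  by apply/cvg_ex; eexists; exact: cv.
apply: nearW => n; rewrite (fibre_sum_integral GT2 (fsq n) (ikn n) (skn n)) lee_fin.
apply: le_trans (hB _ (fsq n)); exact: ler_sum.
Unshelve. all: by end_near. Qed.

End FibreEstimates.

(** * The reduced norm as a bound on finite matrices *)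

Section MatrixNorm.
Context {R : realType} {G : groupoid} {T : twist R G}.
Hypotheses (Gtop : topological_groupoid G) (Get : etale G)
  (GT2 : hausdorff_space G) (Gcpt : compact (@gunit G)).
Local Notation E := (tw_E T).
Local Notation pi := (tw_pi T).
Variable p : R.
Hypothesis p1 : 1 <= p.
Implicit Types (f a : E -> R[i]) (s : seq G) (c : G -> R[i]).

Let p0 : 0 < p. Proof. exact: lt_le_trans p1. Qed.
Let pn0 : p != 0. Proof. by rewrite gt_eqF. Qed.

Definition equivariant f : Prop := forall z e, f (tw_act z e) = circle_val z * f e.

(** An elementary form of the bound |lambda_x(a)| <= M for all x: the finite
    corners of the matrices a(g h^-1), g and h in G_x, have norm at most M on l^p.
    The lifts only conjugate these matrices by diagonal unitaries. *)
Definition matrix_bounded (M : R) a : Prop :=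
  forall x s c, fibre_seq x s ->
    \sum_(g <- s) nrm (\sum_(h <- s) a (gmul (lift g) (ginv (lift h))) * c h) `^ p
      <= M `^ p * \sum_(h <- s) nrm (c h) `^ p.

Lemma lift_fibre (x : units G) (g : G) : src0 g = x ->
  fibre_val (fibre_lift T x g) = lift g.
Proof. by move<-. Qed.

Lemma equivariant_div f (e d : E) z : equivariant f -> es e = es d ->
  f (gmul e (ginv (tw_act z d))) = (circle_val z)^-1 * f (gmul e (ginv d)).
Proof. by move=> ef ec; rewrite act_inv act_mulr ?er_inv // ef. Qed.

Lemma lambda_sum (x : units G) s f (xi : tw_fibre T x -> R[i]) (e : tw_fibre T x) :
  equivariant f -> (forall z d, xi (fibre_act z d) = circle_val z * xi d) ->
  fibre_seq x s ->
  (forall d, f (gmul (fibre_val e) (ginv (fibre_val d))) * xi d != 0 ->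
     pi (fibre_val d) \in s) ->
  lambda f xi e =
    \sum_(g <- s) f (gmul (fibre_val e) (ginv (lift g))) * xi (fibre_lift T x g).
Proof.
move=> ef exi fs hs; rewrite /lambda (fibre_integralE GT2 fs) //.
- rewrite big_seq [RHS]big_seq; apply: eq_bigr => g gs.
  by rewrite lift_fibre //; case: fs => _; apply.
- move=> z c /=; rewrite fibre_val_act equivariant_div ?es_fibre // exi.
  by rewrite mulrACA mulVf ?circle_neq0 // mul1r.
Qed.

Lemma Sigma_finite_src f (x : units G) : Sigma_c f ->
  exists s, fibre_seq x s /\ forall e, es e = x -> f e != 0 -> pi e \in s.
Proof.
move=> [_ cf _].
have cK : compact (pi @` closure [set e | f e != 0]).
  by apply: compact_image => // e _; exact: tw_pi_continuous.
have [s [us hs]] := finite_uniq_seq (compact_src_finite Gtop Get GT2 x cK).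
exists s; split; first by split=> // g /hs[].
move=> e ex fe; apply/hs; split=> //; exists e => //; exact: subset_closure.
Qed.

Lemma Sigma_finite_div f (e0 : E) : Sigma_c f ->
  exists s, fibre_seq (es e0) s /\
    forall e, es e = es e0 -> f (gmul e0 (ginv e)) != 0 -> pi e \in s.
Proof.
move=> /Sigma_star sf; have [s [[us sx] hs]] := Sigma_finite_src (er e0) sf.
exists (undup (map (fun g => gmul g (pi e0)) s)); split.
  split; first exact: undup_uniq.
  move=> _ /[!mem_undup]/mapP[g gs ->].
  by rewrite src0M // sx.
move=> e ee fe; rewrite mem_undup; apply/mapP; exists (pi (gmul e (ginv e0))).
  apply: hs; first by rewrite esM ?er_inv // es_inv.
  by rewrite invM ?er_inv // ginvK conjc_eq0.
by rewrite -piM ?mulVK // esM ?er_inv // es_inv.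
Qed.

(** A function that on the fibre of E over s(g) is concentrated on the coset of g:
    an equivariant basis vector of L^p(G_x; E_x). *)
Lemma fibre_bump (g : G) : exists a, [/\ Sigma_c a, a (lift g) = 1 &
  forall e, es e = src0 g -> a e != 0 -> pi e = g].
Proof.
have [||||U [a [[oU _ iU] [_ Ug] sa a1 ha]]] :=
  @exists_bisection_fun R G T Gtop Get GT2 Gcpt (lift g) setT setT => //.
- exact: openT.
- exact: openT.
exists a; split=> // e eg /ha[Ue _]; move: Ug; rewrite pi_lift => Ug.
by apply: iU; rewrite ?inE.
Qed.

Lemma Lp_norm_powR (x : units G) (xi : tw_fibre T x -> R[i]) :
  (Lp_norm p xi `^ p = \int[nu T x]_(e in setT) (nrm (xi e) `^ p)%:E)%E.
Proof.
rewrite /Lp_norm powR_Lnorm; last exact: pn0.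
apply: eq_integral => e _.
rewrite (_ : complex.Re `|xi e| = nrm (xi e)); last by rewrite /nrm.
by rewrite /= ger0_norm ?nrm_ge0.
Qed.

Lemma Lp_norm_le (x : units G) (xi : tw_fibre T x -> R[i]) (M : R) : 0 <= M ->
  (Lp_norm p xi <= M%:E)%E <->
  (\int[nu T x]_(e in setT) (nrm (xi e) `^ p)%:E <= (M `^ p)%:E)%E.
Proof.
move=> M0; rewrite -Lp_norm_powR -poweR_EFin.
have L0 : (0 <= Lp_norm p xi)%E by exact: Lnorm_ge0.
split=> h.
  apply: gt0_ler_poweR => //; first exact: ltW.
    by rewrite in_itv /= L0 leey.
  by rewrite in_itv /= leey lee_fin M0.
have := @gt0_ler_poweR R p^-1 _ _ _ _ _ h.
rewrite -!poweRrM divff // !poweRe1 ?lee_fin //; apply.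
- by rewrite invr_ge0 ltW.
- by rewrite in_itv; apply/andP; split; [exact: poweR_ge0|exact: leey].
- by rewrite in_itv; apply/andP; split; [exact: poweR_ge0|exact: leey].
Qed.

Lemma continuous_fibre_fun (x : units G) f : continuous f ->
  continuous (fun e : tw_fibre T x => f (fibre_val e)).
Proof.
move=> cf e; apply: continuous_comp; [exact: continuous_fibre_val|exact: cf].
Qed.

Lemma continuous_div f (e0 : E) (x : units G) : es e0 = x -> continuous f ->
  continuous (fun e : tw_fibre T x => f (gmul (fibre_val e) (ginv e0))).
Proof.
move=> <- cf e; have Fe : Filter (nbhs e) by exact: nbhs_filter.
have c : gmul (fibre_val e') (ginv e0) @[e' --> e] --> gmul (fibre_val e) (ginv e0).
  apply: cvg_mul.
  - by apply: nearW => e'; rewrite er_inv es_fibre.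
  - by rewrite er_inv es_fibre.
  - exact: continuous_fibre_val.
  - exact: cvg_cst.
exact: (cvg_comp _ _ c (cf _)).
Qed.

Lemma continuous_lin (X : topologicalType) (s : seq G) (F : G -> X -> R[i]) c :
  {in s, forall h, continuous (F h)} -> continuous (fun e => \sum_(h <- s) F h e * c h).
Proof.
move=> cF e; have Fe : Filter (nbhs e) by exact: nbhs_filter.
apply: (@cvg_sum_seq _ _ _ _ _ s (fun h e => F h e * c h)) => h hs.
apply: cvgM; first exact: cF.
exact: (@cst_continuous X R[i]).
Qed.

(** A finitely supported vector c is the restriction to lifts of a vector xi in
    L^p(G_x; E_x); the l^p norm of a corner of lambda_x(f) xi is at most its L^p
    norm. *)
Lemma matrix_bounded_norm f (N : R) : Sigma_c f -> reduced_norm p f = N%:E ->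
  matrix_bounded N f.
Proof.
move=> sf fN x s c fs; have [us sx] := fs.
have ef : equivariant f by case: sf.
have [a ha] := choice fibre_bump.
set S := \sum_(h <- s) nrm (c h) `^ p.
have S0 : 0 <= S by apply: sumr_ge0 => h _; exact: powR_ge0.
have [S00|Sn0] := eqVneq S 0.
  have c0 h : h \in s -> c h = 0.
    move=> hs; apply/eqP; rewrite -nrm_eq0; apply/eqP/(@powR_eq0_eq0 _ _ p).
    move: S00; rewrite /S (bigD1_seq h) //= => /eqP.
    rewrite paddr_eq0 ?powR_ge0 ?sumr_ge0 // => [/andP[/eqP]//|g _].
    exact: powR_ge0.
  rewrite S00 mulr0 big1 // => g _; rewrite big_seq big1 ?nrm0 ?powR0 // => h hs.
  by rewrite c0 // mulr0.
have Sgt0 : 0 < S by rewrite lt_def Sn0.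
(* Divide the vector by its norm t, since the operator norm is a supremum
    over the unit ball. *)
pose t := S `^ p^-1.
have t0 : 0 < t by exact: powR_gt0.
have tp : t `^ p = S by rewrite -powRrM mulVf // powRr1.
pose c' h := c h * (t%:C)^-1.
have nc' z : nrm (z * (t%:C)^-1) `^ p = nrm z `^ p / S.
  rewrite cabsM cabsV cabsR gtr0_norm // powRM ?nrm_ge0 ?invr_ge0 ?(ltW t0) //.
  by rewrite -powR_inv1 ?(ltW t0) // -powRrM mulN1r powRN tp.
pose xi (e : tw_fibre T x) := \sum_(h <- s) a h (fibre_val e) * c' h.
have sa h : Sigma_c (a h) by case: (ha h).
have xi_supp e : xi e != 0 -> pi (fibre_val e) \in s.
  apply: contraNT => nes; rewrite /xi big_seq big1 // => h hs.
  have [_ _ hh] := ha h; apply/eqP; rewrite mulf_eq0; apply/orP; left.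
  apply: contraNT nes => /hh -> //.
  by rewrite es_fibre sx.
have xi_lift g : g \in s -> xi (fibre_lift T x g) = c' g.
  move=> gs; rewrite /xi (bigD1_seq g) //= lift_fibre ?sx //.
  have [_ -> _] := ha g; rewrite mul1r big_seq_cond big1 ?addr0 // => h /andP[hs hg].
  have [_ _ hh] := ha h; apply/eqP; rewrite mulf_eq0; apply/orP; left.
  apply: contraNT hg => /hh; rewrite es_lift pi_lift !sx // => ->//.
have xi_act z e : xi (fibre_act z e) = circle_val z * xi e.
  rewrite /xi mulr_sumr; apply: eq_bigr => h _.
  by rewrite fibre_val_act (Sigma_equi _ _ (sa h)) mulrA.
have cxi : continuous xi.
  apply: continuous_lin => h hs.
  by apply: continuous_fibre_fun; case: (sa h).
have ixi : fibre_invariant (fun e => nrm (xi e) `^ p).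
  by move=> z e; rewrite xi_act cabsM cabs_circle mul1r.
have xi1 : (Lp_norm p xi <= 1%:E)%E.
  apply/Lp_norm_le => //; rewrite (fibre_sum_integral GT2 fs ixi) => [|e].
    rewrite lee_fin powR1 big_seq (eq_bigr (fun g => nrm (c g) `^ p / S)) => [|g gs].
      by rewrite -big_seq -mulr_suml mulfV.
    by rewrite xi_lift // nc'.
  move=> h; apply: xi_supp; apply: contraNN h => /eqP ->.
  by rewrite nrm0 powR0.
have sxi : Lp_space p xi.
  split=> //; last by apply: le_lt_trans xi1 _; rewrite ltry.
  split; apply: fibre_measurable => e; have Fe : Filter (nbhs e) by exact: nbhs_filter.
    by apply: (@continuous_comp _ _ _ xi); [exact: cxi|exact: continuous_Re].
  by apply: (@continuous_comp _ _ _ xi); [exact: cxi|exact: continuous_Im].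
have lamE e : lambda f xi e = \sum_(h <- s) f (gmul (fibre_val e) (ginv (lift h))) * c' h.
  rewrite (lambda_sum ef xi_act fs).
    by rewrite big_seq [RHS]big_seq; apply: eq_bigr => h hs; rewrite xi_lift.
  by move=> d fd; apply: xi_supp; apply: contraNN fd => /eqP ->; rewrite mulr0.
have N0 : 0 <= N.
  by rewrite -lee_fin -fN; apply: ereal_sup_ubound; left.
have lamN : (Lp_norm p (lambda f xi) <= N%:E)%E.
  rewrite -fN; apply: (@le_trans _ _ (lambda_norm p x f)).
    by apply: ereal_sup_ubound; exists xi.
  by apply: ereal_sup_ubound; right; exists x.
move/(Lp_norm_le _ N0) in lamN.
have clam : continuous (lambda f xi).
  have -> : lambda f xi = fun e => \sum_(h <- s) f (gmul (fibre_val e) (ginv (lift h))) * c' h.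
    exact/funext.
  apply: (@continuous_lin (tw_fibre T x) s (fun h e => f (gmul (fibre_val e) (ginv (lift h)))) c').
  by move=> h hs; apply: continuous_div; [rewrite es_lift sx|case: sf].
have := @fibre_integral_ge _ _ _ GT2 x (fun e => nrm (lambda f xi e) `^ p) s _ _ _ fs.
have -> : \sum_(g <- s) nrm (lambda f xi (fibre_lift T x g)) `^ p =
    (\sum_(g <- s) nrm (\sum_(h <- s) f (gmul (lift g) (ginv (lift h))) * c h) `^ p) / S.
  rewrite mulr_suml big_seq [RHS]big_seq; apply: eq_bigr => g gs.
  rewrite lamE lift_fibre ?sx // -nc' mulr_suml; congr (nrm _ `^ p).
  by apply: eq_bigr => h _; rewrite mulrA.
move=> H; rewrite -ler_pdivrMr // -lee_fin; apply: le_trans lamN; apply: H.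
- apply: (@measurableT_comp _ _ _ _ _ _ (fun r => r `^ p)) => //.
  apply: fibre_measurable => e.
  by apply: (@continuous_comp _ _ _ (lambda f xi)); [exact: clam|exact: continuous_nrm].
- by move=> e; exact: powR_ge0.
- move=> z e; have -> : lambda f xi (fibre_act z e) = circle_val z * lambda f xi e.
    rewrite !lamE mulr_sumr big_seq [RHS]big_seq; apply: eq_bigr => h hs.
    by rewrite fibre_val_act act_mull ?ef ?mulrA // es_fibre er_inv es_lift sx.
  by rewrite cabsM cabs_circle mul1r.
Qed.

End MatrixNorm.

Section MatrixNormConverse.
Context {R : realType} {G : groupoid} {T : twist R G}.
Hypotheses (Gtop : topological_groupoid G) (Get : etale G)
  (GT2 : hausdorff_space G) (Gcpt : compact (@gunit G)).
Local Notation E := (tw_E T).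
Local Notation pi := (tw_pi T).
Variable p : R.
Hypothesis p1 : 1 <= p.
Implicit Types (f a : E -> R[i]) (s : seq G) (c : G -> R[i]).

Lemma fibre_seq_cat (x : units G) s s' : fibre_seq x s -> fibre_seq x s' ->
  fibre_seq x (undup (s ++ s')).
Proof.
move=> [us sx] [us' sx']; split; first exact: undup_uniq.
by move=> g; rewrite mem_undup mem_cat => /orP[/sx|/sx'].
Qed.

(** A row of the matrix of f is, up to conjugation, a column of the matrix of its
    adjoint, so it has finitely many nonzero entries. *)
Lemma Sigma_finite_rows f (x : units G) s : Sigma_c f -> fibre_seq x s ->
  exists s', [/\ fibre_seq x s', {subset s <= s'} &
    forall g e, g \in s -> es e = x -> f (gmul (lift g) (ginv e)) != 0 -> pi e \in s'].
Proof.
move=> sf [us sx].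
suff [s' [fs' h]] : exists s', fibre_seq x s' /\
    forall g e, g \in s -> es e = x -> f (gmul (lift g) (ginv e)) != 0 -> pi e \in s'.
  exists (undup (s ++ s')); split.
  - by apply: fibre_seq_cat.
  - by move=> g gs; rewrite mem_undup mem_cat gs.
  - by move=> g e gs ex fe; rewrite mem_undup mem_cat (h g e) ?orbT.
elim: s us sx => [|g s IH] us sx; first by exists [::]; split.
have [] := IH.
- by case/andP: us.
- by move=> h hs; apply: sx; rewrite inE hs orbT.
move=> s1 [fs1 h1]; have gx : src0 g = x by apply: sx; rewrite inE eqxx.
have [s2 []] := Sigma_finite_div Gtop Get GT2 (lift g) sf.
rewrite es_lift gx => fs2 h2; exists (undup (s1 ++ s2)); split.
  exact: fibre_seq_cat.
move=> h e; rewrite inE mem_undup mem_cat => /orP[/eqP ->|hs] ex fe.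
  by rewrite (h2 e) ?orbT.
by rewrite (h1 h e).
Qed.

(** The norm of lambda_x(f) xi is the supremum over finite sets of rows, and each
    such set of rows involves only finitely many coordinates of xi. *)
Lemma norm_le_matrix_bounded f (M : R) : Sigma_c f -> 0 <= M ->
  matrix_bounded p M f -> (reduced_norm p f <= M%:E)%E.
Proof.
move=> sf M0 bf; apply: ge_ereal_sup => _ [->|[x _ <-]]; first by rewrite lee_fin.
have ef : equivariant f by case: sf.
apply: ge_ereal_sup => _ [xi [[[mRe mIm] exi _] xi1] <-].
apply/(Lp_norm_le p1) => //.
have pos (h : tw_fibre T x -> R[i]) e : 0 <= nrm (h e) `^ p by exact: powR_ge0.
move/(Lp_norm_le p1 _ ler01) : xi1; rewrite powR1 => xi1.
have lamE s (e : tw_fibre T x) : fibre_seq x s -> (forall d, es d = x ->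
    f (gmul (fibre_val e) (ginv d)) != 0 -> pi d \in s) -> lambda f xi e =
    \sum_(h <- s) f (gmul (fibre_val e) (ginv (lift h))) * xi (fibre_lift T x h).
  move=> fs hs; apply: lambda_sum => // d nz; apply: hs; first exact: es_fibre.
  by apply: contraNN nz => /eqP ->; rewrite mul0r.
have mxi : measurable_fun [set: fibre_borel T x] (fun e => nrm (xi e) `^ p).
  apply: (@measurableT_comp _ _ _ _ _ _ (fun r => r `^ p)) => //.
  have -> : (fun e => nrm (xi e)) =
      fun e => Num.sqrt (complex.Re (xi e) ^+ 2 + complex.Im (xi e) ^+ 2).
    by apply/funext => e; rewrite /nrm normc_def.
  apply: (@measurableT_comp _ _ _ _ _ _ (@Num.sqrt R)).
    by apply: continuous_measurable_fun; exact: sqrt_continuous.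
  by apply: measurable_funD; exact: measurable_funX.
have ixi : fibre_invariant (fun e => nrm (xi e) `^ p).
  by move=> z e; rewrite exi cabsM cabs_circle mul1r.
apply: (@fibre_integral_le R G T GT2 x (fun e => nrm (lambda f xi e) `^ p) (M `^ p)).
- exact: pos.
- move=> z e; have [s [fs hs]] := Sigma_finite_div Gtop Get GT2 (fibre_val e) sf.
  rewrite es_fibre in fs hs.
  rewrite (lamE s e fs hs) (lamE s (fibre_act z e) fs).
    congr (_ `^ p); rewrite -[RHS]mul1r -(cabs_circle z) -cabsM mulr_sumr.
    congr (nrm _); rewrite big_seq [RHS]big_seq; apply: eq_bigr => h hh.
    rewrite fibre_val_act act_mull ?ef ?mulrA // es_fibre er_inv es_lift.
    by case: fs => _ ->.
  move=> d dx; rewrite fibre_val_act act_mull ?er_inv ?es_fibre // ef => nz; apply: hs => //.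
  by apply: contraNN nz => /eqP ->; rewrite mulr0.
- move=> s fs; have [us sx] := fs.
have [s' [fs' ss' hs']] := Sigma_finite_rows sf fs.
have [us' sx'] := fs'.
pose c h := xi (fibre_lift T x h).
apply: (@le_trans _ _ (\sum_(g <- s') nrm (\sum_(h <- s') f (gmul (lift g) (ginv (lift h))) * c h) `^ p)).
  apply: (@le_trans _ _ (\sum_(g <- s) nrm (\sum_(h <- s') f (gmul (lift g) (ginv (lift h))) * c h) `^ p)).
    rewrite big_seq [leRHS]big_seq le_eqVlt; apply/orP; left; apply/eqP.
    apply: eq_bigr => g gs; rewrite (lamE s') ?lift_fibre ?sx //.
    by move=> d; apply: hs'.
  by apply: sum_sub_seq_le => // g; exact: powR_ge0.
apply: le_trans (bf x s' c fs') _.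
rewrite -[leRHS]mulr1 ler_wpM2l ?powR_ge0 // -lee_fin; apply: le_trans xi1.
exact: (@fibre_integral_ge R G T GT2 x (fun e => nrm (xi e) `^ p) s' mxi (pos xi) ixi fs').
Qed.

End MatrixNormConverse.

(** * Convolution as a finite sum *)

Lemma hausdorff_separate (X : topologicalType) (x y : X) : hausdorff_space X -> x <> y ->
  exists U V : set X, [/\ open U, open V, U x, V y & forall z, U z -> ~ V z].
Proof.
rewrite open_hausdorff => h /eqP xy.
have [[U V] /= [Ux Vy] [oU oV /eqP UV]] := h _ _ xy.
exists U, V; split=> //; [exact: set_mem|exact: set_mem|move=> z Uz Vz].
by have : (U `&` V) z by []; rewrite UV.
Qed.

Lemma hausdorff_neq_near (X Y : topologicalType) (F : set_system Y) (FF : Filter F)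
    (f g : Y -> X) (a b : X) : hausdorff_space X -> f @ F --> a -> g @ F --> b -> a <> b ->
  \forall y \near F, f y <> g y.
Proof.
move=> hX fa gb /(hausdorff_separate hX)[U [V [oU oV Ua Vb UV]]].
have nU : nbhs a U by exact: open_nbhs_nbhs.
have nV : nbhs b V by exact: open_nbhs_nbhs.
apply: (@filterS2 _ F FF _ _ _ _ (fa _ nU) (gb _ nV)) => y /= Uy Vy e.
by apply: (UV (f y)) => //; rewrite e.
Qed.

Lemma closed_eq_fun (X Y : topologicalType) (f g : Y -> X) : hausdorff_space X ->
  continuous f -> continuous g -> closed [set y | f y = g y].
Proof.
move=> hX cf cg; rewrite -[X in closed X]setCK; apply: open_closedC.
rewrite openE => y /= fg.
exact: (@hausdorff_neq_near X Y _ (nbhs_filter y) f g _ _ hX (cf y) (cg y) fg).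
Qed.

Section Convolution.
Context {R : realType} {G : groupoid} {T : twist R G}.
Hypotheses (Gtop : topological_groupoid G) (Get : etale G)
  (GT2 : hausdorff_space G) (Gcpt : compact (@gunit G)).
Local Notation E := (tw_E T).
Local Notation pi := (tw_pi T).
Implicit Types (f g : E -> R[i]) (s : seq G) (e d : E).

(** The phases of d in the two factors cancel, so a term of a convolution depends
    on the arrow under d only. *)
Lemma conv_term_inv f g e d d' : equivariant f -> equivariant g -> es e = es d ->
  pi d = pi d' -> f (gmul e (ginv d)) * g d = f (gmul e (ginv d')) * g d'.
Proof.
move=> ef eg ed /pi_eq_act[z ->]; rewrite equivariant_div // eg mulrACA.
by rewrite mulVf ?circle_neq0 // mul1r.
Qed.

Lemma conv_sum f g e s : equivariant f -> equivariant g -> fibre_seq (es e) s ->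
  (forall d, es d = es e -> f (gmul e (ginv d)) * g d != 0 -> pi d \in s) ->
  convolution f g e = \sum_(h <- s) f (gmul e (ginv (lift h))) * g (lift h).
Proof.
move=> ef eg fs hs; rewrite /convolution (fibre_integralE GT2 fs).
- rewrite big_seq [RHS]big_seq; apply: eq_bigr => h hh.
  by rewrite lift_fibre //; case: fs => _; apply.
- move=> z d /=; apply: conv_term_inv => //; rewrite fibre_val_act ?es_act ?pi_act //.
  by rewrite es_fibre.
- by move=> d; apply: hs; rewrite es_fibre.
Qed.

Lemma conv_sum_src f g e s : equivariant f -> equivariant g -> fibre_seq (es e) s ->
  (forall d, es d = es e -> g d != 0 -> pi d \in s) ->
  convolution f g e = \sum_(h <- s) f (gmul e (ginv (lift h))) * g (lift h).
Proof.
move=> ef eg fs hs; apply: conv_sum => // d ed nz; apply: hs => //.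
by apply: contraNN nz => /eqP ->; rewrite mulr0.
Qed.

Lemma conv_neq0 f g e : Sigma_c f -> Sigma_c g -> convolution f g e != 0 ->
  exists d, [/\ es d = es e, f (gmul e (ginv d)) != 0 & g d != 0].
Proof.
move=> [_ _ ef] sg; have [_ _ eg] := sg.
have [s [fs hs]] := Sigma_finite_src Gtop Get GT2 (es e) sg.
rewrite (conv_sum_src ef eg fs hs) => nz; apply: contrapT => nd.
move: nz; rewrite big_seq big1 ?eqxx // => h hh; apply: contrapT => /eqP.
rewrite mulf_eq0 negb_or => /andP[fh gh]; apply: nd; exists (lift h).
by rewrite es_lift; have [_ ->] := fs.
Qed.

Lemma conv_equivariant f g : Sigma_c f -> Sigma_c g -> equivariant (convolution f g).
Proof.
move=> [_ _ ef] sg z e; have [_ _ eg] := sg.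
have [s [fs hs]] := Sigma_finite_src Gtop Get GT2 (es e) sg.
rewrite (conv_sum_src ef eg fs hs) (@conv_sum_src _ _ _ s) ?es_act //.
rewrite mulr_sumr big_seq [RHS]big_seq; apply: eq_bigr => h hh.
by rewrite act_mull ?er_inv ?es_lift ?ef ?mulrA //; have [_ ->] := fs.
Qed.

Lemma conv_compact f g : Sigma_c f -> Sigma_c g ->
  compact (closure [set e | convolution f g e != 0]).
Proof.
move=> sf sg; have [_ kf _] := sf; have [_ kg _] := sg.
set Kf := closure _ in kf; set Kg := closure _ in kg.
pose M := (Kf `*` Kg) `&` [set q : E * E | es q.1 = er q.2].
have cM : compact M.
  apply: compact_closedI; first exact: compact_setX.
  apply: closed_eq_fun; first exact: hausdorff_units.
  - by move=> q; apply: (@continuous_comp _ _ _ fst (@es R G T)); [exact: cvg_fst|exact: continuous_es].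
  - by move=> q; apply: (@continuous_comp _ _ _ snd (@er R G T)); [exact: cvg_snd|exact: continuous_er].
have cI : compact ((fun q : E * E => gmul q.1 q.2) @` M).
  apply: continuous_compact => //; have [cm _] := tw_E_topological T.
  by apply: continuous_subspaceW cm => q [_ /gcompE].
apply: (subclosed_compact _ cI); first exact: closed_closure.
rewrite [X in X `<=` _]closureE => e; apply; split.
  by apply: compact_closed => //; exact: tw_E_hausdorff.
move=> e' /(conv_neq0 sf sg)[d [ed fd gd]].
exists (gmul e' (ginv d), d) => /=; last by rewrite mulVK.
split; last by rewrite /= esM ?es_inv // er_inv.
by split; apply: subset_closure.
Qed.

(** The arrows in the compact support of g with source y, for y near a given unit,
    lie on finitely many disjoint local sections. So near a given element the
    convolution is a fixed finite sum of continuous functions. *)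
Lemma conv_continuous f g : Sigma_c f -> Sigma_c g -> continuous (convolution f g).
Proof.
move=> sf sg e0; have [cf _ ef] := sf; have [cg kg eg] := sg.
set x0 := es e0.
pose K := pi @` closure [set e | g e != 0].
have cK : compact K by apply: compact_image => // e _; exact: tw_pi_continuous.
have [s [us hs]] := finite_uniq_seq (compact_src_finite Gtop Get GT2 x0 cK).
have sx h : h \in s -> src0 h = x0 by move=> /hs[].
have ch (h : G) : exists q : set G * (units G -> E), [/\ open q.1, q.1 h &
    forall k, q.1 k -> pi (q.2 (src0 k)) = k /\ q.2 y @[y --> src0 k] --> q.2 (src0 k)].
  have [U [S [ph [sec Uh]]]] := @exists_local_section R G T h.
  have [sgm hsg] := source_section Gtop Get sec.
  by exists (U, sgm); split=> //; case: sec.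
have {ch}[q hq] := choice ch.
pose sg' h := (q h).2.
have piE h : h \in s -> pi (sg' h x0) = h.
  by move=> hh; have [_ qh /(_ _ qh)[+ _]] := hq h; rewrite sx.
have csg h : h \in s -> sg' h y @[y --> x0] --> sg' h x0.
  by move=> hh; have [_ qh /(_ _ qh)[_]] := hq h; rewrite sx.
have Fx : Filter (nbhs x0) by exact: nbhs_filter.
have srcE : \forall y \near x0, {in s, forall h, src0 (pi (sg' h y)) = y}.
  apply: (@near_all_seq _ _ (nbhs x0) Fx s (fun h y => src0 (pi (sg' h y)) = y)) => h hh.
  have [oU Uh hk] := hq h.
  have n : nbhs x0 (@src0 G @` (q h).1).
    by apply: open_nbhs_nbhs; split; [exact: open_src0|exists h; rewrite ?sx].
  by apply: (@filterS _ _ Fx _ _ _ n) => _ [k Uk <-]; have [-> _] := hk k Uk.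
have inj : \forall y \near x0, {in s, forall h, {in s, forall h',
    h <> h' -> pi (sg' h y) <> pi (sg' h' y)}}.
  apply: (@near_all_seq _ _ (nbhs x0) Fx s (fun h y => {in s, forall h',
    h <> h' -> pi (sg' h y) <> pi (sg' h' y)})) => h hh.
  apply: (@near_all_seq _ _ (nbhs x0) Fx s (fun h' y =>
    h <> h' -> pi (sg' h y) <> pi (sg' h' y))) => h' hh'.
  have [->|/eqP nhh'] := eqVneq h h'; first by apply: nearW.
  have c k : k \in s -> pi (sg' k y) @[y --> x0] --> k.
    move=> ks; rewrite -{2}(piE k ks).
    exact: (cvg_comp _ _ (csg k ks) (@tw_pi_continuous _ _ T _)).
  have := hausdorff_neq_near Fx GT2 (c h hh) (c h' hh') nhh'.
  by apply: filterS => y.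
(* The part of the support away from the chosen sections is compact, so its
    sources avoid a neighbourhood of x0. *)
have cov : \forall y \near x0, forall k, K k -> src0 k = y ->
    exists2 h, h \in s & k = pi (sg' h y).
  pose C := K `&` ~` \bigcup_(h in [set` s]) (q h).1.
  have oC : open (\bigcup_(h in [set` s]) (q h).1).
    by apply: bigcup_open => h _; have [] := hq h.
  have cC : closed (@src0 G @` C).
    apply: compact_closed; first exact: hausdorff_units.
    apply: compact_image => [k _|]; first exact: continuous_src0.
    by apply: compact_closedI => //; exact: open_closedC.
  have n : nbhs x0 (~` (@src0 G @` C)).
    apply: open_nbhs_nbhs; split; first exact: closed_openC.
    move=> [k [Kk nk] kx]; apply: nk; exists k; first by apply/hs.
    by have [] := hq k.
  apply: (@filterS _ _ Fx _ _ _ n) => y ny k Kk ky.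
  have : (\bigcup_(h in [set` s]) (q h).1) k.
    by apply: contrapT => nk; apply: ny; exists k.
  move=> [h /= hh Uk]; exists h => //.
  by have [_ _ /(_ k Uk)[<- _]] := hq h; rewrite ky.
have Fe : Filter (nbhs e0) by exact: nbhs_filter.
have ce : es e @[e --> e0] --> x0 by exact: continuous_es.
pose Phi (e : E) := \sum_(h <- s) f (gmul e (ginv (sg' h (es e)))) * g (sg' h (es e)).
have near_eq : \forall e \near e0, convolution f g e = Phi e.
  have n : \forall y \near x0, forall e, es e = y -> convolution f g e = Phi e.
    apply: (@filterS3 _ _ Fx _ _ _ _ _ srcE inj cov) => y hsrc hinj hcov e ey.
    pose s' := map (fun h => pi (sg' h y)) s.
    have fs' : fibre_seq (es e) s'.
      split=> [|_ /mapP[h hh ->]]; last by rewrite hsrc.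
      rewrite map_inj_in_uniq // => h h' hh hh' /eqP hE; apply: contrapT => nE.
      by move/eqP : hE; exact: hinj.
    rewrite (conv_sum_src ef eg fs') => [|d de gd]; last first.
      have [|//|h hh ->] := hcov (pi d) _ _; first by exists d => //; exact: subset_closure.
        by rewrite -ey.
      by apply/mapP; exists h.
    rewrite big_map /Phi big_seq [RHS]big_seq; apply: eq_bigr => h hh.
    by rewrite ey; apply: conv_term_inv; rewrite ?pi_lift // es_lift hsrc.
  have := ce _ n; rewrite /= nbhs_simpl => {}n.
  by apply: (@filterS _ _ Fe _ _ _ n) => e; apply.
have cP : Phi @ e0 --> Phi e0.
  apply: cvg_sum_seq => h hh.
  have c1 : sg' h (es e) @[e --> e0] --> sg' h x0 by exact: (cvg_comp _ _ ce (csg h hh)).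
  apply: cvgM; last exact: (cvg_comp _ _ c1 (cg _)).
  have c2 : gmul e (ginv (sg' h (es e))) @[e --> e0] --> gmul e0 (ginv (sg' h x0)).
    apply: cvg_mul.
    - have := ce _ srcE; rewrite /= nbhs_simpl => {}n.
      apply: (@filterS _ _ Fe _ _ _ n) => e he; rewrite er_inv.
      by have := he h hh.
    - by rewrite er_inv -[LHS]/x0 /es piE // sx.
    - exact: cvg_id.
    - exact: (cvg_comp _ _ c1 (@continuous_inv _ _ T _)).
  exact: (cvg_comp _ _ c2 (cf _)).
rewrite /continuous_at (_ : convolution f g e0 = Phi e0); last exact: (nbhs_singleton near_eq).
apply: (cvg_trans _ cP); apply: near_eq_cvg.
by apply: (@filterS _ _ Fe _ _ _ near_eq) => e ->.
Qed.

Lemma Sigma_conv f g : Sigma_c f -> Sigma_c g -> Sigma_c (convolution f g).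
Proof.
move=> sf sg; split; [exact: conv_continuous|exact: conv_compact|].
exact: conv_equivariant.
Qed.

End Convolution.

(** * Elements of the algebra as functions on the twist *)

Lemma cvg_powR (R : realType) (X : Type) (F : set_system X) (FF : Filter F)
    (f : X -> R) (l q : R) : 0 < q -> (forall x, 0 <= f x) -> f @ F --> l -> 0 <= l ->
  (fun x => f x `^ q) @ F --> l `^ q.
Proof.
move=> q0 f0 fl; rewrite le_eqVlt => /orP[/eqP l0|l0]; last first.
  have c : {for l, continuous (fun r : R => r `^ q)}.
    apply/differentiable_continuous/derivable1_diffP/derivable_powR.
    by rewrite in_itv /= l0.
  exact: (cvg_comp _ _ fl c).
rewrite -l0 powR0 ?gt_eqF //; apply/cvgrPdist_lt => e e0.
have e1 : 0 < e `^ q^-1 by exact: powR_gt0.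
move/cvgrPdist_lt : fl => /(_ _ e1); apply: filterS => x.
rewrite -l0 !sub0r !normrN !ger0_norm ?powR_ge0 // => h.
have -> : e = (e `^ q^-1) `^ q by rewrite -powRrM mulVf ?gt_eqF // powRr1 // ltW.
by apply: gt0_ltr_powR; rewrite ?nnegrE ?powR_ge0.
Qed.

Section MatrixBound.
Context {R : realType} {G : groupoid} {T : twist R G}.
Local Notation E := (tw_E T).
Local Notation pi := (tw_pi T).
Variable p : R.
Hypothesis p1 : 1 <= p.
Variables (M : R) (a : E -> R[i]).
Hypotheses (M0 : 0 <= M) (ba : matrix_bounded p M a) (ea : equivariant a).

Let p0 : 0 < p. Proof. exact: lt_le_trans p1. Qed.
Let pn0 : p != 0. Proof. by rewrite gt_eqF. Qed.

(** Apply the matrix to the basis vector at the unit x. *)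
Lemma column_bound (x : units G) (s : seq G) : fibre_seq x s ->
  \sum_(g <- s) nrm (a (lift g)) `^ p <= M `^ p.
Proof.
move=> fs; have [us sx] := fs.
have fx : fibre_seq x [:: unit_val x] by split=> // g; rewrite inE => /eqP ->; exact: src0_unit.
set s' := undup (s ++ [:: unit_val x]).
have fs' : fibre_seq x s' by exact: fibre_seq_cat.
have [us' sx'] := fs'.
have xs' : unit_val x \in s' by rewrite mem_undup mem_cat inE eqxx orbT.
have ss' : {subset s <= s'} by move=> g gs; rewrite mem_undup mem_cat gs.
have := ba (fun h => (h == unit_val x)%:R) fs'.
have -> : \sum_(h <- s') nrm ((h == unit_val x)%:R : R[i]) `^ p = 1.
  rewrite (bigD1_seq (unit_val x)) //= eqxx cabs1 powR1 big1 ?addr0 // => h /negPf ->.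
  by rewrite nrm0 powR0.
rewrite mulr1; apply: le_trans.
apply: (@le_trans _ _ (\sum_(g <- s') nrm (a (lift g)) `^ p)).
  by apply: sum_sub_seq_le => // g; exact: powR_ge0.
rewrite le_eqVlt; apply/orP; left; apply/eqP; rewrite big_seq [RHS]big_seq.
apply: eq_bigr => g gs; congr (_ `^ p).
rewrite (bigD1_seq (unit_val x)) //= eqxx mulr1 big1 ?addr0 => [|h /negPf ->]; last by rewrite mulr0.
have [z ez] : exists z, lift (unit_val x) = tw_i T (x, z).
  have [|z ez] := @pi_unitP _ _ T (lift (unit_val x)); first by rewrite pi_lift; exact: unit_valP.
  by exists z; rewrite ez es_lift src0_unit.
rewrite ez tw_i_inv -(sx' g gs) -(es_lift (T := T)) -actEr ea cabsM cabs_circle mul1r.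
by [].
Qed.

Lemma pointwise_bound e : nrm (a e) <= M.
Proof.
have fs : fibre_seq (es e) [:: pi e] by split=> // g; rewrite inE => /eqP ->.
have := column_bound fs; rewrite big_seq1 => h.
have [z ->] := pi_eq_act (pi_lift (T := T) (pi e)); rewrite ea cabsM cabs_circle mul1r.
rewrite leNgt; apply/negP => lt.
by move: h; rewrite leNgt gt0_ltr_powR // nnegrE ?nrm_ge0.
Qed.

(** A single row of the matrix is bounded by the whole matrix. *)
Lemma row_bound (e : E) (s : seq G) (c : G -> R[i]) : fibre_seq (es e) s ->
  nrm (\sum_(h <- s) a (gmul e (ginv (lift h))) * c h) `^ p
    <= M `^ p * \sum_(h <- s) nrm (c h) `^ p.
Proof.
move=> fs; have [us sx] := fs.
have fe : fibre_seq (es e) [:: pi e] by split=> // g; rewrite inE => /eqP ->.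
set s' := undup (s ++ [:: pi e]).
have fs' : fibre_seq (es e) s' by exact: fibre_seq_cat.
have [us' sx'] := fs'.
have es' : pi e \in s' by rewrite mem_undup mem_cat inE eqxx orbT.
have ss' : {subset s <= s'} by move=> g gs; rewrite mem_undup mem_cat gs.
pose c' h := if h \in s then c h else 0.
have := ba c' fs'.
rewrite (sum_sub_seq us us' ss' (F := fun h => nrm (c' h) `^ p)); last first.
  by move=> h _ /negPf hs; rewrite /c' hs nrm0 powR0.
rewrite [X in _ <= _ * X -> _](_ : _ = \sum_(h <- s) nrm (c h) `^ p); last first.
  by rewrite big_seq [RHS]big_seq; apply: eq_bigr => h hs; rewrite /c' hs.
apply: le_trans.
rewrite [leRHS](bigD1_seq (pi e)) //=.
have -> : nrm (\sum_(h <- s') a (gmul (lift (pi e)) (ginv (lift h))) * c' h) =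
    nrm (\sum_(h <- s) a (gmul e (ginv (lift h))) * c h).
  rewrite (sum_sub_seq us us' ss'); last by move=> h _ /negPf hs; rewrite /c' hs mulr0.
  have [z ez] := pi_eq_act (pi_lift (T := T) (pi e)).
  rewrite -[LHS]mul1r -(cabs_circle z) -cabsM mulr_sumr; congr nrm.
  rewrite big_seq [RHS]big_seq; apply: eq_bigr => h hs.
  by rewrite mulrA -ea -act_mull -?ez /c' ?hs // er_inv !es_lift (sx h hs).
rewrite lerDl sumr_ge0 // => h _; exact: powR_ge0.
Qed.

End MatrixBound.

Section FunctionAlgebra.
Context {R : realType} {G : groupoid} {T : twist R G}.
Hypotheses (Gtop : topological_groupoid G) (Get : etale G)
  (GT2 : hausdorff_space G) (Gcpt : compact (@gunit G)).
Local Notation E := (tw_E T).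
Local Notation pi := (tw_pi T).
Context {p : R}.
Hypothesis p1 : 1 <= p.
Variable A : reduced_algebra T p.
Implicit Types (f g : E -> R[i]) (a b : A) (e : E).
Local Notation inA := (ra_in A).

Lemma in_norm f : Sigma_c f -> reduced_norm p f = (nrm (inA f))%:E.
Proof. by move=> sf; rewrite -(ra_in_norm A). Qed.

Lemma in_bounded f : Sigma_c f -> matrix_bounded p (nrm (inA f)) f.
Proof. by move=> sf; apply: matrix_bounded_norm => //; exact: in_norm. Qed.

Lemma in_le f (M : R) : Sigma_c f -> 0 <= M -> matrix_bounded p M f -> nrm (inA f) <= M.
Proof.
by move=> sf M0 bf; rewrite -lee_fin -in_norm //; exact: norm_le_matrix_bounded.
Qed.

Lemma in_sub f g : Sigma_c f -> Sigma_c g -> inA (fun e => f e - g e) = inA f - inA g.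
Proof.
move=> sf sg; have -> : (fun e => f e - g e) = (fun e => f e + (fun e => -1 * g e) e).
  by apply/funext => e; rewrite mulN1r.
by rewrite ra_inD //; [rewrite ra_inZ // scaleN1r|exact: Sigma_scale].
Qed.

Lemma Sigma_equivariant f : Sigma_c f -> equivariant f. Proof. by case. Qed.

(** Point evaluations are contractive on Sigma_c, so they extend to the
    completion. *)
Lemma in_pointwise f g e : Sigma_c f -> Sigma_c g ->
  nrm (f e - g e) <= nrm (inA f - inA g).
Proof.
move=> sf sg; have sfg := Sigma_sub sf sg; rewrite -in_sub //.
apply: (@pointwise_bound _ _ _ p p1 _ (fun e => f e - g e)).
- exact: nrm_ge0.
- exact: in_bounded.
- exact: Sigma_equivariant.
Qed.

Lemma approx a (d : R) : 0 < d -> exists2 f, Sigma_c f & nrm (inA f - a) < d.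
Proof.
move=> d0; have : closure (inA @` @Sigma_c R G T) a by rewrite ra_in_dense.
have d0' : 0 < d%:C by rewrite ltcR.
move=> /(_ _ (nbhsx_ballx a _ d0'))[_ [[f sf <-]]].
rewrite -ball_normE /= distrC nrmE ltcR => h.
by exists f.
Qed.

Definition approx_filter a : set_system (E -> R[i]) :=
  filter_from [set d : R[i] | 0 < d] (fun d => [set f | Sigma_c f /\ `|inA f - a| < d]).

Lemma approx_filterP a (P : set (E -> R[i])) : approx_filter a P <->
  exists2 d : R, 0 < d & forall f, Sigma_c f -> nrm (inA f - a) < d -> P f.
Proof.
split=> [[d /=]|[d d0 h]].
  rewrite ltc0E => /andP[/eqP di dr] dP; exists (complex.Re d) => // f sf h.
  apply: dP; split=> //; rewrite nrmE (complexE d) di mulr0 addr0 ltcR //.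
exists d%:C; first by rewrite /= ltcR.
by move=> f /= [sf]; rewrite nrmE ltcR; exact: h.
Qed.

Lemma approx_proper a : ProperFilter (approx_filter a).
Proof.
apply: Build_ProperFilter_ex => [P /approx_filterP[d d0 h]|].
  by have [f sf fa] := approx a d0; exists f; exact: h.
split.
- by apply/approx_filterP; exists 1.
- move=> P Q /approx_filterP[d d0 h] /approx_filterP[d' d0' h'].
  apply/approx_filterP; exists (Num.min d d'); first by rewrite lt_min d0.
  by move=> f sf; rewrite lt_min => /andP[? ?]; split; [exact: h|exact: h'].
- move=> P Q PQ /approx_filterP[d d0 h]; apply/approx_filterP; exists d => // f sf fa.
  by apply: PQ; exact: h.
Qed.

Lemma approx_near a (d : R) : 0 < d ->
  \forall f \near approx_filter a, Sigma_c f /\ nrm (inA f - a) < d.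
Proof. by move=> d0; apply/approx_filterP; exists d. Qed.

Lemma real_approx_cvg a (u : (E -> R[i]) -> R) :
  (forall f g, Sigma_c f -> Sigma_c g -> `|u f - u g| <= nrm (inA f - inA g)) ->
  cvg (u @ approx_filter a).
Proof.
move=> hu; have Fp := approx_proper a.
apply: cauchy_cvg; apply: cauchy_exP => e e0.
have e2 : 0 < e / 2 by rewrite divr_gt0.
have [f sf fa] := approx a e2.
exists (u f); rewrite /=; have := approx_near a e2.
apply: filterS => g [sg ga]; rewrite -ball_normE /=.
apply: le_lt_trans (hu _ _ sf sg) _.
have -> : inA f - inA g = (inA f - a) - (inA g - a) by rewrite opprB addrA subrK.
apply: le_lt_trans (nrmB _ _) _; lra.
Qed.

(** The approximants of a in Sigma_c converge pointwise, as their values form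
    Cauchy families. *)
Lemma ra_fun_cvg a e : (fun f : E -> R[i] => f e) @ approx_filter a --> ra_fun a e.
Proof.
have Fp := approx_proper a.
suff : cvg ((fun f : E -> R[i] => f e) @ approx_filter a) by [].
have h1 : cvg ((fun f : E -> R[i] => complex.Re (f e)) @ approx_filter a).
  apply: real_approx_cvg => f g sf sg; apply: le_trans (in_pointwise e sf sg).
  by rewrite -raddfB; exact: Re_le_cabs.
have h2 : cvg ((fun f : E -> R[i] => complex.Im (f e)) @ approx_filter a).
  apply: real_approx_cvg => f g sf sg; apply: le_trans (in_pointwise e sf sg).
  by rewrite -raddfB; exact: Im_le_cabs.
have := cvg_Complex _ h1 h2.
rewrite (_ : (fun f : E -> R[i] => Complex _ _) = fun f => f e); last first.
  by apply/funext => f; case: (f e).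
by move=> h; apply/cvg_ex; eexists; exact: h.
Qed.

Lemma nrm_le_eps (V : normedModType R[i]) (v : V) (M : R) :
  (forall d : R, 0 < d -> nrm v <= M + d) -> nrm v <= M.
Proof. by move=> h; apply/ler_addgt0Pr => d d0; exact: h. Qed.

Lemma fun_approx f a e : Sigma_c f -> nrm (f e - ra_fun a e) <= nrm (inA f - a).
Proof.
move=> sf; have Fp := approx_proper a; apply: nrm_le_eps => d d0.
have d2 : 0 < d / 2 by rewrite divr_gt0.
have /cvg_nrm /(_ _ d2) h1 := @ra_fun_cvg a e.
have [g [ge [sg ga]]] := filter_ex (filterI h1 (approx_near a d2)).
have -> : f e - ra_fun a e = (f e - g e) - (ra_fun a e - g e) by rewrite opprB addrA subrK.
apply: le_trans (nrmB _ _) _.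
have := in_pointwise e sf sg.
have : nrm (inA f - inA g) <= nrm (inA f - a) + nrm (inA g - a).
  have -> : inA f - inA g = (inA f - a) - (inA g - a) by rewrite opprB addrA subrK.
  exact: nrmB.
by lra.
Qed.

Lemma nrm0_eq (V : normedModType R[i]) (v w : V) :
  (forall d : R, 0 < d -> nrm (v - w) <= d) -> v = w.
Proof.
move=> h; apply/eqP; rewrite -subr_eq0 -nrm_eq0 eq_le nrm_ge0 andbT.
by apply: nrm_le_eps => d d0; rewrite add0r; exact: h.
Qed.

Lemma fun_in f e : Sigma_c f -> ra_fun (inA f) e = f e.
Proof.
move=> sf; apply/esym/nrm0_eq => d d0; apply: le_trans (fun_approx _ _ sf) _.
by rewrite subrr nrm0 ltW.
Qed.

Lemma fun_eqP a e (v : R[i]) :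
  (forall d : R, 0 < d -> exists f, [/\ Sigma_c f, nrm (inA f - a) <= d & nrm (f e - v) <= d]) ->
  ra_fun a e = v.
Proof.
move=> h; apply: nrm0_eq => d d0; have d2 : 0 < d / 2 by rewrite divr_gt0.
have [f [sf fa fv]] := h _ d2; have := fun_approx a e sf.
have -> : ra_fun a e - v = (f e - v) - (f e - ra_fun a e) by ring.
by have := nrmB (f e - v) (f e - ra_fun a e); lra.
Qed.

Lemma fun_add a b e : ra_fun (a + b) e = ra_fun a e + ra_fun b e.
Proof.
apply: fun_eqP => d d0; have d2 : 0 < d / 2 by rewrite divr_gt0.
have [f sf fa] := approx a d2; have [g sg gb] := approx b d2.
exists (fun e => f e + g e); split; first exact: Sigma_add.
  rewrite ra_inD // opprD addrACA; apply: le_trans (nrmD _ _) _; lra.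
rewrite opprD addrACA; apply: le_trans (nrmD _ _) _.
by have := fun_approx a e sf; have := fun_approx b e sg; lra.
Qed.

Lemma fun_scale (k : R[i]) a e : ra_fun (k *: a) e = k * ra_fun a e.
Proof.
apply: fun_eqP => d d0; have k1 : 0 < nrm k + 1 by rewrite ltr_wpDl ?nrm_ge0.
have d2 : 0 < d / (nrm k + 1) by rewrite divr_gt0.
have [f sf fa] := approx a d2.
have kd : nrm k * (d / (nrm k + 1)) <= d.
  rewrite mulrCA -[leRHS]mulr1 ler_wpM2l ?(ltW d0) // ler_pdivrMr // mul1r.
  by rewrite lerDl.
exists (fun e => k * f e); split; first exact: Sigma_scale.
  rewrite ra_inZ // -scalerBr nrmZ; apply: le_trans kd.
  by rewrite ler_wpM2l ?nrm_ge0 // ltW.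
rewrite -mulrBr cabsM; apply: le_trans kd.
by rewrite ler_wpM2l ?nrm_ge0 // (le_trans (fun_approx a e sf)) // ltW.
Qed.

Lemma fun0 e : ra_fun (0 : A) e = 0.
Proof. by rewrite -(scale0r (0 : A)) fun_scale mul0r. Qed.

Lemma fun_opp a e : ra_fun (- a) e = - ra_fun a e.
Proof. by rewrite -scaleN1r fun_scale mulN1r. Qed.

Lemma fun_sub a b e : ra_fun (a - b) e = ra_fun a e - ra_fun b e.
Proof. by rewrite fun_add fun_opp. Qed.

Lemma fun_sum (I : Type) (r : seq I) (F : I -> A) e :
  ra_fun (\sum_(i <- r) F i) e = \sum_(i <- r) ra_fun (F i) e.
Proof.
elim: r => [|i r IH]; first by rewrite !big_nil fun0.
by rewrite !big_cons fun_add IH.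
Qed.

Lemma fun_le a e : nrm (ra_fun a e) <= nrm a.
Proof.
have := fun_approx (- a) e (@Sigma0 R G T).
have -> : inA (fun=> 0) = 0.
  have h := in_sub (@Sigma0 R G T) (@Sigma0 R G T).
  rewrite [RHS]subrr in h; rewrite -[RHS]h.
  by congr (ra_in A _); apply/funext => e'; rewrite subrr.
by rewrite fun_opp (opprK a) (add0r a) (opprK (ra_fun a e)) add0r.
Qed.

Lemma fun_equivariant a : equivariant (ra_fun a).
Proof.
move=> z e; apply: fun_eqP => d d0; have [f sf fa] := approx a d0.
exists f; split=> //; first exact: ltW.
rewrite (Sigma_equivariant sf) -mulrBr cabsM cabs_circle mul1r.
by rewrite (le_trans (fun_approx a e sf)) // ltW.
Qed.

Lemma fun_continuous a : continuous (ra_fun a).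
Proof.
move=> e; have Fe : Filter (nbhs e) by exact: nbhs_filter.
apply/cvg_nrm => d d0; have d3 : 0 < d / 3 by rewrite divr_gt0.
have [f sf fa] := approx a d3.
have cf : f @ e --> f e by exact: Sigma_cont.
move/cvg_nrm : cf => /(_ _ d3); apply: (@filterS _ _ Fe) => e' h.
have -> : ra_fun a e - ra_fun a e' =
    (f e' - ra_fun a e') - (f e - ra_fun a e) + (f e - f e') by ring.
apply: le_lt_trans (nrmD _ _) _; have := nrmB (f e' - ra_fun a e') (f e - ra_fun a e).
by have := fun_approx a e sf; have := fun_approx a e' sf; lra.
Qed.

Lemma in_cvg_norm a : (fun f => nrm (inA f)) @ approx_filter a --> nrm a.
Proof.
have Fp := approx_proper a; apply/cvgrPdist_lt => d d0.
have := approx_near a d0; apply: filterS => f [sf fa].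
by apply: le_lt_trans (nrm_dist _ _) _; rewrite nrmC.
Qed.

(** The bound on finite matrices involves finitely many values of the function, so
    it passes to the limit. *)
Lemma fun_bounded a : matrix_bounded p (nrm a) (ra_fun a).
Proof.
move=> x s c fs; have Fp := approx_proper a.
have p0 : 0 < p by exact: lt_le_trans p1.
pose lhs f := \sum_(g <- s) nrm (\sum_(h <- s) f (gmul (lift g) (ginv (lift h))) * c h) `^ p.
pose S := \sum_(h <- s) nrm (c h) `^ p.
have cl : lhs @ approx_filter a --> lhs (ra_fun a).
  rewrite /lhs; elim: {1 3}s => [|g r IH].
    rewrite big_nil (_ : (fun f => _) = fun=> 0); first exact: cvg_cst.
    by apply/funext => f; rewrite big_nil.
  rewrite big_cons (_ : (fun f : E -> R[i] => \sum_(g <- g :: r) _) = fun f =>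
    nrm (\sum_(h <- s) f (gmul (lift g) (ginv (lift h))) * c h) `^ p + \sum_(g <- r)
    nrm (\sum_(h <- s) f (gmul (lift g) (ginv (lift h))) * c h) `^ p); last first.
    by apply/funext => f; rewrite big_cons.
  apply: cvgD => //; apply: cvg_powR => //.
  - by move=> f; exact: nrm_ge0.
  - apply: (@cvg_comp _ _ _ (fun f : E -> R[i] =>
      \sum_(h <- s) f (gmul (lift g) (ginv (lift h))) * c h) (@nrm R R[i]) (approx_filter a)
      (nbhs (\sum_(h <- s) ra_fun a (gmul (lift g) (ginv (lift h))) * c h))).
      apply: (@cvg_sum_seq _ _ _ _ _ s (fun h (f : E -> R[i]) =>
        f (gmul (lift g) (ginv (lift h))) * c h)) => h hs.
      by apply: cvgM; [exact: ra_fun_cvg|exact: cvg_cst].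
    exact: continuous_nrm.
  - exact: nrm_ge0.
have cr : (fun f => nrm (inA f) `^ p * S) @ approx_filter a --> nrm a `^ p * S.
  apply: cvgM; last exact: cvg_cst.
  apply: cvg_powR => //; [by move=> f; exact: nrm_ge0|exact: in_cvg_norm|exact: nrm_ge0].
rewrite -subr_le0.
apply: (@cvgr_to_le _ _ Fp R (fun f => lhs f - nrm (inA f) `^ p * S) _ 0 (cvgB cl cr)).
have := approx_near a ltr01; apply: filterS => f [sf _].
by rewrite subr_le0; exact: (in_bounded sf c fs).
Qed.

(** Let f in Sigma_c approximate a - b. If a - b is zero as a function, then f is
    the function of f - (a - b), so the norm of f is at most the small norm of f -
    (a - b). *)
Lemma fun_inj a b : (forall e, ra_fun a e = ra_fun b e) -> a = b.
Proof.
move=> ab; apply: nrm0_eq => d d0; have d2 : 0 < d / 2 by rewrite divr_gt0.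
have [f sf fab] := approx (a - b) d2.
have : nrm (inA f) <= nrm (inA f - (a - b)).
  apply: in_le => //; first exact: nrm_ge0.
  have fE : ra_fun (inA f - (a - b)) = f.
    by apply/funext => e; rewrite !fun_sub fun_in // ab subrr subr0.
  by have := fun_bounded (inA f - (a - b)); rewrite fE.
have := nrmB (inA f) (inA f - (a - b)); rewrite subKr; lra.
Qed.

Lemma in_fun a f : Sigma_c f -> (forall e, ra_fun a e = f e) -> a = inA f.
Proof. by move=> sf af; apply: fun_inj => e; rewrite af fun_in. Qed.

Lemma fun_in_mul f g e : Sigma_c f -> Sigma_c g ->
  ra_fun (inA f ** inA g) e = convolution f g e.
Proof. by move=> sf sg; rewrite -ra_inM // fun_in //; exact: Sigma_conv. Qed.

End FunctionAlgebra.

(** * Products in the algebra, and isolating a single term *)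

Lemma nrmM (R : realType) (B : banach_algebra R[i]) (a b : B) :
  nrm (a ** b) <= nrm a * nrm b.
Proof.
have := ba_norm_mul a b; rewrite !nrmE lecE /= => /andP[_].
by rewrite mulr0 subr0.
Qed.

Lemma mulBl (K : numFieldType) (B : banach_algebra K) (a b c : B) :
  (a - b) ** c = a ** c - b ** c.
Proof. by rewrite ba_mulDl -scaleN1r -ba_scaleAl scaleN1r. Qed.

Lemma mulBr (K : numFieldType) (B : banach_algebra K) (a b c : B) :
  a ** (b - c) = a ** b - a ** c.
Proof. by rewrite ba_mulDr -scaleN1r -ba_scaleAr scaleN1r. Qed.

Section Products.
Context {R : realType} {G : groupoid} {T : twist R G}.
Hypotheses (Gtop : topological_groupoid G) (Get : etale G)
  (GT2 : hausdorff_space G) (Gcpt : compact (@gunit G)).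
Local Notation E := (tw_E T).
Local Notation pi := (tw_pi T).
Context {p : R}.
Hypothesis p1 : 1 <= p.
Variable A : reduced_algebra T p.
Implicit Types (f g : E -> R[i]) (a b : A) (e d : E) (F : units G -> R[i]).
Local Notation inA := (ra_in A).

Let p0 : 0 < p. Proof. exact: lt_le_trans p1. Qed.

Let fin f e : Sigma_c f -> ra_fun (inA f) e = f e.
Proof. exact: fun_in. Qed.

Let finj a b : (forall e, ra_fun a e = ra_fun b e) -> a = b.
Proof. exact: fun_inj. Qed.

Let fapp f a e : Sigma_c f -> nrm (f e - ra_fun a e) <= nrm (inA f - a).
Proof. exact: fun_approx. Qed.

Let fsub a b e : ra_fun (a - b) e = ra_fun a e - ra_fun b e.
Proof. exact: fun_sub. Qed.

Let fle a e : nrm (ra_fun a e) <= nrm a.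
Proof. exact: fun_le. Qed.

Let feq a : equivariant (ra_fun a).
Proof. exact: fun_equivariant. Qed.

Let fbd a : matrix_bounded p (nrm a) (ra_fun a).
Proof. exact: fun_bounded. Qed.

Lemma small_factor (M d : R) : 0 <= M -> 0 < d -> exists2 d', 0 < d' & d' * M <= d.
Proof.
move=> M0 d0; exists (d / (M + 1)); first by rewrite divr_gt0 // ltr_wpDl.
by rewrite mulrAC -mulrA -[leRHS]mulr1 ler_wpM2l ?(ltW d0) // ler_pdivrMr ?ltr_wpDl // mul1r lerDl.
Qed.

(** For b in Sigma_c this is the convolution formula; both sides are continuous in
    b. *)
Lemma fun_mul_in b g e s : Sigma_c g -> fibre_seq (es e) s ->
  (forall d, es d = es e -> g d != 0 -> pi d \in s) ->
  ra_fun (b ** inA g) e = \sum_(h <- s) ra_fun b (gmul e (ginv (lift h))) * g (lift h).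
Proof.
move=> sg fs hs; apply: nrm0_eq => d d0.
set K := nrm (inA g) + \sum_(h <- s) nrm (g (lift h)).
have K0 : 0 <= K by rewrite addr_ge0 ?nrm_ge0 ?sumr_ge0 // => h _; exact: nrm_ge0.
have [d' d'0 d'K] := small_factor K0 d0.
have [f sf fb] := approx b d'0.
have := fun_in_mul Gtop Get GT2 Gcpt p1 A e sf sg.
rewrite (conv_sum_src GT2 (Sigma_equivariant sf) (Sigma_equivariant sg) fs hs) => fgE.
have -> : ra_fun (b ** inA g) e - \sum_(h <- s) ra_fun b (gmul e (ginv (lift h))) * g (lift h)
  = \sum_(h <- s) (f (gmul e (ginv (lift h))) - ra_fun b (gmul e (ginv (lift h)))) * g (lift h)
    - ra_fun ((inA f - b) ** inA g) e.
  rewrite mulBl fsub fgE (eq_bigr _ (fun h _ => mulrBl _ _ _)) sumrB opprB.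
  by rewrite [RHS]addrC addrA subrK.
apply: le_trans (nrmB _ _) _; apply: le_trans d'K.
rewrite /K [leRHS]mulrDr [leLHS]addrC lerD //.
  apply: le_trans (fle _ _) _; apply: le_trans (nrmM _ _) _.
  by rewrite ler_wpM2r ?nrm_ge0 // ltW.
apply: le_trans (nrm_sum _ _ _) _; rewrite mulr_sumr; apply: ler_sum => h _.
rewrite cabsM ler_wpM2r ?nrm_ge0 //; apply: le_trans (fapp _ _ sf) _; exact: ltW.
Qed.

Lemma ext_div F e d : es e = es d -> pi e <> pi d -> ext F (gmul e (ginv d)) = 0.
Proof.
move=> ed ne; apply: ext_out => u; apply: ne; apply: gmul_divI.
  by have := congr1 (@unit_val G) ed.
by move: u; rewrite piM ?pi_inv // er_inv.
Qed.

Lemma ext_div_act F z d : ext F (gmul (tw_act z d) (ginv d)) = circle_val z * F (er d).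
Proof.
rewrite act_mull ?er_inv // mul_inv_r -tw_i_act.
exact: ext_tw_i.
Qed.

Lemma conv_ext F g e : continuous F -> Sigma_c g ->
  convolution (ext F) g e = F (er e) * g e.
Proof.
move=> cF sg; have sF : Sigma_c (@ext R G T F) by exact: Sigma_ext.
have fe : fibre_seq (es e) [:: pi e] by split=> // g'; rewrite inE => /eqP ->.
rewrite (conv_sum GT2 (s := [:: pi e]) (Sigma_equivariant sF) (Sigma_equivariant sg)) //.
  rewrite big_seq1 (@conv_term_inv _ _ _ (ext F) g e (lift (pi e)) e) ?pi_lift ?es_lift //.
  - by rewrite -{1}[e]act1 ext_div_act mul1r.
  - exact: Sigma_equivariant.
  - exact: Sigma_equivariant.
move=> d de; rewrite inE; apply: contraNT => /eqP ne.
by rewrite ext_div ?mul0r // => pe; apply: ne.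
Qed.

Lemma fun_ext_mul F a e : continuous F ->
  ra_fun (inA (ext F) ** a) e = F (er e) * ra_fun a e.
Proof.
move=> cF; have sF : Sigma_c (@ext R G T F) by exact: Sigma_ext.
apply: nrm0_eq => d d0.
set K := nrm (inA (ext F)) + nrm (F (er e)).
have K0 : 0 <= K by rewrite addr_ge0 ?nrm_ge0.
have [d' d'0 d'K] := small_factor K0 d0.
have [g sg ga] := approx a d'0.
have := fun_in_mul Gtop Get GT2 Gcpt p1 A e sF sg; rewrite conv_ext // => gE.
have -> : ra_fun (inA (ext F) ** a) e - F (er e) * ra_fun a e =
   F (er e) * (g e - ra_fun a e) - ra_fun (inA (ext F) ** (inA g - a)) e.
  by rewrite mulBr fsub gE; ring.
apply: le_trans (nrmB _ _) _; apply: le_trans d'K.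
rewrite /K [leRHS]mulrDr [leLHS]addrC lerD //.
  apply: le_trans (fle _ _) _; apply: le_trans (nrmM _ _) _.
  by rewrite mulrC ler_wpM2r ?nrm_ge0 // ltW.
rewrite cabsM mulrC ler_wpM2r ?nrm_ge0 //; apply: le_trans (fapp _ _ sg) _; exact: ltW.
Qed.

Lemma lift_unit (x : units G) : exists z, lift (unit_val x) = tw_i T (x, z).
Proof.
have [|z ez] := @pi_unitP _ _ T (lift (unit_val x)); first by rewrite pi_lift; exact: unit_valP.
by exists z; rewrite ez es_lift src0_unit.
Qed.

Lemma fun_mul_ext F a e : continuous F ->
  ra_fun (a ** inA (ext F)) e = ra_fun a e * F (es e).
Proof.
move=> cF; have sF : Sigma_c (@ext R G T F) by exact: Sigma_ext.
rewrite (@fun_mul_in a (ext F) e [:: unit_val (es e)]) //.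
- rewrite big_seq1; have [z ->] := lift_unit (es e).
  rewrite tw_i_inv -actEr feq ext_tw_i circle_invE.
  by rewrite mulrACA mulVf ?circle_neq0 // mul1r.
- by split=> // g; rewrite inE => /eqP ->; rewrite src0_unit.
move=> d de; rewrite inE; apply: contraNT => ne; apply/eqP; apply: ext_out => u.
by move: ne; rewrite (gunitE u) -[src0 _]/(es d) de eqxx.
Qed.

Lemma oneE : ba_one A = inA (ext (fun=> 1)).
Proof.
rewrite -[RHS]ba_mul1l; apply: finj => e; rewrite fun_mul_ext ?mulr1 //.
exact: cst_continuous.
Qed.

Lemma ext_bounded F (M : R) : 0 <= M -> (forall x, nrm (F x) <= M) ->
  matrix_bounded p M (@ext R G T F).
Proof.
move=> M0 FM x s c fs; have [us sx] := fs.
rewrite mulr_sumr big_seq [leRHS]big_seq; apply: ler_sum => g gs.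
rewrite -powRM ?nrm_ge0 //; apply: ge0_ler_powR; [exact: ltW|by rewrite nnegrE nrm_ge0|by rewrite nnegrE mulr_ge0 ?nrm_ge0|].
rewrite (bigD1_seq g) //= big_seq_cond big1 ?addr0 => [|h /andP[hs hg]]; last first.
  rewrite ext_div ?mul0r // ?es_lift ?pi_lift ?sx // => gh.
  by move: hg; rewrite gh eqxx.
rewrite -{1}(act1 (lift g)) ext_div_act mul1r cabsM ler_wpM2r ?nrm_ge0 //.
Qed.

(** The matrix of ext F is diagonal. *)
Lemma norm_ext F (M : R) : continuous F -> 0 <= M -> (forall x, nrm (F x) <= M) ->
  nrm (inA (ext F)) <= M.
Proof.
move=> cF M0 FM; apply: in_le => //; first exact: Sigma_ext.
exact: ext_bounded.
Qed.

(** The product b F a at e is approximated by finite partial sums of the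
    convolution, uniformly over all F bounded by 1. The rest of the series is
    controlled by a row of b and a column of a, by the matrix bounds. Uniformity
    is what allows F to be chosen after the finite set. *)
Lemma mul_approx b a e (d : R) : 0 < d -> exists s, fibre_seq (es e) s /\
  forall F s', continuous F -> (forall x, nrm (F x) <= 1) -> fibre_seq (es e) s' ->
    {subset s <= s'} ->
    nrm (ra_fun (b ** (inA (ext F) ** a)) e -
      \sum_(h <- s') ra_fun b (gmul e (ginv (lift h))) * (F (rng0 h) * ra_fun a (lift h))) <= d.
Proof.
move=> d0; have b0 : 0 <= nrm b + nrm b by rewrite addr_ge0 ?nrm_ge0.
have [d' d'0 d'K] := small_factor b0 d0.
have [g sg ga] := approx a d'0.
have [s [fs hs]] := Sigma_finite_src Gtop Get GT2 (es e) sg.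
exists s; split=> // F s' cF F1 fs' ss'.
have sF : Sigma_c (@ext R G T F) by exact: Sigma_ext.
have sFg := Sigma_conv Gtop Get GT2 sF sg.
have N1 : nrm (inA (ext F)) <= 1 by exact: norm_ext.
have -> : ra_fun (b ** (inA (ext F) ** a)) e -
    \sum_(h <- s') ra_fun b (gmul e (ginv (lift h))) * (F (rng0 h) * ra_fun a (lift h)) =
  \sum_(h <- s') ra_fun b (gmul e (ginv (lift h))) * (F (rng0 h) * ra_fun (inA g - a) (lift h))
    - ra_fun (b ** (inA (ext F) ** (inA g - a))) e.
  rewrite !mulBr fsub -ra_inM // (@fun_mul_in b (convolution (ext F) g) e s') //; last first.
    move=> x xe; rewrite conv_ext // mulf_eq0 negb_or => /andP[_ gx].
    by apply: ss'; exact: hs.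
  have -> : \sum_(h <- s') ra_fun b (gmul e (ginv (lift h))) * (F (rng0 h) * ra_fun (inA g - a) (lift h))
    = \sum_(h <- s') ra_fun b (gmul e (ginv (lift h))) * convolution (ext F) g (lift h) -
      \sum_(h <- s') ra_fun b (gmul e (ginv (lift h))) * (F (rng0 h) * ra_fun a (lift h)).
    rewrite -sumrB; apply: eq_bigr => h _; rewrite conv_ext // er_lift fsub fin //.
    by rewrite -mulrBr -mulrBr.
  by rewrite opprB [RHS]addrC addrA subrK.
apply: le_trans (nrmB _ _) _; apply: le_trans d'K; rewrite mulrDr.
apply: lerD.
  have := row_bound p1 (fbd b) (feq b) (fun h => F (rng0 h) * ra_fun (inA g - a) (lift h)) fs'.
  have cb := column_bound p1 (fbd (inA g - a)) (feq _) fs'.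
  set S := \sum_(k <- s') nrm (F (rng0 k) * ra_fun (inA g - a) (lift k)) `^ p.
  move=> h; have hS : S <= nrm (inA g - a) `^ p.
    apply: le_trans cb; apply: ler_sum => k _; apply: ge0_ler_powR; [exact: ltW|by rewrite nnegrE nrm_ge0|by rewrite nnegrE nrm_ge0|].
    by rewrite cabsM -[leRHS]mul1r ler_wpM2r ?nrm_ge0.
  have {}h : nrm (\sum_(h <- s') ra_fun b (gmul e (ginv (lift h))) *
      (F (rng0 h) * ra_fun (inA g - a) (lift h))) `^ p <= (nrm b * nrm (inA g - a)) `^ p.
    by apply: le_trans h _; rewrite powRM ?nrm_ge0 // ler_wpM2l ?powR_ge0.
  rewrite leNgt; apply/negP => lt.
  have : d' * nrm b >= nrm b * nrm (inA g - a) by rewrite mulrC ler_wpM2r ?nrm_ge0 // ltW.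
  move=> /le_lt_trans /(_ lt) {}lt; move: h; rewrite leNgt gt0_ltr_powR //;
    by rewrite nnegrE ?mulr_ge0 ?nrm_ge0.
apply: le_trans (fle _ _) _; apply: le_trans (nrmM _ _) _.
rewrite mulrC ler_wpM2r ?nrm_ge0 //; apply: le_trans (nrmM _ _) _.
by rewrite -[leRHS]mul1r ler_pM ?nrm_ge0 // ltW.
Qed.

Lemma term_inv a b e d d' : es e = es d -> pi d = pi d' ->
  ra_fun b (gmul e (ginv d)) * ra_fun a d = ra_fun b (gmul e (ginv d')) * ra_fun a d'.
Proof. by move=> ed dd; apply: conv_term_inv => //; exact: feq. Qed.

(** If only one arrow contributes to the convolution, it is the exact value of the
    product, although the convolution formula is only a limit. *)
Lemma single_term b a e d0 : es d0 = es e ->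
  (forall d, es d = es e -> pi d <> pi d0 ->
     ra_fun b (gmul e (ginv d)) * ra_fun a d = 0) ->
  ra_fun (b ** a) e = ra_fun b (gmul e (ginv d0)) * ra_fun a d0.
Proof.
move=> d0e hd; apply: nrm0_eq => dl dl0.
have [s [fs hs]] := mul_approx b a e dl0.
have fd : fibre_seq (es e) [:: pi d0] by split=> // g; rewrite inE => /eqP ->; exact: d0e.
have fs' := fibre_seq_cat fs fd.
have := hs (fun=> 1) _ _ _ fs' _; rewrite -oneE ba_mul1l.
have [us' sx'] := fs'.
rewrite (bigD1_seq (pi d0)) //=; last by rewrite mem_undup mem_cat inE eqxx orbT.
rewrite big_seq_cond big1 ?addr0 => [|h /andP[hh /eqP hn]]; last first.
  by rewrite mul1r hd ?es_lift ?pi_lift ?sx'.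
rewrite mul1r (@term_inv _ _ _ _ d0) ?pi_lift ?es_lift ?sx' //; last first.
  by rewrite mem_undup mem_cat inE eqxx orbT.
apply.
- exact: cst_continuous.
- by move=> x; rewrite cabs1.
- by move=> g gs; rewrite mem_undup mem_cat gs.
Qed.

Definition trivial_isotropy (x : units G) : Prop :=
  forall g : G, src g = unit_val x -> rng g = unit_val x -> g = unit_val x.

(** The quotient h^-1 g belongs to the isotropy group at x. *)
Lemma trivial_isotropy_inj (x : units G) (g h : G) : trivial_isotropy x ->
  src0 g = x -> src0 h = x -> rng0 g = rng0 h -> g = h.
Proof.
move=> tx gx hx /(congr1 (@unit_val G)); rewrite !rng0_val => gh.
have sg : src g = unit_val x by rewrite -gx.
have sh : src h = unit_val x by rewrite -hx.
rewrite -(gmulVKg (esym gh)) (tx (gmul (ginv h) g)) ?srcM ?rngM ?rng_inv ?src_inv //.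
by rewrite gmul_unit_r //; [exact: unit_valP|rewrite rng_unit //; exact: unit_valP].
Qed.

(** At a unit with trivial isotropy the arrows of a finite partial sum have
    distinct ranges, so a bump function F that is 1 at the range of d0 and 0 at
    the other ranges keeps only the term of d0. *)
Lemma isolate b a e d0 (d : R) : 0 < d -> trivial_isotropy (es e) -> es d0 = es e ->
  exists F : units G -> R, [/\ continuous F, forall x, 0 <= F x <= 1, F (er d0) = 1 &
    nrm (ra_fun (b ** (inA (ext (fun x => (F x)%:C)) ** a)) e -
         ra_fun b (gmul e (ginv d0)) * ra_fun a d0) <= d].
Proof.
move=> dl0 tx d0e.
have [s [fs hs]] := mul_approx b a e dl0.
have fd : fibre_seq (es e) [:: pi d0] by split=> // g; rewrite inE => /eqP ->; exact: d0e.
(* The finite set is enlarged by the arrow of d0, so that its term occurs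
    in the sum. *)
have fs' := fibre_seq_cat fs fd; set s' := undup _ in fs'; have [us' sx'] := fs'.
(* The ranges at which the bump function has to vanish. *)
pose B : set (units G) := [set` map (@rng0 G) [seq h <- s' | h != pi d0]].
have cB : closed B.
  apply: (accessible_finite_set_closed.1 (hausdorff_accessible (hausdorff_units GT2))).
  exact: finite_seq.
have nB : ~ B (er d0).
  move=> /mapP[h]; rewrite mem_filter => /andP[/= hn hh] e0.
  by move/eqP : hn; apply; apply: (trivial_isotropy_inj tx (sx' _ hh) d0e).
have [F [K [cF [F1 F01] cK KB FK]]] := @bump R G GT2 Gcpt (er d0) (~` B) (closed_openC cB) nB.
exists F; split=> //.
have := hs (fun x => (F x)%:C) s' _ _ fs' _.
rewrite (bigD1_seq (pi d0)) //=; last by rewrite mem_undup mem_cat inE eqxx orbT.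
rewrite big_seq_cond big1 ?addr0 => [|h /andP[hh hn]]; last first.
  rewrite FK ?mul0r ?mulr0 // => /KB; apply.
  by apply/mapP; exists h => //; rewrite mem_filter /= hn.
rewrite -[rng0 (pi d0)]/(er d0) F1 mul1r (@term_inv _ _ _ _ d0) ?pi_lift ?es_lift //.
apply.
- exact: continuous_RtoC.
- by move=> x; rewrite cabsR; have /andP[? ?] := F01 x; rewrite ger0_norm.
- by move=> g gs; rewrite mem_undup mem_cat gs.
Qed.

End Products.

(** * The exponential series *)

Section Exponential.
Context {R : realType} (B : banach_algebra R[i]).
Implicit Types a b : B.

Definition exp_term a (n : nat) : B := (n`!%:R)^-1 *: iter n (ba_mul a) (ba_one B).

Lemma nrm_nat n : nrm (n%:R : R[i]) = n%:R.
Proof. by rewrite -(rmorph_nat (real_complex R)) cabsR ger0_norm. Qed.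

Lemma nrm_exp_term a n : nrm (exp_term a n) <= nrm (ba_one B) * exp_coeff (nrm a) n.
Proof.
have h : nrm (iter n (ba_mul a) (ba_one B)) <= nrm a ^+ n * nrm (ba_one B).
  elim: n => [|n IH]; first by rewrite expr0 mul1r.
  rewrite iterS exprS -mulrA; apply: le_trans (nrmM _ _) _.
  by rewrite ler_wpM2l ?nrm_ge0.
rewrite /exp_term nrmZ cabsV nrm_nat /exp_coeff mulrC [leRHS]mulrA.
by rewrite ler_wpM2r ?invr_ge0 // mulrC.
Qed.

Lemma exp_tail a m n : nrm (\sum_(m <= k < n) exp_term a k) <=
  nrm (ba_one B) * \sum_(m <= k < n) exp_coeff (nrm a) k.
Proof.
apply: le_trans (nrm_sum _ _ _) _; rewrite mulr_sumr.
by apply: ler_sum => k _; exact: nrm_exp_term.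
Qed.

Lemma exp_cvg a : series (exp_term a) @ \oo --> ba_exp a.
Proof.
suff : cvg (series (exp_term a) @ \oo) by [].
apply/cauchy_cvgP/cauchy_seriesP => -[e ei]; rewrite ltc0E /= => /andP[/eqP -> e0].
have K0 : 0 < nrm (ba_one B) + 1 by rewrite ltr_wpDl ?nrm_ge0.
have ee : 0 < e / (nrm (ba_one B) + 1) by rewrite divr_gt0.
have /cauchy_cvgP/cauchy_seriesP/(_ _ ee) := is_cvg_series_exp_coeff (nrm a).
apply: filterS => -[m n] /= h; rewrite nrmE -[Complex _ _]/(e%:C) ltcR.
apply: le_lt_trans (exp_tail a m n) _.
have s0 : 0 <= \sum_(m <= k < n) exp_coeff (nrm a) k.
  by apply: sumr_ge0 => k _; rewrite /exp_coeff divr_ge0 ?exprn_ge0 ?nrm_ge0.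
move: h; rewrite ger0_norm // ltr_pdivlMr // => h; apply: le_lt_trans h.
by rewrite mulrC ler_wpM2l // lerDl.
Qed.

(** The tail of the exponential series from the second order on is dominated by
    t^2 times the series of exp |a|. *)
Lemma exp_second_order a : exists2 C : R, 0 <= C & forall t : R, `|t| <= 1 ->
  nrm (ba_exp (Complex 0 t *: a) - ba_one B - Complex 0 t *: a) <= C * t ^+ 2.
Proof.
have Ct (t : R) : nrm (Complex 0 t) = `|t|.
  by rewrite /nrm normc_def /= expr0n add0r sqrtr_sqr.
set K := nrm (ba_one B); exists (K * expR (nrm a)).
  by rewrite mulr_ge0 ?nrm_ge0 ?expR_ge0.
move=> t t1; set b := Complex 0 t *: a.
have cv : (fun n => nrm (series (exp_term b) n - ba_one B - b)) @ \oo -->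
    nrm (ba_exp b - ba_one B - b).
  have c : (fun n => series (exp_term b) n - ba_one B - b) @ \oo --> ba_exp b - ba_one B - b.
    apply: cvgB; last exact: cvg_cst.
    by apply: cvgB; [exact: exp_cvg|exact: cvg_cst].
  exact: (cvg_comp _ _ c (@continuous_nrm _ _ _)).
apply: (cvgr_to_le cv); near=> n.
have n2 : (2 <= n)%N by near: n; exists 2.
have -> : series (exp_term b) n - ba_one B - b = \sum_(2 <= k < n) exp_term b k.
  rewrite /series /= (big_cat_nat (n := 2)) //= [X in X + _ - _ - _]big_ltn //.
  rewrite [X in _ + X + _ - _ - _]big_ltn // [X in _ + (_ + X) + _ - _ - _]big_geq // addr0.
  have -> : exp_term b 0 = ba_one B by rewrite /exp_term /= fact0 invr1 scale1r.
  have -> : exp_term b 1 = b by rewrite /exp_term /= invr1 scale1r ba_mul1r.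
  by rewrite -addrA -opprD addrC addKr.
apply: le_trans (exp_tail _ _ _) _; rewrite -mulrA ler_wpM2l ?nrm_ge0 //.
apply: (@le_trans _ _ (\sum_(2 <= k < n) t ^+ 2 * exp_coeff (nrm a) k)).
  rewrite big_nat [leRHS]big_nat; apply: ler_sum => k /andP[k2 _].
  rewrite /exp_coeff mulrA ler_wpM2r ?invr_ge0 // nrmZ Ct exprMn ler_wpM2r ?exprn_ge0 ?nrm_ge0 //.
  rewrite -(subnK k2) exprD real_normK ?num_real // -[leRHS]mul1r.
  by rewrite ler_wpM2r ?sqr_ge0 // exprn_ile1.
rewrite -mulr_sumr mulrC ler_wpM2r ?sqr_ge0 //.
apply: (@le_trans _ _ (series (exp_coeff (nrm a)) n)).
  rewrite /series /= [leRHS](big_cat_nat (n := 2)) //= lerDr.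
  by apply: sumr_ge0 => k _; rewrite /exp_coeff divr_ge0 ?exprn_ge0 ?nrm_ge0.
apply: nondecreasing_cvgn_le; last exact: is_cvg_series_exp_coeff.
apply: nondecreasing_series => k _ _.
by rewrite /exp_coeff divr_ge0 ?exprn_ge0 ?nrm_ge0.
Unshelve. all: by end_near. Qed.

End Exponential.

(** The even and odd parts of the exponential series at i t are the series of
    cosine and sine. *)
Lemma cvg_complex_exp (R : realType) (t : R) :
  (fun n => \sum_(0 <= k < n) (k`!%:R)^-1 * Complex 0 t ^+ k) @ \oo -->
    Complex (cos t) (sin t).
Proof.
have e (k : nat) : (k`!%:R)^-1 * Complex 0 t ^+ k = Complex (cos_coeff t k) (sin_coeff t k).
  have pw j : Complex 0 t ^+ j = Complex ((~~ odd j)%:R * (-1) ^+ j./2 * t ^+ j)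
      ((odd j)%:R * (-1) ^+ j.-1./2 * t ^+ j).
    elim: j => [|j IH]; first by rewrite !expr0 /= !mul1r !mul0r.
    rewrite exprS IH /=; simpc; congr Complex; last first.
      by rewrite (exprS t j); ring.
    case: j {IH} => [|j] /=; first by rewrite !mul0r !mulr0 oppr0.
    by rewrite negbK (exprS t j.+1) (exprS (-1) j./2); ring.
  have -> : (k`!%:R)^-1 = ((k`!%:R)^-1 : R)%:C :> R[i] by rewrite fmorphV rmorph_nat.
  by rewrite pw /=; simpc; congr Complex; rewrite /cos_coeff /sin_coeff /= mulrC.
have -> : (fun n => \sum_(0 <= k < n) (k`!%:R)^-1 * Complex 0 t ^+ k) =
    (fun n => Complex (series (cos_coeff t) n) (series (sin_coeff t) n)).
  apply/funext => n; rewrite (eq_bigr _ (fun k _ => e k)) /series /=.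
  elim: n => [|n IH]; first by rewrite !big_geq.
  by rewrite !big_nat_recr //= IH.
apply: cvg_Complex; rewrite unlock.
  exact: is_cvg_series_cos_coeff.
exact: is_cvg_series_sin_coeff.
Qed.

(** * Hermitian elements are diagonal when p is not 2 *)

Section TangentLine.
Context {R : realType} (p : R).
Hypothesis p1 : 1 <= p.

Let p0 : 0 < p. Proof. exact: lt_le_trans p1. Qed.

(** The graph of the convex function r |-> r^p lies above its tangent line; by the
    inequality of Young. *)
Lemma powR_tangent (r u v : R) : 0 < r -> u <= v -> 0 <= v ->
  r `^ p + p * r `^ (p - 1) * (u - r) <= v `^ p.
Proof.
move=> r0 uv v0; apply: (@le_trans _ _ (r `^ p + p * r `^ (p - 1) * (v - r))).
  by rewrite lerD2l ler_wpM2l ?mulr_ge0 ?powR_ge0 ?(ltW p0) // lerD2r.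
have [->|pn1] := eqVneq p 1; first by rewrite subrr powRr0 (powRr1 (ltW r0)) (powRr1 v0) !mul1r addrC subrK.
have pm : 0 < p - 1 by rewrite subr_gt0 lt_def pn1.
pose q := p / (p - 1).
have q0 : 0 < q by rewrite divr_gt0.
have pq : p^-1 + q^-1 = 1.
  by rewrite /q invf_div -[X in X + _]mul1r -mulrDl addrC subrK divff ?gt_eqF.
have := conjugate_powR v0 (powR_ge0 r (p - 1)) p0 q0 pq.
have -> : (r `^ (p - 1)) `^ q = r `^ p by rewrite -powRrM /q mulrC divfK // gt_eqF.
have -> : r `^ p = r * r `^ (p - 1) by rewrite mulr_powRB1 ?ltW.
set b := r `^ (p - 1); set w := v `^ p => h.
have : p * (v * b) <= p * (w / p + r * b / q) by rewrite ler_pM2l.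
have -> : p * (w / p + r * b / q) = w + r * b * (p - 1).
  by rewrite /q invf_div; field; rewrite !gt_eqF.
by lra.
Qed.

(** The tangent inequality for w |-> |w|^p at c: the component of w along c is at
    most |w|. *)
Lemma nrm_tangent (c w : R[i]) : c != 0 ->
  nrm c `^ p + p * (nrm c `^ (p - 1) / nrm c * (complex.Re (conjc c * w) - nrm c ^+ 2))
    <= nrm w `^ p.
Proof.
move=> c0; have n0 : 0 < nrm c by rewrite nrm_gt0.
have := @powR_tangent (nrm c) (complex.Re (conjc c * w) / nrm c) (nrm w) n0 _ (nrm_ge0 _).
have -> : p * nrm c `^ (p - 1) * (complex.Re (conjc c * w) / nrm c - nrm c) =
  p * (nrm c `^ (p - 1) / nrm c * (complex.Re (conjc c * w) - nrm c ^+ 2)).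
  by field; rewrite gt_eqF.
apply; rewrite ler_pdivrMr // mulrC -(cabsJ c) -cabsM.
exact: le_trans (ler_norm _) (Re_le_cabs _).
Qed.

(** A linear function bounded above by a multiple of t^2 near 0 has slope 0, as
    the bounds at t and at -t show. *)
Lemma linear_term_zero (X D : R) : 0 <= D ->
  (forall t, `|t| <= 1 -> t * X <= D * t ^+ 2) -> X = 0.
Proof.
move=> D0 h; apply/eqP; apply/negPn/negP => X0.
have X2 : 0 < X ^+ 2 by rewrite exprn_even_gt0.
(* The inequality is tested at t = e X, where e is small enough for t to be
    in [-1, 1] and for D e < 1. *)
set e := (`|X| + D + 1)^-1.
have k0 : 0 < `|X| + D + 1 by rewrite ltr_wpDl ?addr_ge0.
have e0 : 0 < e by rewrite invr_gt0.
have eX : `|e * X| <= 1.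
  by rewrite normrM gtr0_norm // mulrC ler_pdivrMr // mul1r -addrA lerDl addr_ge0.
have := h _ eX; rewrite -mulrA -expr2 exprMn [leRHS]mulrA ler_pM2r // => le.
have : 1 <= D * e by rewrite -(ler_pM2l e0) mulr1 mulrCA -expr2.
by rewrite ler_pdivlMr // mul1r; have := normr_ge0 X; lra.
Qed.

(** The only place where p <> 2 enters. *)
Lemma two_powR_neq1 : p != 2 -> 2 `^ (p - 1) / 2 != 1.
Proof.
apply: contraNN => /eqP h.
have {}h : 2 `^ (p - 1) = 2.
  by apply: (@mulIf _ 2^-1); rewrite ?invr_eq0 // h mulfV.
have l2 : ln 2 != 0 :> R by rewrite gt_eqF // ln_gt0 // ltr1n.
have := congr1 (@ln R) h; rewrite ln_powR -[RHS]mul1r => /(mulIf l2).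
by move/eqP; rewrite subr_eq.
Qed.

End TangentLine.

Section Hermitian.
Context {R : realType} {G : groupoid} {T : twist R G}.
Hypotheses (Gtop : topological_groupoid G) (Get : etale G)
  (GT2 : hausdorff_space G) (Gcpt : compact (@gunit G)).
Local Notation E := (tw_E T).
Local Notation pi := (tw_pi T).
Context {p : R}.
Hypotheses (p1 : 1 <= p) (p2 : p != 2).
Variable A : reduced_algebra T p.
Implicit Types (f g : E -> R[i]) (a b : A) (e d : E) (F : units G -> R[i]).
Local Notation inA := (ra_in A).

Let p0 : 0 < p. Proof. exact: lt_le_trans p1. Qed.

(** The matrix of a on a fibre of the source map, in the basis given by the lifts. *)
Definition entry a (g h : G) : R[i] := ra_fun a (gmul (lift g) (ginv (lift h))).

Lemma entry_one (g h : G) : src0 g = src0 h -> entry (ba_one A) g h = (g == h)%:R.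
Proof.
move=> gh; rewrite /entry (oneE Gtop Get GT2 Gcpt p1) fun_in //; last first.
  by apply: Sigma_ext => //; exact: cst_continuous.
have [->|/eqP ne] := eqVneq g h.
  by rewrite -{1}[lift h](act1) ext_div_act mulr1.
by apply: ext_div; rewrite ?es_lift ?pi_lift.
Qed.

(** For a Hermitian element the function t |-> |exp(i t a) c|_p^p is bounded by
    its value at t = 0, so its derivative at 0 vanishes. By convexity the tangent
    inequality replaces differentiation. This is the condition that a is Hermitian
    in the sense of numerical range on l^p. *)
Lemma hermitian_form a (x : units G) (s : seq G) (c : G -> R[i]) :
  ba_hermitian a -> fibre_seq x s -> {in s, forall k, c k != 0} ->
  \sum_(k <- s) nrm (c k) `^ (p - 1) / nrm (c k) *
     complex.Re (conjc (c k) * ('i%C * \sum_(l <- s) entry a k l * c l)) = 0.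
Proof.
move=> ha fs cn; have [us sx] := fs.
have [C C0 hC] := exp_second_order a.
pose kap k := nrm (c k) `^ (p - 1) / nrm (c k).
have kap0 k : 0 <= kap k by rewrite divr_ge0 ?powR_ge0 ?nrm_ge0.
pose L := \sum_(l <- s) nrm (c l).
have L0 : 0 <= L by apply: sumr_ge0 => l _; exact: nrm_ge0.
apply: (@linear_term_zero _ _ (\sum_(k <- s) kap k * (nrm (c k) * (C * L)))).
  apply: sumr_ge0 => k _; apply: mulr_ge0 => //; apply: mulr_ge0; first exact: nrm_ge0.
  exact: mulr_ge0.
move=> t t1; set b := ba_exp (Complex 0 t *: a).
have nb : nrm b = 1 by apply: complexI; rewrite -nrmE ha.
have := fun_bounded Gtop Get GT2 Gcpt p1 b c fs; rewrite nb powR1 mul1r => hb.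
pose w k := \sum_(l <- s) entry b k l * c l.
pose rho k := \sum_(l <- s) entry (b - ba_one A - Complex 0 t *: a) k l * c l.
have rhoB k : nrm (rho k) <= C * t ^+ 2 * L.
  apply: le_trans (nrm_sum _ _ _) _; rewrite /L mulr_sumr; apply: ler_sum => l _.
  rewrite cabsM ler_wpM2r ?nrm_ge0 //; apply: le_trans (hC t t1).
  exact: fun_le.
have wE k : k \in s -> w k = c k + Complex 0 t * (\sum_(l <- s) entry a k l * c l) + rho k.
  move=> ks; have -> : rho k = w k - \sum_(l <- s) entry (ba_one A) k l * c l -
      Complex 0 t * (\sum_(l <- s) entry a k l * c l).
    rewrite mulr_sumr -!sumrB; apply: eq_bigr => l _.
    by rewrite /entry !(fun_sub Gtop Get GT2 Gcpt p1, fun_scale Gtop Get GT2 Gcpt p1); ring.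
  have -> : \sum_(l <- s) entry (ba_one A) k l * c l = c k.
    rewrite (bigD1_seq k) //= entry_one // eqxx mul1r big_seq_cond big1 ?addr0 // => l /andP[ls lk].
    by rewrite entry_one ?sx // eq_sym (negPf lk) mul0r.
  by ring.
(* The vector w = exp(i t a) c has p-norm at most that of c; sum the
    tangent inequalities at the entries of c. *)
have key : \sum_(k <- s) kap k * (complex.Re (conjc (c k) * w k) - nrm (c k) ^+ 2) <= 0.
  rewrite -(pmulr_rle0 _ p0) mulr_sumr -(lerD2l (\sum_(h <- s) nrm (c h) `^ p)) addr0.
  apply: le_trans hb; rewrite -big_split /= big_seq [leRHS]big_seq; apply: ler_sum => k ks.
  by apply: nrm_tangent => //; exact: cn.
rewrite mulr_sumr mulr_suml -subr_le0; apply: le_trans key; rewrite -sumrB.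
rewrite big_seq [leRHS]big_seq; apply: ler_sum => k ks.
rewrite -/(kap k) wE // mulrCA -[_ * _ * t ^+ 2]mulrA -mulrBr ler_wpM2l //.
set m := \sum_(l <- s) _.
have -> : conjc (c k) * (c k + Complex 0 t * m + rho k) =
    (nrm (c k) ^+ 2)%:C + t%:C * (conjc (c k) * ('i%C * m)) + conjc (c k) * rho k.
  rewrite -mulcJ; have -> : Complex 0 t = t%:C * 'i%C by simpc.
  by ring.
rewrite !raddfD /=.
have ReM (u : R) (z : R[i]) : complex.Re (u%:C * z) = u * complex.Re z.
  by case: z => z1 z2 /=; rewrite mul0r subr0.
rewrite ReM.
have : - (nrm (c k) * (C * t ^+ 2 * L)) <= complex.Re (conjc (c k) * rho k).
  rewrite lerNl; apply: (@le_trans _ _ (nrm (conjc (c k) * rho k))).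
    by apply: le_trans (Re_le_cabs _); rewrite -normrN ler_norm.
  by rewrite cabsM cabsJ ler_wpM2l ?nrm_ge0.
have -> : nrm (c k) * (C * L) * t ^+ 2 = nrm (c k) * (C * t ^+ 2 * L) by ring.
by lra.
Qed.

(** Take two arrows and the vectors (1, z) and (1, -z): in the sum of the two
    relations the diagonal entries cancel. What remains involves the two
    off-diagonal entries with weights 1 and |z|^(p-2), so comparing |z| = 1 and
    |z| = 2 gives two independent relations unless p = 2. *)
Lemma hermitian_offdiag a (g h : G) : ba_hermitian a -> src0 g = src0 h -> g <> h ->
  entry a g h = 0.
Proof.
move=> ha gh /eqP ne.
have fs : fibre_seq (src0 h) [:: g; h].
  split=> [|k]; first by rewrite /= inE ne.
  by rewrite !inE => /orP[]/eqP ->.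
set m1 := entry a g h; pose m2 := entry a h g.
have X (z : R[i]) : z != 0 ->
    complex.Re ('i%C * m1 * z) + nrm z `^ (p - 1) / nrm z * complex.Re ('i%C * m2 * conjc z) = 0.
  move=> z0; have zN0 : - z != 0 by rewrite oppr_eq0.
  pose c (y : R[i]) k := if k == g then 1 else y.
  have cg y : c y g = 1 by rewrite /c eqxx.
  have ch y : c y h = y by rewrite /c eq_sym (negPf ne).
  have cn y : y != 0 -> {in [:: g; h], forall k, c y k != 0}.
    by move=> y0 k; rewrite !inE => /orP[]/eqP ->; rewrite ?cg ?ch ?oner_eq0.
  have := hermitian_form ha fs (cn _ z0); have := hermitian_form ha fs (cn _ zN0).
  rewrite !big_cons !big_nil !addr0 !cg !ch -/m1 -/m2 cabs1 powR1 divr1 !mul1r nrmN conjc1.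
  set k := nrm z `^ (p - 1) / nrm z.
  move: (entry a g g) (entry a h h) m1 m2 => [u1 u2] [v1 v2] [x1 x2] [y1 y2].
  case: (z) => z1 z2 /=; simpc => /= h1 h2.
  have : forall r1 r2 s1 s2 : R, r1 = 0 -> r2 = 0 -> (s1 + s1 = r2 - r1) -> s1 = 0.
    by move=> r1 r2 s1 _ -> ->; lra.
  by move=> H; apply: (H _ _ _ 0 h1 h2); ring.
have k2 := two_powR_neq1 p2; set k : R := 2 `^ (p - 1) / 2 in k2.
have k20 : k - 1 != 0 by rewrite subr_eq0.
have nR (r : R) : nrm (Complex r 0) = `|r| by exact: cabsR.
have nI (r : R) : nrm (Complex 0 r) = `|r|.
  by rewrite /nrm normc_def /= expr0n add0r sqrtr_sqr.
have n0 (z : R[i]) : nrm z != 0 -> z != 0 by rewrite nrm_eq0.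
(* The real and imaginary parts of the two entries are four unknowns: z =
    1, 2, i, 2 i give four equations. *)
have := X (Complex 1 0); have := X (Complex 2 0).
have := X (Complex 0 1); have := X (Complex 0 2).
rewrite -!nrm_eq0 !nR !nI !normr1 !normr_nat oner_eq0 pnatr_eq0 powR1 divr1 -/k.
move: m1 m2 {X} => [x1 x2] [y1 y2] /=.
rewrite !(mul0r, mulr0, mul1r, mulr1, add0r, addr0, oppr0, subr0, sub0r, opprK).
move=> /(_ isT) h1 /(_ isT) h2 /(_ isT) h3 /(_ isT) h4.
have e1 : (k - 1) * y1 = 0 by lra.
have e2 : (k - 1) * y2 = 0 by lra.
move/eqP : e1; rewrite mulf_eq0 (negPf k20) /= => /eqP y10.
move/eqP : e2; rewrite mulf_eq0 (negPf k20) /= => /eqP y20.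
by apply/eqP; rewrite eq_complex /=; apply/andP; split; apply/eqP; lra.
Qed.

End Hermitian.

(** * The core is the algebra of functions on the unit space *)

Section CoreFunctions.
Context {R : realType} {G : groupoid} {T : twist R G}.
Hypotheses (Gtop : topological_groupoid G) (Get : etale G)
  (GT2 : hausdorff_space G) (Gcpt : compact (@gunit G)).
Local Notation E := (tw_E T).
Local Notation pi := (tw_pi T).
Context {p : R}.
Hypotheses (p1 : 1 <= p) (p2 : p != 2).
Variable A : reduced_algebra T p.
Variable x0 : units G.
Implicit Types (f g : E -> R[i]) (a b : A) (e d : E) (F : units G -> R[i]) (x : units G).
Local Notation inA := (ra_in A).

Definition diagonal a : Prop := forall e, ~ gunit (pi e) -> ra_fun a e = 0.

Lemma fun_ext F e : continuous F -> ra_fun (inA (ext F)) e = ext F e.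
Proof. by move=> cF; rewrite fun_in //; exact: Sigma_ext. Qed.

Lemma ev_ext F x : continuous F -> ra_ev (inA (ext F)) x = F x.
Proof. by move=> cF; rewrite /ra_ev fun_ext // ext_unit. Qed.

Lemma ev_continuous a : continuous (ra_ev a).
Proof.
move=> x; apply: (@continuous_comp _ _ _ (fun y => tw_unit T y) (ra_fun a)).
  have Fx : Filter (nbhs x) by exact: nbhs_filter.
  apply: (@cvg_tw_i R G T _ (nbhs x) Fx (fun y => y) (fun=> circle_one)).
    exact: cvg_id.
  exact: (@cvg_cst _ circle_one _ (nbhs x)).
exact: fun_continuous.
Qed.

Lemma diagonal_fun a e : diagonal a -> ra_fun a e = ext (ra_ev a) e.
Proof.
move=> da; have [u|nu] := pselect (gunit (pi e)); last by rewrite ext_out // da.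
have [z ->] := pi_unitP u; rewrite ext_tw_i tw_i_act.
exact: fun_equivariant.
Qed.

(** A diagonal function is determined by its restriction to the units, which is
    continuous. *)
Lemma diagonal_ext a : diagonal a -> a = inA (ext (ra_ev a)).
Proof.
move=> da; apply: (in_fun Gtop Get GT2 Gcpt p1).
  by apply: Sigma_ext => //; exact: ev_continuous.
by move=> e; exact: diagonal_fun.
Qed.

Lemma ext_mulE F K : continuous F -> continuous K ->
  inA (ext F) ** inA (ext K) = inA (ext (fun x => F x * K x)).
Proof.
move=> cF cK; have cFK : continuous ((fun x => F x * K x) : units G -> R[i]).
  exact: (continuous_mulC cF cK).
apply: (fun_inj Gtop Get GT2 Gcpt p1) => e.
rewrite (fun_ext_mul Gtop Get GT2 Gcpt p1 _ _ cF) (fun_ext _ cK) (fun_ext _ cFK).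
have [u|nu] := pselect (gunit (pi e)); last by rewrite !(ext_out _ nu) mulr0.
by have [z ->] := pi_unitP u; rewrite !ext_tw_i er_tw_i mulrCA.
Qed.

Lemma ext_scale (k : R[i]) F : continuous F ->
  k *: inA (ext F) = inA (ext (fun x => k * F x)).
Proof.
move=> cF; have ckF : continuous ((fun x => k * F x) : units G -> R[i]).
  exact: (@continuous_mulC R _ (fun=> k) F (@continuous_cstC R _ k) cF).
apply: (fun_inj Gtop Get GT2 Gcpt p1) => e.
rewrite (fun_scale Gtop Get GT2 Gcpt p1) (fun_ext _ cF) (fun_ext _ ckF).
have [u|nu] := pselect (gunit (pi e)); last by rewrite !(ext_out _ nu) mulr0.
by have [z ->] := pi_unitP u; rewrite !ext_tw_i mulrCA.
Qed.

Lemma fun_cvg (u : nat -> A) a e : u @ \oo --> a ->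
  (fun n => ra_fun (u n) e) @ \oo --> ra_fun a e.
Proof.
move=> /cvg_nrm ua; apply/cvg_nrm => d d0; have := ua d d0; apply: filterS => n.
by apply: le_lt_trans; rewrite -fun_sub //; exact: fun_le.
Qed.

(** For real F the exponential of i t F is again diagonal, with values exp(i t
    F(x)) of modulus 1; so its norm is 1. At least one unit x0 is needed for the
    norm to be at least 1. *)
Lemma ext_hermitian (F : units G -> R) : continuous F ->
  ba_hermitian (inA (ext (fun x => (F x)%:C))).
Proof.
move=> cF t; have cFC : continuous (fun x => (F x)%:C) by exact: continuous_RtoC.
set u := ba_exp _.
pose K x : R[i] := Complex 0 t * (F x)%:C.
have cK : continuous K .
  exact: (@continuous_mulC R _ (fun=> Complex 0 t) _ (@continuous_cstC R _ _) cFC).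
have cKn n : continuous ((fun x => K x ^+ n) : units G -> R[i]).
  elim: n => [|n IH].
    rewrite (_ : (fun x => K x ^+ 0) = fun=> 1); first exact: continuous_cstC.
    by apply/funext => y; rewrite expr0.
  rewrite (_ : (fun x => K x ^+ n.+1) = fun x => K x * K x ^+ n); last first.
    by apply/funext => y; rewrite exprS.
  exact: (continuous_mulC cK IH).
have iterE n : iter n (ba_mul (Complex 0 t *: inA (ext (fun x => (F x)%:C)))) (ba_one A) =
    inA (ext (fun x => K x ^+ n)).
  elim: n => [|n IH]; first exact: oneE.
  rewrite iterS IH (ext_scale (Complex 0 t) cFC) (ext_mulE cK (cKn n)).
  suff -> : (fun x => K x ^+ n.+1) = (fun x => K x * K x ^+ n) by [].
  by apply/funext => y; rewrite exprS.
have us e : (fun n => \sum_(0 <= k < n) (k`!%:R)^-1 * ext (fun x => K x ^+ k) e) @ \oo -->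
    ra_fun u e.
  have := fun_cvg (e := e) (@exp_cvg _ _ (Complex 0 t *: inA (ext (fun x => (F x)%:C)))).
  suff -> : (fun n => \sum_(0 <= k < n) (k`!%:R)^-1 * ext (fun x => K x ^+ k) e) =
      (fun n => ra_fun (series (exp_term
        (Complex 0 t *: inA (ext (fun x => (F x)%:C)))) n) e) by [].
  apply/funext => n; rewrite /series /= (fun_sum Gtop Get GT2 Gcpt p1).
  apply: eq_bigr => k _; rewrite /exp_term iterE.
  by rewrite (fun_scale Gtop Get GT2 Gcpt p1) (fun_ext _ (cKn k)).
have du : diagonal u.
  move=> e nu; have := us e.
  rewrite (_ : (fun n => _) = fun=> 0).
    by move=> h; exact: (cvg_unique (@norm_hausdorff _ R[i]) h (cvg_cst 0)).
  by apply/funext => n; apply: big1 => k _; rewrite (ext_out _ nu) mulr0.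
have evu x : nrm (ra_ev u x) = 1.
  have c1 := us (tw_unit T x); have c2 := @cvg_complex_exp R (t * F x).
  suff E1 : (fun n => \sum_(0 <= k < n) k`!%:R^-1 * ext (fun y => K y ^+ k) (tw_unit T x)) =
     (fun n => \sum_(0 <= k < n) (k`!%:R)^-1 * Complex 0 (t * F x) ^+ k).
    rewrite E1 in c1; rewrite /ra_ev (cvg_unique (@norm_hausdorff _ R[i]) c1 c2).
    by rewrite /nrm normc_def /= cos2Dsin2 sqrtr1.
  apply/funext => n; apply: eq_bigr => k _; rewrite ext_unit.
  by congr (_ * _ ^+ _); rewrite /K; simpc.
rewrite nrmE; congr (_%:C); apply/eqP; rewrite eq_le; apply/andP; split.
  have := norm_ext Gtop Get GT2 Gcpt p1 A (ev_continuous (a := u)) ler01.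
  by rewrite -(diagonal_ext du); apply=> x; rewrite evu.
by rewrite -(evu x0); exact: fun_le.
Qed.

Lemma core_ext F : continuous F -> core (inA (ext F)).
Proof.
move=> cF; exists (inA (ext (fun x => (complex.Re (F x))%:C))).
exists (inA (ext (fun x => (complex.Im (F x))%:C))).
have cR : continuous (fun x => complex.Re (F x)).
  by move=> x; apply: (@continuous_comp _ _ _ F); [exact: cF|exact: continuous_Re].
have cI : continuous (fun x => complex.Im (F x)).
  by move=> x; apply: (@continuous_comp _ _ _ F); [exact: cF|exact: continuous_Im].
have cRC := continuous_RtoC cR; have cIC := continuous_RtoC cI.
split; [exact: ext_hermitian|exact: ext_hermitian|].
apply: (fun_inj Gtop Get GT2 Gcpt p1) => e.
rewrite (fun_add Gtop Get GT2 Gcpt p1) (fun_scale Gtop Get GT2 Gcpt p1).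
rewrite (fun_ext _ cF) (fun_ext _ cRC) (fun_ext _ cIC).
have [u|nu] := pselect (gunit (pi e)); last by rewrite !(ext_out _ nu) mulr0 addr0.
have [z ->] := pi_unitP u; rewrite !ext_tw_i mulrCA -mulrDr; congr (_ * _).
exact: complexE.
Qed.

(** An element e outside the unit space compares the distinct arrows pi(e) and
    s(e), so its value is an off-diagonal entry. *)
Lemma hermitian_diagonal a : ba_hermitian a -> diagonal a.
Proof.
move=> ha e nu; have ge : pi e <> unit_val (es e).
  by move=> h; apply: nu; rewrite h; exact: unit_valP.
have := hermitian_offdiag Gtop Get GT2 Gcpt p1 p2 ha _ ge; rewrite src0_unit => /(_ erefl).
rewrite /entry; have [z ->] := lift_unit (T := T) (es e).
have [w ew] := pi_eq_act (pi_lift (T := T) (pi e)).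
have es0 : es (lift (pi e) : E) = es e by rewrite es_lift.
rewrite tw_i_inv -es0 -actEr (fun_equivariant Gtop Get GT2 Gcpt p1) => /eqP.
rewrite mulf_eq0 (negPf (circle_neq0 _)) /= => /eqP h.
by rewrite ew (fun_equivariant Gtop Get GT2 Gcpt p1) h mulr0.
Qed.

(** Real and imaginary parts of a function on the unit space are Hermitian;
    conversely Hermitian elements are diagonal. This identifies the core with
    C(G^0). *)
Lemma coreP a : core a <-> diagonal a.
Proof.
split=> [[h [k [hh hk ->]]] e nu|da].
  by rewrite fun_add // fun_scale // !hermitian_diagonal // mulr0 addr0.
by rewrite (diagonal_ext da); apply: core_ext; exact: ev_continuous.
Qed.

Lemma core_inE a : core a -> a = inA (ext (ra_ev a)).
Proof. by move=> /coreP; exact: diagonal_ext. Qed.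

Lemma fun_mul_core a b e : core b -> ra_fun (a ** b) e = ra_fun a e * ra_ev b (es e).
Proof. by move=> /core_inE {1}->; rewrite fun_mul_ext //; exact: ev_continuous. Qed.

Lemma core_one : core (ba_one A).
Proof. by rewrite (oneE Gtop Get GT2 Gcpt p1); apply: core_ext; exact: cst_continuous. Qed.

Lemma ev_one x : ra_ev (ba_one A) x = 1.
Proof. by rewrite (oneE Gtop Get GT2 Gcpt p1) ev_ext //; exact: cst_continuous. Qed.

Lemma isolate_core b a e d0 (d : R) : 0 < d -> trivial_isotropy (es e) -> es d0 = es e ->
  exists f : A, [/\ core_nonneg (@ra_ev R G T p A) f, ra_ev f (er d0) = 1 &
    nrm (ra_fun (b ** f ** a) e - ra_fun b (gmul e (ginv d0)) * ra_fun a d0) <= d].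
Proof.
move=> dl0 tx d0e.
have [F [cF F01 F1 h]] := isolate Gtop Get GT2 Gcpt p1 b a dl0 tx d0e.
have cFC := continuous_RtoC cF.
exists (inA (ext (fun x => (F x)%:C))); split.
- split; first exact: core_ext.
  by move=> x; rewrite ev_ext // ler0c; have /andP[] := F01 x.
- by rewrite ev_ext // F1.
- by rewrite -ba_mulA.
Qed.

(** Enough positive functions in the core to separate a point from a closed set. *)
Lemma core_bump (x : units G) (W : set (units G)) : open W -> W x ->
  exists f : A, [/\ core_nonneg (@ra_ev R G T p A) f, ra_ev f x = 1 &
    forall y, ~ W y -> ra_ev f y = 0].
Proof.
move=> oW Wx; have [h [K [ch [hx h01] cK KW hK]]] := bump GT2 Gcpt oW Wx (R := R).
have chC := continuous_RtoC ch.
exists (inA (ext (fun x => (h x)%:C))); split.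
- split; first exact: core_ext.
  by move=> y; rewrite ev_ext // ler0c; have /andP[] := h01 y.
- by rewrite ev_ext // hx.
- by move=> y nW; rewrite ev_ext // hK // => /KW.
Qed.

End CoreFunctions.

(** * Topologies given by a subbase *)

(** Every neighbourhood contains a finite intersection of members of B: the
    property of a subbase that continuity arguments use. *)
Definition generates (Y : topologicalType) (B : set (set Y)) : Prop :=
  forall (O : set Y) u, open O -> O u -> exists s : seq (set Y),
    (forall S, S \in s -> B S /\ S u) /\ forall v, (forall S, S \in s -> S v) -> O v.

Lemma generates_continuous (X Y : topologicalType) (B : set (set Y)) (f : X -> Y) :
  generates B -> (forall S, B S -> open (f @^-1` S)) -> continuous f.
Proof.
move=> gB oB x W /nbhs_open[Q [oQ Qx QW]]; have [s [sB sO]] := gB _ _ oQ Qx.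
have Fx : Filter (nbhs x) by exact: nbhs_filter.
have nS S : S \in s -> \forall y \near x, S (f y).
  by move=> /sB[BS Su]; apply: open_nbhs_nbhs; split=> //; exact: oB.
have := @near_all_seq _ _ _ Fx s (fun S y => S (f y)) nS.
by apply: (@filterS _ _ Fx) => y h; apply/QW/sO => S; exact: h.
Qed.

Lemma germ_generates (R : realType) (A : banach_algebra R[i]) (X : topologicalType)
  (ev : A -> X -> R[i]) : generates (@weyl_germ_basis R A X ev).
Proof.
move=> O u [D sD <-] [S DS Su]; have [F FB FS] := sD S DS.
exists (finmap.enum_fset F); split=> [U UF|v h].
  have := FB U UF; rewrite inE => BU; split=> //.
  have Sw : (S : set _) u := Su.
  by move: Sw; rewrite -FS; apply.
have Sv : (S : set _) v by rewrite -FS => U UF; exact: h.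
by exists S; [exact: DS|exact: Sv].
Qed.

Lemma germ_basis_open (R : realType) (A : banach_algebra R[i]) (X : topologicalType)
  (ev : A -> X -> R[i]) S : @weyl_germ_basis R A X ev S -> open S.
Proof.
move=> BS; exists [set S].
  move=> _ ->; exists (finmap.fset1 S); first by move=> U; rewrite finmap.in_fset1 => /eqP ->; exact: mem_set.
  apply/seteqP; split=> [u h|u Su U]; first by apply: h; rewrite /= finmap.in_fset1.
  by rewrite /= finmap.in_fset1 => /eqP ->.
by apply/seteqP; split=> [u [_ -> //]|u Su]; exists S.
Qed.

Lemma arrow_generates (R : realType) (A : banach_algebra R[i]) (X : topologicalType)
  (ev : A -> X -> R[i]) : generates (@weyl_arrow_basis R A X ev).
Proof.
move=> O u [D sD <-] [S DS Su]; have [F FB FS] := sD S DS.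
exists (finmap.enum_fset F); split=> [U UF|v h].
  have := FB U UF; rewrite inE => BU; split=> //.
  have Sw : (S : set _) u := Su.
  by move: Sw; rewrite -FS; apply.
have Sv : (S : set _) v by rewrite -FS => U UF; exact: h.
by exists S; [exact: DS|exact: Sv].
Qed.

Lemma arrow_basis_open (R : realType) (A : banach_algebra R[i]) (X : topologicalType)
  (ev : A -> X -> R[i]) S : @weyl_arrow_basis R A X ev S -> open S.
Proof.
move=> BS; exists [set S].
  move=> _ ->; exists (finmap.fset1 S); first by move=> U; rewrite finmap.in_fset1 => /eqP ->; exact: mem_set.
  apply/seteqP; split=> [u h|u Su U]; first by apply: h; rewrite /= finmap.in_fset1.
  by rewrite /= finmap.in_fset1 => /eqP ->.
by apply/seteqP; split=> [u [_ -> //]|u Su]; exists S.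
Qed.

Lemma homeomorphism_inverse (X Y : topologicalType) (f : X -> Y) (g : Y -> X) :
  cancel f g -> cancel g f -> continuous f -> continuous g -> homeomorphism f.
Proof.
move=> fg gf cf cg; split.
- split=> // [x y _ _ /(congr1 g)|y _]; first by rewrite !fg.
  by exists (g y).
- exact: continuous_subspaceT.
- move=> W oW; exists (g @^-1` W); first exact: open_preimage.
  apply/seteqP; split=> [_ [x [_ Wx] <-]|y [_ Wy]]; first by rewrite /= fg.
  by exists (g y).
Qed.

(** * Pairs that compress the positive functions, and their bisections *)

Lemma open_neq0 (R : realType) (X : topologicalType) (f : X -> R[i]) : continuous f ->
  open [set x | f x != 0].
Proof.
move=> cf; have -> : [set x | f x != 0] = f @^-1` (~` [set 0]).
  by apply/seteqP; split=> x /eqP.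
apply: open_preimage => //; apply: closed_openC.
exact: (closed_point (@norm_hausdorff _ R[i])).
Qed.

Lemma ge0_approx (R : realType) (c : R[i]) :
  (forall d : R, 0 < d -> exists c' : R[i], 0 <= c' /\ nrm (c' - c) <= d) -> 0 <= c.
Proof.
move=> h; have hR d : 0 < d -> - complex.Re c <= d /\ `|complex.Im c| <= d.
  move=> d0; have [[u v] [c0 /= le]] := h d d0.
  move: c0; rewrite lecE /= => /andP[/eqP v0 u0].
  have := le_trans (Re_le_cabs _) le; have := le_trans (Im_le_cabs _) le.
  case: (c) => s t /=; rewrite v0 sub0r normrN => ht hs; split=> //.
  by have := ler_norm (u - s); lra.
have cI : complex.Im c = 0.
  apply/eqP; rewrite -normr_eq0 eq_le normr_ge0 andbT.
  by apply/ler_addgt0Pl => d d0; rewrite addr0; have [] := hR d d0.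
have cR : 0 <= complex.Re c.
  rewrite -oppr_le0; apply/ler_addgt0Pl => d d0.
  by rewrite addr0; have [] := hR d d0.
by case: (c) cI cR => s t /= -> s0; rewrite lecE /= eqxx.
Qed.

Section Pairs.
Context {R : realType} {G : groupoid} {T : twist R G}.
Hypotheses (Gtop : topological_groupoid G) (Get : etale G)
  (GT2 : hausdorff_space G) (Gcpt : compact (@gunit G)).
Local Notation E := (tw_E T).
Local Notation pi := (tw_pi T).
Context {p : R}.
Hypotheses (p1 : 1 <= p) (p2 : p != 2).
Variable A : reduced_algebra T p.
Variable x0 : units G.
Hypothesis princ : topologically_principal G.
Implicit Types (a b f : A) (n m : A * A) (e d : E) (x y : units G).
Local Notation j := (@ra_fun R G T p A).
Local Notation ev := (@ra_ev R G T p A).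

Let jact a z e : j a (tw_act z e) = circle_val z * j a e.
Proof. exact: fun_equivariant. Qed.

Let jcont a : continuous (j a).
Proof. exact: fun_continuous. Qed.

Let core_mul_r a b e : core b -> j (a ** b) e = j a e * ev b (es e).
Proof. exact: fun_mul_core. Qed.

Let coreE a : core a <-> diagonal a.
Proof. exact: coreP. Qed.

Let single b a e d0 : es d0 = es e ->
  (forall d, es d = es e -> pi d <> pi d0 -> j b (gmul e (ginv d)) * j a d = 0) ->
  j (b ** a) e = j b (gmul e (ginv d0)) * j a d0.
Proof. exact: single_term. Qed.

Lemma jinv_act a z e : j a (ginv (tw_act z e)) = conjc (circle_val z) * j a (ginv e).
Proof. by rewrite act_inv jact circle_invE -circle_valJ. Qed.

(** The supports of the two members of an admissible pair match along one
    bisection. *)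
Definition orthogonal_pair n : Prop := forall e d, pi e <> pi d ->
  es e = es d \/ er e = er d -> j n.1 e * j n.2 (ginv d) = 0.

Definition positive_pair n : Prop := forall e, 0 <= j n.2 (ginv e) * j n.1 e.

(** A description of the admissible pairs by the values of the two functions,
    without reference to the maps they realize. *)
Definition normalizing n : Prop := orthogonal_pair n /\ positive_pair n.

(** The first condition in the definition of an admissible pair. *)
Definition compresses n : Prop := forall f, core_nonneg ev f ->
  core_nonneg ev (n.2 ** f ** n.1) /\ core_nonneg ev (n.1 ** f ** n.2).

Lemma normalizing_sharp n : normalizing n -> normalizing (pair_sharp n).
Proof.
move=> [on pn]; split=> [e d ed h|e] /=; last by rewrite mulrC -[X in j n.2 X]ginvK; exact: pn.
rewrite mulrC -[X in j n.2 X]ginvK; apply: on.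
  by rewrite !pi_inv => /(congr1 (@ginv G)); rewrite !ginvK => /esym.
by rewrite !es_inv !er_inv; case: h => ->; [right|left].
Qed.

Lemma compresses_sharp n : compresses n -> compresses (pair_sharp n).
Proof. by move=> h f /h[]. Qed.

Lemma same_pi n e d : normalizing n -> j n.1 e != 0 -> j n.2 (ginv d) != 0 ->
  es e = es d \/ er e = er d -> pi e = pi d.
Proof.
move=> [on _] ae bd h; apply: contrapT => /on /(_ h) /eqP.
by rewrite mulf_eq0 (negPf ae) (negPf bd).
Qed.

Lemma normalizing_gt0 n e : normalizing n -> j n.1 e != 0 -> j n.2 (ginv e) != 0 ->
  0 < j n.2 (ginv e) * j n.1 e.
Proof. by move=> [_ pn] ae be; rewrite lt_def pn mulf_neq0. Qed.

(** A nonzero term of the convolution of b and a at e comes from elements d and (e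
    d^-1)^-1 with the same range; orthogonality makes them lie over the same
    arrow. *)
Lemma unit_of_term n e d : normalizing n -> es d = es e -> j n.1 d != 0 ->
  j n.2 (gmul e (ginv d)) != 0 -> gunit (pi e).
Proof.
move=> nn de ad bd; have c : es e = er (ginv d) by rewrite er_inv.
have := same_pi (d := ginv (gmul e (ginv d))) nn ad; rewrite ginvK => /(_ bd).
rewrite (er_inv (gmul _ _)) esM // (es_inv d) => /(_ (or_intror erefl)) h.
rewrite -(mulVK (esym de)) piM; last by rewrite esM // es_inv.
suff -> : pi (gmul e (ginv d)) = ginv (pi d) by exact: gunit_src.
by rewrite h pi_inv ginvK.
Qed.

(** By orthogonality all terms of the convolution vanish off the unit space. *)
Lemma compress_diagonal n f : normalizing n -> core f -> diagonal (n.2 ** f ** n.1).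
Proof.
move=> nn cf e nu; have t0 d : es d = es e ->
    j (n.2 ** f) (gmul e (ginv d)) * j n.1 d = 0.
  move=> de; have [-> |ad] := eqVneq (j n.1 d) 0; first by rewrite mulr0.
  rewrite core_mul_r //; have [-> |bd] := eqVneq (j n.2 (gmul e (ginv d))) 0.
    by rewrite !mul0r.
  by case: nu; exact: (unit_of_term nn de ad bd).
have := single (erefl (es e)) (b := n.2 ** f) (a := n.1) (fun d de _ => t0 d de).
by rewrite t0 // => ->.
Qed.

(** By orthogonality only one arrow contributes to b f a at a unit. *)
Lemma compress_ev n f d : normalizing n -> core f -> j n.1 d != 0 -> j n.2 (ginv d) != 0 ->
  ev (n.2 ** f ** n.1) (es d) = ev f (er d) * (j n.2 (ginv d) * j n.1 d).
Proof.
move=> nn cf ad bd.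
have u k : es k = es d -> gmul (tw_unit T (es d)) (ginv k) = ginv k.
  by move=> kd; rewrite -kd -(er_inv k) mul_unit_l.
rewrite /ra_ev (single (d0 := d)); last 2 first.
- by rewrite es_unit.
- move=> k; rewrite es_unit => kd kpd; rewrite u // core_mul_r //.
  have [-> |ak] := eqVneq (j n.1 k) 0; first by rewrite mulr0.
  by case: kpd; apply: (same_pi nn ak bd); left.
by rewrite u // core_mul_r // es_inv -mulrA mulrCA.
Qed.

Lemma compress_ev0 n f x : normalizing n -> core f ->
  (forall d, es d = x -> j n.1 d != 0 -> j n.2 (ginv d) = 0) ->
  ev (n.2 ** f ** n.1) x = 0.
Proof.
move=> nn cf h; rewrite /ra_ev.
have t0 k : es k = es (tw_unit T x) ->
    j (n.2 ** f) (gmul (tw_unit T x) (ginv k)) * j n.1 k = 0.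
  rewrite es_unit => kx; rewrite -[X in tw_unit T X]kx -(er_inv k) mul_unit_l core_mul_r //.
  have [-> |ak] := eqVneq (j n.1 k) 0; first by rewrite mulr0.
  by rewrite h // !mul0r.
have := single (erefl (es (tw_unit T x))) (b := n.2 ** f) (a := n.1) (fun d de _ => t0 d de).
by rewrite t0 // => ->.
Qed.

Lemma normalizing_compress n f : normalizing n -> core_nonneg ev f -> core_nonneg ev (n.2 ** f ** n.1).
Proof.
move=> nn [cf f0]; split; first by apply/coreE; exact: compress_diagonal.
move=> x; have [[d [dx ad bd]]|no] :=
    pselect (exists d, [/\ es d = x, j n.1 d != 0 & j n.2 (ginv d) != 0]).
  by rewrite -dx compress_ev // mulr_ge0 // ltW // normalizing_gt0.
rewrite compress_ev0 // => d dx ad; apply/eqP; apply: contrapT => /negP bd.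
by case: no; exists d.
Qed.

Lemma normalizing_compresses n : normalizing n -> compresses n.
Proof.
move=> nn f ff; split; first exact: normalizing_compress.
exact: (normalizing_compress (normalizing_sharp nn)).
Qed.

(** Topological principality in the topology of the unit space itself, which is
    open in G. *)
Lemma principal_dense (W : set (units G)) x : open W -> W x ->
  exists2 y, W y & trivial_isotropy y.
Proof.
move=> oW Wx; have := princ (unit_valP x).
have oN : open (@gunit G `&` @src0 G @^-1` W).
  by apply: openI; [exact: open_gunit|apply: open_preimage => //; exact: continuous_src0].
move=> /(_ (@gunit G `&` @src0 G @^-1` W)) [].
  by apply: open_nbhs_nbhs; split=> //; split; [exact: unit_valP|rewrite /= src0_unit].
move=> g [[gu tg] [_ Wg]]; exists (src0 g) => // h sh rh.
have sg : unit_val (src0 g) = g by rewrite -gunitE.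
have : ([set k | src k = g] `&` [set k | rng k = g]) h by split; rewrite /= ?sh ?rh.
by rewrite tg sg.
Qed.

(** If s(e) has trivial isotropy, the product a(e) b(d^-1) can be isolated as a
    value of b f a off the unit space, where b f a vanishes. *)
Lemma orthogonal_rng_trivial n e d : compresses n -> trivial_isotropy (es e) ->
  pi e <> pi d -> er e = er d -> j n.1 e * j n.2 (ginv d) = 0.
Proof.
move=> cn te ed r; have c : es (ginv d) = er e by rewrite es_inv.
pose k := gmul (ginv d) e.
have ke : es k = es e by exact: esM.
have nk : ~ gunit (pi k).
  rewrite piM // pi_inv -[pi e]ginvK => h; apply: ed.
  have : ginv (pi d) = ginv (pi e).
    by apply: gmul_divI => //; rewrite !src_inv -!rng0_val -[rng0 (pi e)]/(er e) r.
  by move=> /(congr1 (@ginv G)); rewrite !ginvK.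
apply: nrm0_eq => dl dl0.
have tk : trivial_isotropy (es k) by rewrite ke.
have [f [cf _ ]] := isolate_core Gtop Get GT2 Gcpt p1 x0 n.2 n.1 dl0 tk (esym ke).
have [[/coreE cb _] _] := cn f cf; by rewrite cb // sub0r nrmN /k mulK // mulrC subr0.
Qed.

(** If the product were nonzero, it would stay so for nearby elements over
    distinct arrows with a common range; by density one of these pairs has a
    source with trivial isotropy. *)
Lemma orthogonal_rng n e d : compresses n -> pi e <> pi d -> er e = er d ->
  j n.1 e * j n.2 (ginv d) = 0.
Proof.
move=> cn ed r; apply/eqP; apply: contrapT => /negP; rewrite mulf_eq0 negb_or => /andP[ae bd].
have [P [Q [oP oQ Pe Qd PQ]]] := hausdorff_separate GT2 ed.
pose O2 := [set k | j n.2 (ginv k) != 0] `&` pi @^-1` Q.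
have oO2 : open O2.
  apply: openI; last by apply: open_preimage => //; exact: tw_pi_continuous.
  apply: (@open_neq0 R E (fun k => j n.2 (ginv k))) => k.
  by apply: (@continuous_comp _ _ _ (@ginv E) (j n.2)); [exact: continuous_inv|exact: jcont].
pose O1 := ([set k | j n.1 k != 0] `&` pi @^-1` P) `&` @er R G T @^-1` (@er R G T @` O2).
have oO1 : open O1.
  apply: openI; first apply: openI.
  - exact: open_neq0 (@jcont n.1).
  - by apply: open_preimage => //; exact: tw_pi_continuous.
  apply: open_preimage; first exact: continuous_er.
  have -> : @er R G T @` O2 = @rng0 G @` (pi @` O2).
    by apply/seteqP; split=> [_ [k Ok <-]|_ [_ [k Ok <-] <-]]; [exists (pi k) => //|]; exists k.
  by apply: open_rng0 => //; exact: open_pi.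
have O1e : O1 e by split; [split|exists d].
have [y [k Ok <-] tk] := principal_dense (open_es Gtop Get oO1) (ex_intro2 _ _ e O1e erefl).
have [[ak Pk] [l [bl Ql] lk]] := Ok.
have := orthogonal_rng_trivial cn tk _ (esym lk).
move=> /(_ _) h; have : j n.1 k * j n.2 (ginv l) = 0.
  by apply: h => kl; apply: (PQ (pi k)) => //; rewrite kl.
by move=> /eqP; rewrite mulf_eq0 (negPf ak) (negPf bl).
Qed.

Lemma closed_ge0 : closed [set c : R[i] | 0 <= c].
Proof.
have -> : [set c : R[i] | 0 <= c] =
    (@complex.Re R @^-1` [set t | 0 <= t]) `&` (@complex.Im R @^-1` [set 0]).
  apply/seteqP; split=> [[a b]|[a b] [/= h1 h2]] /=; rewrite ?h2 lecE /= ?eqxx //.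
  by case/andP=> /eqP -> ->.
apply: closedI; apply: (proj1 (continuous_closedP _)).
- exact: continuous_Re.
- exact: closed_ge.
- exact: continuous_Im.
- exact: (closed_point (@norm_hausdorff _ R)).
Qed.

(** At a unit with trivial isotropy the product is isolated as a limit of values
    of b f a at units; in general by density and closedness of the set of
    nonnegative reals. *)
Lemma positive_term n e : compresses n -> 0 <= j n.2 (ginv e) * j n.1 e.
Proof.
move=> cn; apply: contrapT => ne.
pose O := (fun k => j n.2 (ginv k) * j n.1 k) @^-1` (~` [set c : R[i] | 0 <= c]).
have oO : open O.
  apply: open_preimage; last by apply: closed_openC; exact: closed_ge0.
  have c1 : continuous ((fun k => j n.2 (ginv k)) : E -> R[i]).
    move=> k.
    by apply: (@continuous_comp _ _ _ (@ginv E) (j n.2)); [exact: continuous_inv|exact: jcont].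
  exact: (continuous_mulC c1 (@jcont n.1)).
have [y [k Ok <-] tk] := principal_dense (open_es Gtop Get oO) (ex_intro2 _ _ e ne erefl).
apply: Ok; apply: ge0_approx => dl dl0.
have tu : trivial_isotropy (es (tw_unit T (es k))) by rewrite es_unit.
have ku : es k = es (tw_unit T (es k)) by rewrite es_unit.
have [f [cf _ h]] := isolate_core Gtop Get GT2 Gcpt p1 x0 n.2 n.1 dl0 tu ku.
have [[_ bp] _] := cn f cf.
exists (ev (n.2 ** f ** n.1) (es k)); split; first exact: bp.
by move: h; rewrite -[in X in gmul X _](er_inv k) mul_unit_l.
Qed.

(** Compression of the positive functions is a condition on the values of the two
    functions. Topological principality is used for the direct implication. *)
Lemma compressesP n : compresses n <-> normalizing n.
Proof.
split=> [cn|]; last exact: normalizing_compresses.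
split=> [e d ed [s|r]|e]; [|exact: orthogonal_rng|exact: positive_term].
rewrite mulrC -[X in j n.1 X]ginvK.
apply: (orthogonal_rng (compresses_sharp cn)); last by rewrite !er_inv.
by rewrite !pi_inv => /(congr1 (@ginv G)); rewrite !ginvK => /esym.
Qed.

Lemma bisection_ofP n e :
  bisection_of n (pi e) <-> j n.1 e != 0 /\ j n.2 (ginv e) != 0.
Proof.
split=> [h|[ae be] d de]; first exact: h.
have [z ->] := pi_eq_act (esym de).
by rewrite jinv_act jact !mulf_neq0 // ?circle_neq0 // circle_valJ invr_eq0 circle_neq0.
Qed.

Lemma open_bisection_of n : open (bisection_of n).
Proof.
have -> : bisection_of n =
    pi @` ([set e | j n.1 e != 0] `&` [set e | j n.2 (ginv e) != 0]).
  apply/seteqP; split=> [g Bg|_ [e [ae be] <-]]; last exact/bisection_ofP.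
  by have [e eg] := @pi_surj R G T g; exists e => //; move: Bg; rewrite -eg => /bisection_ofP.
apply: open_pi => //; apply: openI; first exact: open_neq0 (@jcont n.1).
apply: (@open_neq0 R E (fun k => j n.2 (ginv k))) => k.
by apply: (@continuous_comp _ _ _ (@ginv E) (j n.2)); [exact: continuous_inv|exact: jcont].
Qed.

Lemma bisection_src_inj n g h : normalizing n -> bisection_of n g -> bisection_of n h ->
  src0 g = src0 h -> g = h.
Proof.
move=> nn; have [e <-] := @pi_surj R G T g; have [d <-] := @pi_surj R G T h.
move=> /bisection_ofP[ae _] /bisection_ofP[_ bd] ed.
by apply: (same_pi nn ae bd); left.
Qed.

Lemma bisection_rng_inj n g h : normalizing n -> bisection_of n g -> bisection_of n h ->
  rng0 g = rng0 h -> g = h.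
Proof.
move=> nn; have [e <-] := @pi_surj R G T g; have [d <-] := @pi_surj R G T h.
move=> /bisection_ofP[ae _] /bisection_ofP[_ bd] ed.
by apply: (same_pi nn ae bd); right.
Qed.

Lemma bisection_sharp n g : bisection_of (pair_sharp n) (ginv g) <-> bisection_of n g.
Proof.
have [e <-] := @pi_surj R G T g; rewrite -pi_inv.
by rewrite !bisection_ofP /= ginvK; split=> -[].
Qed.

Lemma pair_dom_over n g : normalizing n -> bisection_of n g -> pair_dom ev n (src0 g).
Proof.
move=> nn; have [e <-] := @pi_surj R G T g => /bisection_ofP[ae be].
have := compress_ev nn (core_one Gtop Get GT2 Gcpt p1 A x0) ae be.
rewrite ev_one // mul1r ba_mul1r /pair_dom /= => ->; exact: normalizing_gt0.
Qed.

Lemma pair_domP n x : normalizing n ->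
  pair_dom ev n x <-> exists2 g, bisection_of n g & src0 g = x.
Proof.
move=> nn; split=> [dx|[g Bg <-]]; last exact: pair_dom_over.
have [[d [dx' ad bd]]|no] :=
    pselect (exists d, [/\ es d = x, j n.1 d != 0 & j n.2 (ginv d) != 0]).
  by exists (pi d) => //; exact/bisection_ofP.
have := compress_ev0 nn (core_one Gtop Get GT2 Gcpt p1 A x0) (x := x).
rewrite ba_mul1r => h; move: dx; rewrite /pair_dom /= h ?ltxx // => d dx ad.
by apply/eqP; apply: contrapT => /negP bd; case: no; exists d.
Qed.

Lemma pair_codP n y : normalizing n ->
  pair_cod ev n y <-> exists2 g, bisection_of n g & rng0 g = y.
Proof.
move=> nn; rewrite -[pair_cod ev n y]/(pair_dom ev (pair_sharp n) y).
rewrite (pair_domP _ (normalizing_sharp nn)); split=> [[g Bg gy]|[g Bg gy]].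
  by exists (ginv g); rewrite ?rng0_inv // -bisection_sharp ginvK.
by exists (ginv g); rewrite ?src0_inv // bisection_sharp.
Qed.

Definition traces n (alpha : partial_map (units G)) : Prop :=
  pdom alpha = pair_dom ev n /\ forall g, bisection_of n g -> alpha (src0 g) = rng0 g.

Lemma traces_cod n alpha : normalizing n -> traces n alpha -> pcod alpha = pair_cod ev n.
Proof.
move=> nn [dn an]; apply/seteqP; split=> [_ [x + <-]|y /(pair_codP _ nn)[g Bg <-]].
  rewrite dn => /(pair_domP _ nn)[g Bg <-]; apply/(pair_codP _ nn).
  by exists g => //; rewrite an.
by exists (src0 g); [rewrite dn; exact: pair_dom_over|exact: an].
Qed.

Lemma open_pair_dom n : normalizing n -> open (pair_dom ev n).
Proof.
move=> nn; suff -> : pair_dom ev n = @src0 G @` bisection_of n.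
  by apply: open_src0 => //; exact: open_bisection_of.
by apply/seteqP; split=> x; rewrite pair_domP // => -[g Bg gx]; exists g.
Qed.

(** The source and range maps are homeomorphisms from the bisection onto its
    sources and ranges. *)
Lemma traces_homeo n alpha : normalizing n -> traces n alpha -> partial_homeo alpha.
Proof.
move=> nn tr; have [dn an] := tr; have cn := traces_cod nn tr.
have im (W : set (units G)) : open W ->
    open (alpha @` (pdom alpha `&` W)) /\ open (pdom alpha `&` alpha @^-1` W).
  move=> oW; have oB := @open_bisection_of n.
  have -> : alpha @` (pdom alpha `&` W) = @rng0 G @` (bisection_of n `&` @src0 G @^-1` W).
    apply/seteqP; split=> [_ [x [+ Wx] <-]|_ [g [Bg Wg] <-]].
      rewrite dn => /(pair_domP _ nn)[g Bg gx]; subst x; exists g; first by split.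
      by rewrite an.
    by exists (src0 g); [split=> //; rewrite dn; exact: pair_dom_over|exact: an].
  have -> : pdom alpha `&` alpha @^-1` W = @src0 G @` (bisection_of n `&` @rng0 G @^-1` W).
    apply/seteqP; split=> [x [+ Wx]|_ [g [Bg Wg] <-]].
      rewrite dn => /(pair_domP _ nn)[g Bg gx]; subst x; exists g => //.
      by split=> //=; rewrite -an.
    by split; [rewrite dn; exact: pair_dom_over|rewrite /= an].
  by split; [apply: open_rng0|apply: open_src0] => //; apply: openI => //;
    apply: open_preimage => //; [exact: continuous_src0|exact: continuous_rng0].
have od : open (pdom alpha) by rewrite dn; exact: open_pair_dom.
split=> //; first by have [+ _] := im _ openT; rewrite setIT.
split; first split.
- by move=> x dx; exists x.
- move=> x y /set_mem + /set_mem; rewrite dn.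
  move=> /(pair_domP _ nn)[g Bg <-] /(pair_domP _ nn)[h Bh <-].
  by rewrite !an // => /(bisection_rng_inj nn Bg Bh) ->.
- by [].
- rewrite continuous_open_subspace // => x /set_mem dx W /nbhs_open[V [oV Vx VW]].
  have [_ oP] := im _ oV.
  have : nbhs x (pdom alpha `&` alpha @^-1` V) by apply: open_nbhs_nbhs.
  have Fx : Filter (nbhs x) by exact: nbhs_filter.
  by apply: (@filterS _ _ Fx) => y [_ /VW].
- move=> W oW; have [oI _] := im _ oW; exists (alpha @` (pdom alpha `&` W)) => //.
  by apply/seteqP; split=> [y [x [dx Wx] <-]|y []] //; split; exists x.
Qed.

Lemma pinverse_traces n alpha g : normalizing n -> traces n alpha -> bisection_of n g ->
  pinverse alpha (rng0 g) = src0 g.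
Proof.
move=> nn [dn an] Bg; rewrite /pinverse /=; case: xgetP => [x _ [+ ax]|/(_ (src0 g)) []].
  move: ax; rewrite dn => + /(pair_domP _ nn)[h Bh hx]; rewrite -hx an // => hg.
  by rewrite (bisection_rng_inj nn Bh Bg hg).
by split; [rewrite dn; exact: pair_dom_over|exact: an].
Qed.

(** The commutation relation that defines the map of an admissible pair, computed
    on its bisection. *)
Lemma compress_over n f g : normalizing n -> core f -> bisection_of n g ->
  ev (n.2 ** f ** n.1) (src0 g) = ev f (rng0 g) * ev (n.2 ** n.1) (src0 g).
Proof.
move=> nn cf; have [e <-] := @pi_surj R G T g => /bisection_ofP[ae be].
have := compress_ev nn (core_one Gtop Get GT2 Gcpt p1 A x0) ae be.
rewrite ev_one // mul1r ba_mul1r => h.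
by rewrite -[src0 _]/(es e) compress_ev // h.
Qed.

(** The maps realized by n are those that follow its bisection: the commutation
    relation of n at x, tested on a bump function at alpha(x), forces alpha(x) to
    be the range of the arrow over x. *)
Lemma realizesP n alpha : realizes ev n alpha <-> normalizing n /\ traces n alpha.
Proof.
case: n => a b; split=> [|[nn tr]].
  move=> [[_ oc _] /(compressesP (a, b)) nn [dn cn] h4 _]; split=> //; split=> // g Bg.
  have dg : pair_dom ev (a, b) (src0 g) by exact: pair_dom_over.
  apply: contrapT => ne.
  have oW : open (pcod alpha `&` ~` [set rng0 g]).
    by apply: openI => //; apply: closed_openC; apply: closed_point; exact: hausdorff_units.
  have Wx : (pcod alpha `&` ~` [set rng0 g]) (alpha (src0 g)).
    by split=> //; exists (src0 g) => //; rewrite dn.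
  have [f [[cf f0] f1 fW]] := core_bump Gtop Get GT2 Gcpt p1 A x0 oW Wx.
  have cc : core_c0 ev (pcod alpha) f by split=> // y ny; apply: fW => -[].
  have := h4 (src0 g) f; rewrite dn => /(_ dg cc).
  have f2 : ev f (rng0 g) = 0 by apply: fW => -[_]; exact.
  rewrite f1 mul1r (compress_over nn cf Bg) f2 mul0r.
  by move=> h; move: dg; rewrite /pair_dom /= h ltxx.
have cn := traces_cod nn tr; have ph := traces_homeo nn tr; have [dn an] := tr.
split=> //; first exact: ((compressesP (a, b)).2 nn).
- move=> x f; rewrite dn => /(pair_domP _ nn)[g Bg <-] [cf _].
  by rewrite an // (compress_over nn cf Bg).
- move=> y f; rewrite cn => /(pair_codP _ nn)[g Bg <-] [cf _].
  rewrite (pinverse_traces nn tr Bg).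
  have := compress_over (normalizing_sharp nn) cf ((bisection_sharp (a, b) g).2 Bg).
  by rewrite src0_inv rng0_inv.
Qed.

(** * The element of the twist represented by a pair over a unit *)

(** The positivity conditions normalize the phase: over each arrow of the
    bisection of n exactly one element of the twist satisfies them. *)
Definition represents n e : Prop := 0 < j n.1 e /\ 0 < j n.2 (ginv e).

Lemma represents_bisection n e : represents n e -> bisection_of n (pi e).
Proof. by move=> [ae be]; apply/bisection_ofP; rewrite !gt_eqF. Qed.

Lemma represents_dom n e : normalizing n -> represents n e -> pair_dom ev n (es e).
Proof. by move=> nn /represents_bisection; exact: pair_dom_over. Qed.

(** Multiply e by the unit number that makes a(e) positive; then b(e^-1) is
    positive too, since the product of the two is. *)
Lemma exists_represents n g : normalizing n -> bisection_of n g ->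
  exists2 e, pi e = g & represents n e.
Proof.
move=> nn; have [e <-] := @pi_surj R G T g => /bisection_ofP[ae be].
have h : `|conjc (j n.1 e) / (nrm (j n.1 e))%:C| = 1.
  rewrite nrmE cabsM cabsJ cabsV cabsR ger0_norm ?nrm_ge0 // mulfV //.
  by rewrite nrm_eq0.
pose z := mk_circle h; exists (tw_act z e); first exact: pi_act.
have a0 : 0 < j n.1 (tw_act z e).
  rewrite jact [circle_val z]/(conjc _ / _) mulrAC [conjc _ * _]mulrC mulcJ.
  by rewrite divr_gt0 // ltcR ?exprn_gt0 ?nrm_gt0.
have nz : j n.2 (ginv (tw_act z e)) != 0.
  by rewrite jinv_act mulf_neq0 // circle_valJ invr_eq0 circle_neq0.
split=> //; have := normalizing_gt0 nn (lt0r_neq0 a0) nz.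
by rewrite pmulr_lgt0.
Qed.

Lemma circle_pos (z : circle R) (c : R[i]) : 0 < c -> 0 < circle_val z * c -> z = circle_one.
Proof.
move=> c0 zc; apply: circle_val_inj; apply: (mulIf (lt0r_neq0 c0)).
rewrite mul1r (gtc0_cabs zc) [RHS](gtc0_cabs c0); congr (_%:C).
by rewrite cabsM cabs_circle mul1r.
Qed.

(** Over a unit of the domain a vanishes off one coset of the circle, where
    positivity determines the phase. *)
Lemma represents_only n e d : normalizing n -> represents n e -> es d = es e -> 0 < j n.1 d -> d = e.
Proof.
move=> nn [ae be] de ad.
have [z ez] := pi_eq_act (same_pi nn (lt0r_neq0 ad) (lt0r_neq0 be) (or_introl de)).
move: ae; rewrite ez jact => /(circle_pos ad) ->.
by rewrite act1.
Qed.

(** As m.1 vanishes on E_x off one coset, one term of the convolution survives. *)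
Lemma cross_mul n m e k : normalizing m -> bisection_of m (pi k) -> es e = es k ->
  j (n.2 ** m.1) e = j n.2 (gmul e (ginv k)) * j m.1 k.
Proof.
move=> nm /bisection_ofP[ck dk] ek; apply: single => // d de dk'.
have [-> |cd] := eqVneq (j m.1 d) 0; first by rewrite mulr0.
by case: dk'; apply: (same_pi nm cd dk); left; rewrite de.
Qed.

Lemma cross_ev n m k : normalizing m -> bisection_of m (pi k) ->
  ev (n.2 ** m.1) (es k) = j n.2 (ginv k) * j m.1 k.
Proof.
move=> nm mk; rewrite /ra_ev (@cross_mul n m _ k) ?es_unit //.
by rewrite -[in X in gmul X _](er_inv k) mul_unit_l.
Qed.

(** Over the units where h does not vanish the two bisections coincide, so the
    product of the second half of one pair with the first half of the other is
    supported over units there. *)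
Lemma cross_core n m h : normalizing n -> normalizing m -> core h ->
  (forall y, ~ (exists g, [/\ bisection_of n g, bisection_of m g & src0 g = y]) ->
     ev h y = 0) ->
  core (n.2 ** m.1 ** h).
Proof.
move=> nn nm ch h0; apply/coreE => e nu; rewrite core_mul_r //.
have [[g [Bn Bm ge]]|no] :=
    pselect (exists g, [/\ bisection_of n g, bisection_of m g & src0 g = es e]);
  last by rewrite h0 ?mulr0.
have [k gk] := @pi_surj R G T g; rewrite -gk in Bn Bm ge.
rewrite (cross_mul n nm Bm (esym ge)); have [ak bk] := (bisection_ofP n k).1 Bn.
have [-> |bd] := eqVneq (j n.2 (gmul e (ginv k))) 0; first by rewrite !mul0r.
by case: nu; exact: (unit_of_term nn ge ak bd).
Qed.

(** Two pairs are equivalent over a unit exactly when they represent the same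
    element of the twist. If n = (a, b) and m = (c, d) do, then f = b c h and g =
    b a h belong to the core when the bump h is supported where the two bisections
    coincide, and a f = c g. *)
Lemma weyl_equivP n m e d : normalizing n -> normalizing m -> represents n e -> represents m d ->
  es e = es d -> weyl_equiv ev n m (es e) <-> e = d.
Proof.
move=> nn nm re rd ed; split=> [[f [g [cf cg f0 g0 fg]]]|{}ed].
  apply: (represents_only nm rd ed).
  have := congr1 (fun a => j a e) fg; rewrite /= !core_mul_r // => h.
  by have := mulr_gt0 (proj1 re) f0; rewrite h pmulr_lgt0.
subst d; pose O := @src0 G @` (bisection_of n `&` bisection_of m).
have oO : open O.
  by apply: open_src0 => //; apply: openI; exact: open_bisection_of.
have Bn := represents_bisection re; have Bm := represents_bisection rd.
have Oe : O (es e) by exists (pi e).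
have [h [[ch _] h1 hO]] := core_bump Gtop Get GT2 Gcpt p1 A x0 oO Oe.
have cf : core (n.2 ** m.1 ** h).
  by apply: cross_core => // y no; apply: hO => -[g [? ?] gy]; apply: no; exists g.
have cg : core (n.2 ** n.1 ** h).
  by apply: cross_core => // y no; apply: hO => -[g [? ?] gy]; apply: no; exists g.
have evE q y : ev (q ** h) y = ev q y * ev h y.
  by rewrite {1}/ra_ev core_mul_r // es_unit.
(* The identity a (b c h) = c (b a h) holds because over O all four
    functions live on one bisection. *)
exists (n.2 ** m.1 ** h), (n.2 ** n.1 ** h); split=> //.
- by rewrite evE h1 mulr1 cross_ev // mulr_gt0 //; [case: re|case: rd].
- by rewrite evE h1 mulr1 cross_ev // mulr_gt0 //; case: re.
apply: (fun_inj Gtop Get GT2 Gcpt p1) => k; rewrite !core_mul_r // !evE.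
have [Ok|nO] := pselect (O (es k)); last by rewrite hO // !mulr0.
have [g [Gn Gm] gk] := Ok; have [l gl] := @pi_surj R G T g; subst g.
rewrite -gk -[src0 _]/(es l) !cross_ev // !mulrA; congr (_ * _).
have [al bl] := (bisection_ofP n l).1 Gn; have [cl dl] := (bisection_ofP m l).1 Gm.
have [pkl|nkl] := pselect (pi l = pi k).
  by have [z ->] := pi_eq_act pkl; rewrite !jact; ring.
have -> : j n.1 k = 0.
  apply/eqP; apply: contrapT => /negP ak; apply: nkl; apply/esym.
  by apply: (same_pi nn ak bl); left.
have -> : j m.1 k = 0.
  apply/eqP; apply: contrapT => /negP ak; apply: nkl; apply/esym.
  by apply: (same_pi nm ak dl); left.
by rewrite !mul0r.
Qed.

Lemma core_nonneg_one : core_nonneg ev (ba_one A).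
Proof. by split=> [|x]; [exact: core_one|rewrite ev_one // ler01]. Qed.

Lemma compresses_mul n m : compresses n -> compresses m -> compresses (pair_mul n m).
Proof.
move=> cn cm f ff /=; rewrite !ba_mulA.
have [f1 _] := cn f ff; have [_ f2] := cm f ff.
have [h1 _] := cm _ f1; have [_ h2] := cn _ f2.
by split; [move: h1|move: h2]; rewrite !ba_mulA.
Qed.

Lemma normalizing_mul n m : normalizing n -> normalizing m -> normalizing (pair_mul n m).
Proof. by rewrite -!compressesP; exact: compresses_mul. Qed.

Lemma represents_sharp n e : represents n e -> represents (pair_sharp n) (ginv e).
Proof. by move=> [ae be]; split; rewrite /= ?ginvK. Qed.

(** By orthogonality one term of each convolution survives, and it is a product of
    positive numbers. *)
Lemma represents_mul n m e d : normalizing n -> normalizing m -> represents n e -> represents m d ->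
  es e = er d -> represents (pair_mul n m) (gmul e d).
Proof.
move=> nn nm re rd ed; have [ae be] := re; have [cd dd] := rd; split=> /=.
  have Bm := represents_bisection rd.
  have := @cross_mul (pair_sharp n) m (gmul e d) d nm Bm; rewrite /= esM // => -> //.
  by rewrite mulK // mulr_gt0.
have Bn : bisection_of (pair_sharp n) (pi (ginv e)).
  by rewrite pi_inv; apply/bisection_sharp; exact: represents_bisection.
have := @cross_mul m (pair_sharp n) (ginv (gmul e d)) (ginv e) (normalizing_sharp nn) Bn.
rewrite /= es_inv erM // es_inv => -> //.
by rewrite invM // mulK ?mulr_gt0 // es_inv er_inv.
Qed.

Lemma pair_dom_represents n x : normalizing n -> pair_dom ev n x ->
  exists2 e, represents n e & es e = x.
Proof.
move=> nn /(pair_domP _ nn)[g Bg <-].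
by have [e <- re] := exists_represents nn Bg; exists e.
Qed.

(** Apply the compression formula of m to the function b a of the pair n: it is
    positive at x only if x is in the domain of m and its image in the domain of
    n. *)
Lemma pair_dom_mul n m x : normalizing n -> normalizing m -> pair_dom ev (pair_mul n m) x ->
  exists e d, [/\ represents n e, represents m d, es e = er d & es d = x].
Proof.
move=> nn nm; rewrite /pair_dom /= ba_mulA -[X in ev (X ** _) x]ba_mulA.
have [cb b0] := normalizing_compress nn core_nonneg_one; rewrite ba_mul1r in cb b0 => dx.
have [[d [dx' cd dd]]|no] :=
    pselect (exists d, [/\ es d = x, j m.1 d != 0 & j m.2 (ginv d) != 0]); last first.
  move: dx; rewrite compress_ev0 ?ltxx // => d dx' cd.
  by apply/eqP; apply: contrapT => /negP dd; case: no; exists d.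
have Bm : bisection_of m (pi d) by exact/bisection_ofP.
have [d' pd rd] := exists_represents nm Bm.
move: dx; rewrite -dx' compress_ev // => h.
have dn : pair_dom ev n (er d).
  rewrite /pair_dom /= lt_def b0 andbT.
  by apply: contraTneq h => ->; rewrite mul0r ltxx.
have [e re ee] := pair_dom_represents nn dn.
by exists e, d'; split=> //; [rewrite ee /er pd|rewrite /es pd].
Qed.

Lemma traces_represents n alpha e : traces n alpha -> represents n e ->
  alpha (es e) = er e.
Proof. by move=> [_ an] re; exact/an/represents_bisection. Qed.

(** The bisection of a product of pairs is the product of the bisections. *)
Lemma traces_mul n m alpha beta : normalizing n -> normalizing m -> traces n alpha -> traces m beta ->
  traces (pair_mul n m) (Defs.pcomp alpha beta).
Proof.
move=> nn nm tn tm; have nnm := normalizing_mul nn nm; split.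
  apply/seteqP; split=> [x [/= + ]|x /(pair_dom_mul nn nm)[e [d [re rd ed <-]]]].
    rewrite (proj1 tm) => /(pair_dom_represents nm)[d rd <-].
    rewrite (traces_represents tm rd) (proj1 tn) => /(pair_dom_represents nn)[e re ed].
    rewrite -(esM ed); apply: represents_dom => //; exact: represents_mul.
  split=> /=; first by rewrite (proj1 tm); exact: represents_dom.
  by rewrite (traces_represents tm rd) (proj1 tn) -ed; exact: represents_dom.
move=> g Bg /=; have := pair_dom_over nnm Bg.
move=> /(pair_dom_mul nn nm)[e [d [re rd ed dg]]].
have B := represents_bisection (represents_mul nn nm re rd ed).
have <- : pi (gmul e d) = g.
  by apply: (bisection_src_inj nnm B Bg); rewrite -dg -[LHS]/(es (gmul e d)) esM.
rewrite -[src0 _]/(es _) -[rng0 _]/(er _) esM // erM //.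
by rewrite (traces_represents tm rd) -ed (traces_represents tn re).
Qed.

Lemma traces_sharp n alpha : normalizing n -> traces n alpha ->
  traces (pair_sharp n) (pinverse alpha).
Proof.
move=> nn tn; split; first by rewrite /= (traces_cod nn tn).
move=> g Bg; have := @pinverse_traces n alpha (ginv g) nn tn.
rewrite rng0_inv src0_inv => h; apply: h.
by apply/(bisection_sharp n (ginv g)); rewrite ginvK.
Qed.

Definition pair_map n : partial_map (units G) := PartialMap (pair_dom ev n)
  (fun x => xget x [set y | exists g, [/\ bisection_of n g, src0 g = x & rng0 g = y]]).

Lemma traces_pair_map n : normalizing n -> traces n (pair_map n).
Proof.
move=> nn; split=> // g Bg /=; case: xgetP => [y _ [h [Bh hg <-]]|/(_ (rng0 g)) []].
  by rewrite (bisection_src_inj nn Bh Bg hg).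
by exists g.
Qed.

Lemma admissibleP n : admissible ev n <-> normalizing n.
Proof.
split=> [[alpha /realizesP[]] //|nn]; exists (pair_map n).
by apply/realizesP; split=> //; exact: traces_pair_map.
Qed.

Lemma normalizing_scale z n : normalizing n -> normalizing (pair_scale z n).
Proof.
have zE e (q : A) k : j (k *: q) e = k * j q e by rewrite fun_scale.
move=> [on pn]; split=> [e d ed h|e] /=.
  by rewrite !zE mulrACA on // mulr0.
by rewrite !zE mulrACA [conjc _ * _]mulrC circle_valMJ mul1r; exact: pn.
Qed.

(** Take the pair (f, star f) for a function f of Sigma_c supported over a
    bisection, with f(e) = 1. *)
Lemma exists_normalizing e : exists2 n, normalizing n & represents n e.
Proof.
have [U [f [[oU rU sU] [_ Ue] sf fe fU]]] :=
  exists_bisection_fun Gtop Get GT2 Gcpt (@openT (units G)) (I : setT (es e)) (@openT G) (I : setT (pi e)).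
have sf' := Sigma_star sf.
have j1 d : j (ra_in A f) d = f d by exact: fun_in.
have j2 d : j (ra_in A (fun d => conjc (f (ginv d)))) (ginv d) = conjc (f d).
  by rewrite fun_in // ginvK.
exists (ra_in A f, ra_in A (fun d => conjc (f (ginv d)))).
  split=> [k l kl h|k] /=; rewrite j1 j2; last first.
    by rewrite mulrC mulcJ ler0c sqr_ge0.
  apply/eqP; apply: contrapT => /negP; rewrite mulf_eq0 conjc_eq0 negb_or => /andP[fk fl].
  have [Uk _] := fU _ fk; have [Ul _] := fU _ fl; apply: kl.
  by case: h => h; [apply: sU|apply: rU] => //; exact: mem_set.
by split; rewrite /= ?j1 ?j2 fe ?conjc1 ltr01.
Qed.

Lemma gunit_inv (g : G) : gunit g -> gunit (ginv g).
Proof.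
by case=> h _ <-; rewrite /rng ginvM ?rng_inv // ginvK; exact: gunit_rng.
Qed.

(** A function in the core is supported over units, which are determined by their
    source or range. *)
Lemma core_conj_normalizing f f' : core_conj ev f f' -> normalizing (f, f').
Proof.
move=> [/coreE df /coreE df' ff'].
split=> [k l kl h|k] /=.
  have [uk|nk] := pselect (gunit (pi k)); last by rewrite df ?mul0r.
  have [ul|nl] := pselect (gunit (pi (ginv l))); last by rewrite df' ?mulr0.
  case: kl; have ul' : gunit (pi l).
    by move: ul; rewrite pi_inv => /gunit_inv; rewrite ginvK.
  rewrite (gunitE uk) (gunitE ul'); congr unit_val; case: h => // h.
  by move: h; rewrite /er (gunitE uk) (gunitE ul') !rng0_unit !src0_unit.
have [uk|nk] := pselect (gunit (pi k)); last by rewrite df ?mulr0.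
have [z ->] := pi_unitP uk; rewrite tw_i_inv !tw_i_act !jact.
rewrite -[j f' _]/(ev f' (es k)) -[j f _]/(ev f (es k)) ff' circle_invE -circle_valJ.
by rewrite mulrACA [conjc _ * _]mulrC circle_valMJ mul1r mulrC mulcJ ler0c sqr_ge0.
Qed.

(** Here the convention f(z . e) = z f(e) forces f(x) to be the conjugate of z. *)
Lemma core_conj_represents f f' x z : core_conj ev f f' -> ev f x = conjc (circle_val z) ->
  represents (f, f') (tw_i T (x, z)).
Proof.
move=> [_ _ ff'] fx; split; rewrite /= ?tw_i_inv tw_i_act jact.
  by rewrite -[j f _]/(ev f x) fx circle_valMJ ltr01.
rewrite -[j f' _]/(ev f' x) ff' fx conjcK circle_invE mulVf ?ltr01 //.
exact: circle_neq0.
Qed.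

(** * Germs and arrows *)

(** If the bisections of n and m passed through distinct arrows over a unit x,
    nearby arrows would stay apart; but at a nearby unit with trivial isotropy the
    arrows over it have the same range, hence are equal. *)
Lemma traces_agree n m alpha beta g h : normalizing n -> normalizing m ->
  traces n alpha -> traces m beta -> bisection_of n g -> bisection_of m h ->
  src0 h = src0 g -> (\forall w \near src0 g, alpha w = beta w) -> g = h.
Proof.
move=> nn nm [_ an] [_ bm] Bg Bh hg /nbhs_open[W [oW Wg WE]].
apply: contrapT => /(hausdorff_separate GT2)[P [Q [oP oQ Pg Qh PQ]]].
pose S := @src0 G @` (bisection_of n `&` P) `&` @src0 G @` (bisection_of m `&` Q) `&` W.
have oS : open S.
  by apply: openI => //; apply: openI; apply: open_src0 => //; apply: openI => //;
    exact: open_bisection_of.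
have Sg : S (src0 g) by split=> //; split; [exists g|exists h].
have [y [[[g' [Bg' Pg'] <-] [h' [Bh' Qh'] hg']] Wy] ty] := principal_dense oS Sg.
apply: (PQ g' Pg'); suff -> : g' = h' by [].
apply: (trivial_isotropy_inj ty) => //.
by rewrite -an // -bm // hg'; exact: WE.
Qed.

Lemma traces_near n m alpha beta g : normalizing n -> normalizing m ->
  traces n alpha -> traces m beta -> bisection_of n g -> bisection_of m g ->
  \forall w \near src0 g, [/\ pdom alpha w, pdom beta w & alpha w = beta w].
Proof.
move=> nn nm [dn an] [dm bm] Bg Bg'.
have oW : open (@src0 G @` (bisection_of n `&` bisection_of m)).
  by apply: open_src0 => //; apply: openI; exact: open_bisection_of.
have Fx : Filter (nbhs (src0 g)) by exact: nbhs_filter.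
apply: (@filterS _ _ Fx (@src0 G @` (bisection_of n `&` bisection_of m))).
  move=> _ [h [Bh Bh'] <-]; rewrite dn dm an // bm //.
  by split=> //; exact: pair_dom_over.
by apply: open_nbhs_nbhs; split=> //; exists g.
Qed.

Lemma germ_sub (alpha beta : partial_map (units G)) x :
  (\forall w \near x, [/\ pdom alpha w, pdom beta w & alpha w = beta w]) ->
  germ ev alpha x `<=` germ ev beta x.
Proof.
move=> ab q [rq dq qx aq]; split=> //.
have Fx : Filter (nbhs x) by exact: nbhs_filter.
apply: (@filterS2 _ _ Fx _ _ _ _ ab aq) => w [_ bw ->] [_ ? ->].
by [].
Qed.

(** A germ of a realized map amounts to an arrow of G. Topological principality
    enters through the direct implication: germs remember only the map on units. *)
Lemma germ_eq n m alpha beta g h : realizes ev n alpha -> realizes ev m beta ->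
  bisection_of n g -> bisection_of m h ->
  germ ev alpha (src0 g) = germ ev beta (src0 h) <-> g = h.
Proof.
move=> rn rm Bg Bh.
have [nn tn] := (realizesP n alpha).1 rn; have [nm tm] := (realizesP m beta).1 rm.
split=> [e|gh].
  have : germ ev beta (src0 h) (beta, src0 h).
    split=> //=; [by exists m|by rewrite (proj1 tm); exact: pair_dom_over|].
    have Fx : Filter (nbhs (src0 h)) by exact: nbhs_filter.
    by apply: (@filterS _ _ Fx _ _ _ (traces_near nm nm tm tm Bh Bh)) => w [].
  rewrite -e => -[_ _ /= hg near]; apply: (traces_agree nn nm tn tm Bg Bh hg).
  have Fx : Filter (nbhs (src0 g)) by exact: nbhs_filter.
  by apply: (@filterS _ _ Fx _ _ _ near) => w [].
subst h; apply/seteqP; split; apply: germ_sub.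
  exact: (traces_near nn nm tn tm Bg Bh).
exact: (traces_near nm nn tm tn Bh Bg).
Qed.

Lemma germ_over (u : ra_weyl_groupoid A) : exists g, exists n alpha,
  [/\ realizes ev n alpha, bisection_of n g & germ_val u = germ ev alpha (src0 g)].
Proof.
have [alpha [x [[n rn] dx ux]]] := set_valP u.
have [nn tn] := (realizesP n alpha).1 rn.
move: dx; rewrite (proj1 tn) => /(pair_domP _ nn)[g Bg gx].
by exists g, n, alpha; split=> //; rewrite gx.
Qed.

(** The arrow of the bisection of n over x, for any n and alpha presenting the
    germ. *)
Definition theta (u : ra_weyl_groupoid A) : G := projT1 (cid (germ_over u)).

Lemma thetaE u g n alpha : realizes ev n alpha -> bisection_of n g ->
  germ_val u = germ ev alpha (src0 g) -> theta u = g.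
Proof.
move=> rn Bg ug; rewrite /theta; case: cid => h [m [beta [rm Bh uh]]] /=.
by apply/(germ_eq rm rn Bh Bg); rewrite -uh.
Qed.

Lemma theta_germ u n alpha : realizes ev n alpha -> bisection_of n (theta u) ->
  germ_val u = germ ev alpha (src0 (theta u)).
Proof.
move=> rn; rewrite /theta; case: cid => h [m [beta [rm Bh uh]]] /= Bn.
by rewrite uh; apply/(germ_eq rm rn Bh Bn).
Qed.

Lemma theta_over u : exists n, normalizing n /\ bisection_of n (theta u).
Proof.
have [g [n [alpha [rn Bg ug]]]] := germ_over u; exists n.
by split; [exact: (proj1 ((realizesP n alpha).1 rn))|rewrite (thetaE rn Bg ug)].
Qed.

Lemma realizes_pair_map n : normalizing n -> realizes ev n (pair_map n).
Proof. by move=> nn; apply/realizesP; split=> //; exact: traces_pair_map. Qed.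

Lemma exists_theta g : exists u, theta u = g.
Proof.
have [e eg] := @pi_surj R G T g; have [n nn re] := exists_normalizing e.
have Bg : bisection_of n g by rewrite -eg; exact: represents_bisection.
have rn := realizes_pair_map nn.
have h : exists alpha x, [/\ realizable ev alpha, pdom alpha x &
    germ ev (pair_map n) (src0 g) = germ ev alpha x].
  by exists (pair_map n), (src0 g); split=> //; [exists n|exact: pair_dom_over].
exists (exist _ (germ ev (pair_map n) (src0 g)) (mem_set h)).
exact: (thetaE rn Bg).
Qed.

Lemma theta_inj : injective theta.
Proof.
move=> u v uv; have [n [nn Bu]] := theta_over u; have rn := realizes_pair_map nn.
have hu := theta_germ rn Bu; rewrite uv in Bu; have hv := theta_germ rn Bu.
by apply: val_inj; rewrite -[LHS]/(germ_val u) -[RHS]/(germ_val v) hu hv uv.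
Qed.

(** Existence of a pair whose bisection contains g comes from functions supported
    over bisections. *)
Definition theta_inv g : ra_weyl_groupoid A := projT1 (cid (exists_theta g)).

Lemma theta_invK : cancel theta_inv theta.
Proof. by move=> g; rewrite /theta_inv; case: cid. Qed.

Lemma thetaK : cancel theta theta_inv.
Proof. by move=> u; apply: theta_inj; rewrite theta_invK. Qed.

(** The preimage of a basic open set of germs is the part of a bisection over an
    open set of units. *)
Lemma continuous_theta_inv : continuous theta_inv.
Proof.
apply: (generates_continuous (@germ_generates R A (units G) ev)) => S0.
move=> [alpha [U [[n rn] oU Ud ->]]].
have [nn tn] := (realizesP n alpha).1 rn; rewrite (proj1 tn) in Ud.
set S := _ @^-1` _; suff -> : S = bisection_of n `&` @src0 G @^-1` U.
  apply: openI; first exact: open_bisection_of.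
  by apply: open_preimage => //; exact: continuous_src0.
apply/seteqP; split=> [g [x Ux gx]|g [Bg Ug]].
  have [h Bh hx] := (pair_domP x nn).1 (Ud _ Ux); rewrite -hx in gx Ux.
  by have := thetaE rn Bh gx; rewrite theta_invK => ->.
exists (src0 g) => //; have := @theta_germ (theta_inv g) n alpha rn.
by rewrite theta_invK => ->.
Qed.

(** A neighbourhood of an arrow in G contains the part of a bisection over an open
    set of units, whose germs form a basic open set. *)
Lemma continuous_theta : continuous theta.
Proof.
apply/continuousP => W oW; rewrite openE => u Wu.
have [n [nn Bu]] := theta_over u; have rn := realizes_pair_map nn.
pose U := @src0 G @` (bisection_of n `&` W).
have oU : open U by apply: open_src0 => //; apply: openI => //; exact: open_bisection_of.
have oS : open ([set v | exists2 x, U x & germ_val v = germ ev (pair_map n) x] :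
    set (ra_weyl_groupoid A)).
  apply: germ_basis_open; exists (pair_map n), U; split=> //; first by exists n.
  by move=> _ [g [Bg _] <-]; exact: pair_dom_over.
have nS := open_nbhs_nbhs (conj oS (ex_intro2 _ _ (src0 (theta u))
  (ex_intro2 _ _ (theta u) (conj Bu Wu) erefl) (theta_germ rn Bu))).
have Fu : Filter (nbhs u) by exact: nbhs_filter.
apply: (@filterS _ _ Fu _ _ _ nS) => v [x [g [Bg Wg] <-] vg].
by rewrite /= (thetaE rn Bg vg).
Qed.

Lemma bisection_mul n m g h : normalizing n -> normalizing m -> bisection_of n g -> bisection_of m h ->
  src0 g = rng0 h -> bisection_of (pair_mul n m) (gmul g h).
Proof.
move=> nn nm Bg Bh gh; have [e eg re] := exists_represents nn Bg.
have [d dh rd] := exists_represents nm Bh; subst g h.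
by rewrite -piM //; apply/represents_bisection/represents_mul.
Qed.

Lemma theta_mul u v w : gd_prod u v w <->
  @gd_prod (groupoid_graph G) (theta u) (theta v) (theta w).
Proof.
split=> [[alpha [beta [y [[[n rn] [m rm]] [by_ aby] uE vE wE]]]]|[/gcomp0 c uvw]].
  have [nn tn] := (realizesP n alpha).1 rn; have [nm tm] := (realizesP m beta).1 rm.
  move: by_ aby; rewrite (proj1 tn) (proj1 tm) => /(pair_domP _ nm)[h Bh hy]; subst y.
  rewrite (proj2 tm _ Bh) in uE *; move=> /(pair_domP _ nn)[g Bg gh].
  have c : gcomp g h by apply/gcomp0.
  rewrite -gh in uE; rewrite (thetaE rn Bg uE) (thetaE rm Bh vE).
  have Bgh := bisection_mul nn nm Bg Bh gh.
  rewrite -(src0M gh) in wE; split=> //; apply/esym; apply: (thetaE _ Bgh wE).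
  by apply/realizesP; split; [exact: normalizing_mul|exact: traces_mul].
have [n [nn Bn]] := theta_over u; have [m [nm Bm]] := theta_over v.
have rn := realizes_pair_map nn; have rm := realizes_pair_map nm.
have tn := traces_pair_map nn; have tm := traces_pair_map nm.
exists (pair_map n), (pair_map m), (src0 (theta v)).
rewrite (proj2 tm _ Bm) -c; split.
- by split; [exists n|exists m].
- by split; exact: pair_dom_over.
- exact: (theta_germ rn Bn).
- exact: (theta_germ rm Bm).
- have rnm : realizes ev (pair_mul n m) (Defs.pcomp (pair_map n) (pair_map m)).
    by apply/realizesP; split; [exact: normalizing_mul|exact: traces_mul].
  have := @theta_germ w _ _ rnm; rewrite -uvw src0M //; apply.
  exact: bisection_mul.
Qed.

Lemma theta_inverse u v : gd_inv u v <->
  @gd_inv (groupoid_graph G) (theta u) (theta v).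
Proof.
split=> [[alpha [x [[n rn] dx uE vE]]]|/= uv].
  have [nn tn] := (realizesP n alpha).1 rn.
  move: dx; rewrite (proj1 tn) => /(pair_domP _ nn)[g Bg gx]; subst x.
  rewrite (proj2 tn _ Bg) -src0_inv in vE; rewrite /= (thetaE rn Bg uE); apply/esym.
  apply: (thetaE _ ((bisection_sharp n g).2 Bg) vE).
  by apply/realizesP; split; [exact: normalizing_sharp|exact: traces_sharp].
have [n [nn Bn]] := theta_over u; have rn := realizes_pair_map nn.
exists (pair_map n), (src0 (theta u)); split.
- by exists n.
- exact: pair_dom_over.
- exact: (theta_germ rn Bn).
- have rs : realizes ev (pair_sharp n) (pinverse (pair_map n)).
    by apply/realizesP; split; [exact: normalizing_sharp|apply: traces_sharp => //; exact: traces_pair_map].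
  rewrite (proj2 (traces_pair_map nn) _ Bn) -src0_inv.
  by have := @theta_germ v _ _ rs; rewrite -uv; apply; apply/bisection_sharp.
Qed.

Lemma theta_iso : groupoid_iso (theta : ra_weyl_groupoid A -> groupoid_graph G).
Proof.
split; [|exact: theta_mul|exact: theta_inverse].
exact: (homeomorphism_inverse thetaK theta_invK continuous_theta continuous_theta_inv).
Qed.

Lemma is_theta_theta : is_theta theta.
Proof.
move=> n alpha x u rn; have [nn tn] := (realizesP n alpha).1 rn.
rewrite (proj1 tn) => /(pair_domP _ nn)[g Bg <-] uE.
by rewrite (thetaE rn Bg uE).
Qed.

(** * Classes of pairs and elements of the twist *)

Lemma class_sub n m e : normalizing n -> normalizing m -> represents n e -> represents m e ->
  pair_class ev n (es e) `<=` pair_class ev m (es e).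
Proof.
move=> nn nm re re' q [/admissibleP nq dq qe wq]; split=> //; first exact/admissibleP.
rewrite qe in dq; have [d rd de] := pair_dom_represents nq dq.
have /(weyl_equivP nn nq re rd (esym de)) ed := wq; subst d.
exact/(weyl_equivP nm nq re' rd).
Qed.

(** A class of pairs over a unit amounts to an element of the twist, since
    equivalence is equality of the represented elements. *)
Lemma class_eq n m e d : normalizing n -> normalizing m -> represents n e -> represents m d ->
  pair_class ev n (es e) = pair_class ev m (es d) <-> e = d.
Proof.
move=> nn nm re rd; split=> [h|ed]; last first.
  by subst d; apply/seteqP; split; exact: class_sub.
have : pair_class ev m (es d) (m, es d).
  split=> //=; [exact/admissibleP|exact: represents_dom|].
  exact/(weyl_equivP nm nm rd rd).
rewrite -h => -[_ _ /= de]; rewrite -/(weyl_equiv ev n m (es e)).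
by move/(weyl_equivP nn nm re rd (esym de)).
Qed.

Lemma class_over (u : ra_weyl_twist A) : exists e, exists n,
  [/\ normalizing n, represents n e & arrow_val u = pair_class ev n (es e)].
Proof.
have [n [x [/admissibleP nn dx ux]]] := set_valP u.
have [e re ex] := pair_dom_represents nn dx.
by exists e, n; split=> //; rewrite ex.
Qed.

(** The element of the twist represented by any pair in the class. *)
Definition phi (u : ra_weyl_twist A) : E := projT1 (cid (class_over u)).

Lemma phiE u e n : normalizing n -> represents n e ->
  arrow_val u = pair_class ev n (es e) -> phi u = e.
Proof.
move=> nn re ue; rewrite /phi; case: cid => d [m [nm rd ud]] /=.
by apply/(class_eq nm nn rd re); rewrite -ud.
Qed.

Lemma phi_class u n : normalizing n -> represents n (phi u) ->
  arrow_val u = pair_class ev n (es (phi u)).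
Proof.
move=> nn; rewrite /phi; case: cid => d [m [nm rd ud]] /= re.
by rewrite ud; apply/(class_eq nm nn rd re).
Qed.

Lemma phi_over u : exists2 n, normalizing n & represents n (phi u).
Proof.
have [e [n [nn re ue]]] := class_over u; exists n => //.
by rewrite (phiE nn re ue).
Qed.

Lemma exists_phi e : exists u, phi u = e.
Proof.
have [n nn re] := exists_normalizing e.
have h : exists m x, [/\ admissible ev m, pair_dom ev m x &
    pair_class ev n (es e) = pair_class ev m x].
  by exists n, (es e); split=> //; [exact/admissibleP|exact: represents_dom].
exists (exist _ (pair_class ev n (es e)) (mem_set h)).
exact: (phiE nn re).
Qed.

Lemma phi_inj : injective phi.
Proof.
move=> u v uv; have [n nn re] := phi_over u.
have hu := phi_class nn re; rewrite uv in re; have hv := phi_class nn re.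
by apply: val_inj; rewrite -[LHS]/(arrow_val u) -[RHS]/(arrow_val v) hu hv uv.
Qed.

Definition phi_inv e : ra_weyl_twist A := projT1 (cid (exists_phi e)).

Lemma phi_invK : cancel phi_inv phi.
Proof. by move=> e; rewrite /phi_inv; case: cid. Qed.

Lemma phiK : cancel phi phi_inv.
Proof. by move=> u; apply: phi_inj; rewrite phi_invK. Qed.

(** The unit number by which c has to be multiplied to become positive. *)
Definition phase (c : R[i]) : R[i] := conjc c * ((nrm c)^-1)%:C.

Lemma phase_mul c : c != 0 -> phase c * c = (nrm c)%:C.
Proof.
move=> c0; have n0 : nrm c != 0 by rewrite nrm_eq0.
rewrite /phase mulrAC [conjc c * c]mulrC mulcJ -rmorphM; congr (_%:C).
by rewrite expr2 mulfK.
Qed.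

Lemma norm_phase c : c != 0 -> `|phase c| = 1.
Proof.
move=> c0; have n0 : nrm c != 0 by rewrite nrm_eq0.
by rewrite nrmE /phase cabsM cabsJ cabsR ger0_norm ?invr_ge0 ?nrm_ge0 // mulfV.
Qed.

Lemma phase_gt0 c : 0 < c -> phase c = 1.
Proof.
move=> c0; apply: (mulIf (lt0r_neq0 c0)).
by rewrite phase_mul ?lt0r_neq0 // mul1r -gtc0_cabs.
Qed.

Lemma phase_unique (z : circle R) (c : R[i]) : 0 < circle_val z * c -> circle_val z = phase c.
Proof.
move=> zc; have c0 : c != 0.
  by apply: contraTneq zc => ->; rewrite mulr0 ltxx.
apply: (mulIf c0); rewrite phase_mul // (gtc0_cabs zc).
by rewrite cabsM cabs_circle mul1r.
Qed.

Lemma cvg_phase (c : R[i]) : c != 0 -> phase d @[d --> c] --> phase c.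
Proof.
move=> c0; have Fc : Filter (nbhs c) by exact: nbhs_filter.
have c1 : (fun d : R[i] => (nrm d)^-1) @ c --> (nrm c)^-1.
  by apply: cvgV; [rewrite nrm_eq0|exact: continuous_nrm].
have c2 : (fun d : R[i] => ((nrm d)^-1)%:C) @ c --> ((nrm c)^-1)%:C.
  by apply: cvg_Complex; [exact: c1|exact: (@cvg_cst _ (0 : R) _ (nbhs c))].
have c3 : (fun d : R[i] => conjc d) @ c --> conjc c by exact: continuous_conjc.
exact: (cvgM c3 c2).
Qed.

(** Since b(e^-1) a(e) is positive on the bisection, positivity of z a(e) entails
    that of the second half. *)
Lemma represents_scale (z : circle R) n e : normalizing n -> bisection_of n (pi e) ->
  0 < circle_val z * j n.1 e -> represents (pair_scale z n) e.
Proof.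
have zE k (q : A) d : j (k *: q) d = k * j q d by rewrite fun_scale.
move=> nn /bisection_ofP[ae be] za; split; rewrite /= zE //.
have := normalizing_gt0 nn ae be; rewrite -[X in _ < X]mul1r -(circle_valMJ z).
by rewrite [circle_val z * _]mulrC mulrACA pmulr_lgt0.
Qed.

Lemma circle_phase c : c != 0 -> exists z : circle R, circle_val z = phase c.
Proof. by move=> c0; exists (mk_circle (norm_phase c0)). Qed.

Lemma phi_inv_class e n : normalizing n -> represents n e ->
  arrow_val (phi_inv e) = pair_class ev n (es e).
Proof. by move=> nn re; have := @phi_class (phi_inv e) n nn; rewrite phi_invK; apply. Qed.

Lemma pair_dom_scale z n : pair_dom ev (pair_scale z n) = pair_dom ev n.
Proof.
rewrite /pair_dom /= -ba_scaleAl -ba_scaleAr scalerA [conjc _ * _]mulrC circle_valMJ.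
by rewrite scale1r.
Qed.

Lemma bisection_scale z n e : represents (pair_scale z n) e ->
  bisection_of n (pi e) /\ circle_val z = phase (j n.1 e).
Proof.
have zE k (q : A) d : j (k *: q) d = k * j q d by rewrite fun_scale.
move=> [/=]; rewrite !zE => za zb; split; last exact: phase_unique.
by apply/bisection_ofP; split; [move: za|move: zb] => /lt0r_neq0; rewrite mulf_eq0 negb_or;
  case/andP.
Qed.

(** The preimage of a basic open set is described by the source and the phase of
    a, both continuous where a does not vanish. *)
Lemma continuous_phi_inv : continuous phi_inv.
Proof.
apply: (generates_continuous (@arrow_generates R A (units G) ev)) => S0.
move=> [n [U [V [/admissibleP nn [oU Ud] oV ->]]]].
have [V' oV' VE] := (open_set_typeP V).1 oV; subst V.
rewrite openE => e [x [z [Ux Vz ez]]].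
have nz := normalizing_scale z nn.
have := Ud _ Ux; rewrite -(pair_dom_scale z) => /(pair_dom_represents nz)[d rd dx].
subst x; have := phiE nz rd ez; rewrite phi_invK => ed; subst d.
have [Be ze] := bisection_scale rd; have [ae _] := (bisection_ofP n e).1 Be.
have Fe : Filter (nbhs e) by exact: nbhs_filter.
have n1 : \forall d \near e, U (es d).
  by apply: open_nbhs_nbhs; split=> //; apply: open_preimage => //; exact: continuous_es.
have n2 : \forall d \near e, bisection_of n (pi d).
  apply: open_nbhs_nbhs; split=> //; apply: open_preimage; last exact: open_bisection_of.
  exact: tw_pi_continuous.
have n3 : \forall d \near e, V' (phase (j n.1 d)).
  have c := @cvg_comp _ _ _ (j n.1) phase _ _ _ (@jcont n.1 e) (cvg_phase ae).
  by apply: c; apply: open_nbhs_nbhs; split=> //; rewrite -ze.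
apply: (@filterS3 _ _ Fe _ _ _ _ _ n1 n2 n3) => d Ud' Bd Vd.
have [ad _] := (bisection_ofP n d).1 Bd; have [w wd] := circle_phase ad.
exists (es d), w; split=> //; first by rewrite /= -[set_val w]/(circle_val w) wd.
apply: phi_inv_class; first exact: normalizing_scale.
by apply: represents_scale => //; rewrite wd phase_mul // ltcR nrm_gt0.
Qed.

(** Continuity of the circle action at (1, e), in terms of the distance of the
    circle element to 1. *)
Lemma act_near e (W : set E) : open W -> W e -> exists (dl : R) (N : set E),
  [/\ 0 < dl, open N, N e &
    forall (z : circle R) d, nrm (circle_val z - 1) < dl -> N d -> W (tw_act z d)].
Proof.
move=> oW We; have F1 : Filter (nbhs (circle_one : circle R)) by exact: nbhs_filter.
have Fe : Filter (nbhs e) by exact: nbhs_filter.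
have c : (fun q : circle R * E => tw_act q.1 q.2) @
    filter_prod (nbhs (circle_one : circle R)) (nbhs e) --> tw_act circle_one e.
  by apply: (cvg_act Gtop); [exact: cvg_fst|exact: cvg_snd].
have nW : nbhs (tw_act circle_one e) W by rewrite act1; exact: open_nbhs_nbhs.
have [[V N] /= [nV nN] VN] := c _ nW.
have [V1 [oV1 V11 V1V]] := nbhs_open nV; have [N1 [oN1 N1e N1N]] := nbhs_open nN.
have [V2 oV2 VE] := (open_set_typeP V1).1 oV1.
have V21 : V2 1 by move: V11; rewrite VE.
have n1 : \forall c \near (1 : R[i]), V2 c by exact: open_nbhs_nbhs.
have /nbhs_ballP [rho /= rho0 hV] := n1.
exists (nrm rho), N1; split=> //; first by rewrite nrm_gt0 lt0r_neq0.
move=> z d z1 Nd; apply: (VN (z, d)); split; last exact: N1N.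
apply: V1V; rewrite VE; apply: hV.
rewrite -ball_normE /ball_ /= (gtc0_cabs rho0) nrmE ltcR -nrmN opprB.
exact: z1.
Qed.

(** A basic open set of classes around u is obtained from units near s(e) and
    scalars near 1. Its members represent elements t . d, where d is near e = phi
    u and t corrects the phase; as the phase of a is 1 at e, t is near 1. *)
Lemma continuous_phi : continuous phi.
Proof.
apply/continuousP => W oW; rewrite openE => u Wu.
have [n nn re] := phi_over u; set e := phi u in re.
have [dl [N [dl0 oN Ne hN]]] := act_near oW Wu.
have Fe : Filter (nbhs e) by exact: nbhs_filter.
have [ae _] := re; have Be := represents_bisection re.
have n1 : \forall d \near e, N d by exact: open_nbhs_nbhs.
have n2 : \forall d \near e, bisection_of n (pi d).
  apply: open_nbhs_nbhs; split=> //; apply: open_preimage; last exact: open_bisection_of.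
  exact: tw_pi_continuous.
have dl2 : 0 < dl / 2 by rewrite divr_gt0.
have n3 : \forall d \near e, nrm (1 - phase (j n.1 d)) < dl / 2.
  have c := @cvg_comp _ _ _ (j n.1) phase _ _ _ (@jcont n.1 e) (cvg_phase (lt0r_neq0 ae)).
  by move: c => /cvg_nrm /(_ _ dl2); rewrite (phase_gt0 ae).
have [M [oM Me hM]] : exists M : set E, [/\ open M, M e & M `<=` [set d |
    [/\ N d, bisection_of n (pi d) & nrm (1 - phase (j n.1 d)) < dl / 2]]].
  by apply: nbhs_open; apply: (@filterS3 _ _ Fe _ _ _ _ _ n1 n2 n3) => d.
pose U := @es R G T @` M; pose V : set (circle R) := [set z | nrm (circle_val z - 1) < dl / 2].
have oU : open U by exact: open_es.
have Ud : U `<=` pair_dom ev n.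
  by move=> _ [d /hM[_ Bd _] <-]; exact: (pair_dom_over nn Bd).
have oV : open V.
  rewrite openE => z Vz; have Fz : Filter (nbhs z) by exact: nbhs_filter.
  have c1 : (fun w : circle R => circle_val w) @ z --> circle_val z.
    exact: continuous_circle_val.
  have c2 : (fun _ : circle R => 1 : R[i]) @ z --> (1 : R[i]).
    exact: (@cvg_cst _ (1 : R[i]) _ (nbhs z)).
  have c3 : (fun w : circle R => circle_val w - 1) @ z --> circle_val z - 1.
    exact: (cvgB c1 c2).
  have c : (fun w : circle R => nrm (circle_val w - 1)) @ z --> nrm (circle_val z - 1).
    by apply: (cvg_comp _ (@nrm R R[i]) c3); exact: continuous_nrm.
  have h : \forall w \near z, nrm (circle_val w - 1) < dl / 2.
    by apply: (cvgr_lt _ c); exact: Vz.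
  exact: h.
have V1 : V circle_one by rewrite /V /= subrr nrm0.
have oS : open ([set v | exists x z, [/\ U x, V z &
    arrow_val v = pair_class ev (pair_scale z n) x]] : set (ra_weyl_twist A)).
  by apply: arrow_basis_open; exists n, U, V; split=> //; exact/admissibleP.
have Su : exists x z, [/\ U x, V z & arrow_val u = pair_class ev (pair_scale z n) x].
  exists (es e), circle_one; split=> //; first by exists e.
  apply: phi_class; first exact: normalizing_scale.
  by apply: represents_scale => //; rewrite mul1r.
have nS := open_nbhs_nbhs (conj oS Su).
have Fu : Filter (nbhs u) by exact: nbhs_filter.
apply: (@filterS _ _ Fu _ _ _ nS) => v [_ [z [[d Md <-] Vz ve]]].
have [Nd Bd pd] := hM d Md; have [ad _] := (bisection_ofP n d).1 Bd.
(* The element over pi(d) represented by z . n is t . d with t the inverse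
    of z times the phase of a(d). *)
have [w wd] := circle_phase ad; pose t := circle_mul (circle_inv z) w.
have rt : represents (pair_scale z n) (tw_act t d).
  apply: represents_scale; rewrite ?pi_act // jact mulrA.
  rewrite circle_mulE circle_invE mulrA mulfV ?circle_neq0 // mul1r wd phase_mul //.
  by rewrite ltcR nrm_gt0.
have := phiE (normalizing_scale z nn) rt; rewrite es_act => /(_ _ ve) pv.
rewrite /= pv; apply: hN => //.
have -> : circle_val t - 1 = circle_val (circle_inv z) * (circle_val w - circle_val z).
  by rewrite mulrBr circle_mulE circle_invE mulVf ?circle_neq0.
rewrite cabsM cabs_circle mul1r wd (splitr dl).
have -> : phase (j n.1 d) - circle_val z = - (1 - phase (j n.1 d)) + - (circle_val z - 1).
  by rewrite !opprB addrA subrK.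
by apply: le_lt_trans (nrmD _ _) _; rewrite !nrmN ltrD.
Qed.

Lemma phi_mul u v w : gd_prod u v w <->
  @gd_prod (groupoid_graph (tw_E T)) (phi u) (phi v) (phi w).
Proof.
split=> [[n [m [alpha [x [[/admissibleP nn rm] [dm dn] uE vE wE]]]]]|[/gcompE c uvw]].
  have [nm tm] := (realizesP m alpha).1 rm.
  have [d rd dx] := pair_dom_represents nm dm; subst x.
  rewrite (traces_represents tm rd) in dn uE.
  have [e re ed] := pair_dom_represents nn dn; rewrite -ed in uE.
  rewrite (phiE nn re uE) (phiE nm rd vE).
  split; first exact/gcompE.
  rewrite -(esM ed) in wE; apply/esym.
  by apply: (phiE (normalizing_mul nn nm) _ wE); exact: represents_mul.
have [n nn rn] := phi_over u; have [m nm rm] := phi_over v.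
exists n, m, (pair_map m), (es (phi v)).
rewrite (traces_represents (traces_pair_map nm) rm) -c; split.
- by split; [exact/admissibleP|exact: realizes_pair_map].
- by split; exact: represents_dom.
- exact: phi_class.
- exact: phi_class.
- have := @phi_class w _ (normalizing_mul nn nm); rewrite -uvw esM //; apply.
  exact: represents_mul.
Qed.

Lemma phi_inverse u v : gd_inv u v <->
  @gd_inv (groupoid_graph (tw_E T)) (phi u) (phi v).
Proof.
split=> [[n [alpha [x [rn dn uE vE]]]]|/= uv].
  have [nn tn] := (realizesP n alpha).1 rn.
  have [e re ex] := pair_dom_represents nn dn; subst x.
  rewrite (traces_represents tn re) -es_inv in vE.
  rewrite /= (phiE nn re uE); apply/esym.
  exact: (phiE (normalizing_sharp nn) (represents_sharp re) vE).
have [n nn rn] := phi_over u.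
exists n, (pair_map n), (es (phi u)); split.
- exact: realizes_pair_map.
- exact: represents_dom.
- exact: phi_class.
- rewrite (traces_represents (traces_pair_map nn) rn) -es_inv.
  have := @phi_class v _ (normalizing_sharp nn); rewrite -uv; apply.
  exact: represents_sharp.
Qed.

Lemma phi_iso : groupoid_iso (phi : ra_weyl_twist A -> groupoid_graph (tw_E T)).
Proof.
split; [|exact: phi_mul|exact: phi_inverse].
exact: (homeomorphism_inverse phiK phi_invK continuous_phi continuous_phi_inv).
Qed.

Lemma is_weyl_i_phi : is_weyl_i (phi_inv \o tw_i T).
Proof.
move=> x z f f' ff' fx.
have := phi_inv_class (core_conj_normalizing ff') (core_conj_represents ff' fx).
by rewrite es_tw_i.
Qed.

Lemma is_weyl_pi_phi : is_weyl_pi (theta_inv \o pi \o phi).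
Proof.
move=> n alpha x u rn dn uE; have [nn tn] := (realizesP n alpha).1 rn.
have [e re ex] := pair_dom_represents nn dn; subst x.
have Be := represents_bisection re.
rewrite /= (phiE nn re uE); have := @theta_germ (theta_inv (pi e)) n alpha rn.
by rewrite theta_invK => /(_ Be).
Qed.

Lemma weyl_twist_iso :
  exists (iA : units G * circle R -> ra_weyl_twist A)
         (piA : ra_weyl_twist A -> ra_weyl_groupoid A)
         (theta : ra_weyl_groupoid A -> groupoid_graph G),
    [/\ is_weyl_i iA, is_weyl_pi piA,
        is_theta theta /\ groupoid_iso theta &
        exists phi : ra_weyl_twist A -> groupoid_graph (tw_E T),
          [/\ groupoid_iso phi,
              phi \o iA =1 tw_i T &
              tw_pi T \o phi =1 theta \o piA]].
Proof.
exists (phi_inv \o tw_i T), (theta_inv \o pi \o phi), theta; split.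
- exact: is_weyl_i_phi.
- exact: is_weyl_pi_phi.
- by split; [exact: is_theta_theta|exact: theta_iso].
- exists phi; split; first exact: phi_iso.
    by move=> q /=; rewrite phi_invK.
  by move=> u /=; rewrite theta_invK.
Qed.

End Pairs.

(** * The isomorphism theorem *)

(** The unit space may be empty; then every space in the statement is. *)
Lemma empty_groupoid_iso (D D' : groupoid_data) (f : D -> D') :
  (D -> False) -> (D' -> False) -> groupoid_iso f.
Proof.
move=> hD hD'; split; [split|by move=> g; case: (hD g)|by move=> g; case: (hD g)].
- by split=> [x|x|y]; [case: (hD x)|case: (hD x)|case: (hD' y)].
- by move=> x; case: (hD x).
- move=> W _; exists set0; first exact: open0.
  by apply/seteqP; split=> y; case: (hD' y).
Qed.

Local Close Scope complex_scope.

Theorem theorem7p19 (R : realType) (p : R) (hp1 : 1 <= p) (hp2 : p != 2)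
    (G : groupoid) (hG_top : topological_groupoid G)
    (hG_lc : locally_compact [set: G]) (hG_T2 : hausdorff_space G)
    (hG_etale : etale G) (hG_princ : topologically_principal G)
    (hG_compact : compact (@gunit G))
    (T : twist R G) (A : reduced_algebra T p) :
  exists (iA : units G * circle R -> ra_weyl_twist A)
         (piA : ra_weyl_twist A -> ra_weyl_groupoid A)
         (theta : ra_weyl_groupoid A -> groupoid_graph G),
    [/\ is_weyl_i iA, is_weyl_pi piA,
        is_theta theta /\ groupoid_iso theta &
        exists phi : ra_weyl_twist A -> groupoid_graph (tw_E T),
          [/\ groupoid_iso phi,
              phi \o iA =1 tw_i T &
              tw_pi T \o phi =1 theta \o piA]].
Proof.
have [[x0 _]|no] := pselect (exists x0 : units G, True); first exact: weyl_twist_iso.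
have hX (x : units G) : False by apply: no; exists x.
have hW (u : ra_weyl_twist A) : False by have [n [x _]] := set_valP u; exact: (hX x).
have hV (u : ra_weyl_groupoid A) : False by have [n [x _]] := set_valP u; exact: (hX x).
exists (fun q => False_rect _ (hX q.1)), (fun u => False_rect _ (hW u)),
  (fun u => False_rect _ (hV u)); split.
- by move=> x; case: (hX x).
- by move=> n alpha x; case: (hX x).
- split; first by move=> n alpha x; case: (hX x).
  by apply: empty_groupoid_iso => // g; exact: (hX (src0 g)).
exists (fun u => False_rect _ (hW u)); split.
- by apply: empty_groupoid_iso => // e; exact: (hX (es e)).
- by move=> [x z]; case: (hX x).
- by move=> u; case: (hW u).
Qed.
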